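(* Assume the following. (i) $f$ and $g$ are continuous. (ii) There are constants $\kappa>\frac12$, $C_\psi\ge 0$, $\alpha\ge 0$ such that for every $R\ge 0$ the function $\psi$ is Hölder on $I\times\{x\in E:|x|\le R\}$ with exponent $\kappa$ and a constant $K_R$, i.e. $|\psi(t,x)-\psi(s,y)|\le K_R(|t-s|^\kappa+|x-y|^\kappa)$ whenever $s,t\in I$, $|x|,|y|\le R$, and $K_R\le C_\psi(1+R^\alpha)$. (iii) $U$ is closed and convex. (iv) $\phi$ is continuous on $I\times E\times U$, convex in $u\in U$, and there are constants $C_\phi>0$, $\delta>0$, $r>1$ with $\phi(t,x,u)\ge C_\phi(|u|^r-|x|^\delta)$ for all $(t,x,u)\in I\times E\times U$. (v) $\xi\in E$ and there are nonnegative constants $C_s,C_e,\beta,\gamma$ such that for any control $u\in\mathcal U_r$ and any local solution $x$ of the state equation with control $u$ and initial condition $\xi$, $$\|\dot x\|_r\le C_s(1+\|u\|_r^\beta),\qquad \|x\|_\infty\le C_e(1+\|u\|_r^\gamma).$$ Further $\gamma(\alpha+\kappa-\frac12)+\frac\beta2<r$ and $\gamma\delta<r$. Suppose moreover that there is an admissible process $(x_0,u_0)$ with respect to $\xi$. Then for any observation path $\eta$, the problem of minimising $$A(x,u)=\int_I\phi(t,x(t),u(t))\,dt+\int_I\psi(t,x(t))\,d\eta(t)$$ over all admissible processes $(x,u)$ with respect to $\xi$ has a solution $(x_*,u_* )$. Further, $\|u_*\|_r<\infty$.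
   Context: $T>0$, $I=[0,T]$; $E$ is a finite-dimensional real vector space with norm $|\cdot|$; $d\in\mathbb N$; $U\subset E$ is the control set; $f:I\times E\to E$, $g:I\times E\to L(E,E)$, $\phi:I\times E\times E\to\mathbb R$, $\psi:I\times E\to L(\mathbb R^d,\mathbb R)$ are given functions. The state equation is $\dot x(t)=f(t,x(t))+g(t,x(t))u(t)$. A process with respect to $\xi$ is a pair $(x,u)$ with $u:I\to E$ measurable, $x:I\to E$ absolutely continuous, $x(0)=\xi$, and the state equation satisfied for a.e. $t\in I$. It is feasible if $u(t)\in U$ for a.e. $t\in I$; a feasible process is admissible if it has finite costs $A(x,u)$ (under the stated assumptions this does not depend on the observation path). A local solution is a solution of the state equation on a possibly smaller interval $[0,T_1]$, $T_1\le T$ (norms of $x,\dot x$ are then over $[0,T_1]$). $\|u\|_r=(\int_I|u(s)|^r ds)^{1/r}$, $\|u\|_\infty=\sup_{s\in I}|u(s)|$; $\mathcal U_r$ is the set of measurable $u:I\to E$ with $u(t)\in U$ a.e. and $\|u\|_r<\infty$. For $p\ge1$ the $p$-variation of a continuous function $x$ on $I$ is $[x]_p=(\sup\sum_i|x(t_{i+1})-x(t_i)|^p)^{1/p}$, the supremum being over finite dissections $0=t_0<\dots<t_n=T$. The Young integral $\int_I x\,dy$ is the limit of $\sum_i x(\tau_i)(y(t_{i+1})-y(t_i))$, $\tau_i\in[t_i,t_{i+1}]$, as the mesh of the dissections tends to $0$, required to exist independently of the choice of dissections and of the $\tau_i$. An observation path is a continuous function $\eta:I\to\mathbb R^d$ with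 $[\eta]_p<\infty$ for every $p>2$; integrals against $\eta$ are Young integrals. *)

(* Defs.v *)
(* The interval I = [0, T] is a subset of an arbitrary [R : realType]: functions
   on I are total functions on [R], and only their values on I matter.
   "Measurable" means Borel measurable; "almost everywhere" and integrals are
   with respect to [lebesgue_measure], so that the exceptional sets are all the
   Lebesgue null sets. *)
From HB Require Import structures.
From mathcomp Require Import all_boot all_order all_algebra.
From mathcomp Require Import all_classical all_reals all_analysis.

Set Implicit Arguments.
Unset Strict Implicit.
Unset Printing Implicit Defensive.

Import Order.TTheory GRing.Theory Num.Theory.
Import numFieldNormedType.Exports.

Local Open Scope classical_set_scope.
Local Open Scope ring_scope.

(* Finite-dimensional vector spaces with an arbitrary norm. *)
#[short(type="normedVectType")]
HB.structure Definition NormedVector (R : numFieldType) :=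
  {E of NormedModule R E & Vector R E}.

(* The library norm on these matrix spaces, hence on R^d, is the maximum norm;
   all notions below depend on the norm of R^d only up to equivalence. *)
HB.instance Definition _ (R : realType) (m n : nat) :=
  Vector.on 'M[R]_(m, n).
HB.instance Definition _ (R : realType) := Vector.on R^o.

Section Norms.
Context {R : realType}.

(* The set is nonempty, and bounded because [V] is finite-dimensional. *)
Definition opnorm (V W : normedVectType R) (A : 'Hom(V, W)) : R :=
  sup [set `|A v| | v in [set v : V | `|v| <= 1]].

Definition lfun_continuous_in (X : topologicalType) (V W : normedVectType R)
    (D : set X) (G : X -> 'Hom(V, W)) : Prop :=
  forall z, D z -> opnorm (G y - G z) @[y --> within D (nbhs z)] --> (0 : R).

Definition Lnorm_itv (V : normedModType R) (T r : R) (h : R -> V) : \bar R :=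
  ((\int[lebesgue_measure]_(t in `[0%R, T]) (`|h t| `^ r)%:E) `^ r^-1)%E.

Definition supnorm_itv (V : normedModType R) (T : R) (h : R -> V) : \bar R :=
  ereal_sup [set `|h t|%:E | t in `[0%R, T]].

End Norms.

Section AbsolutelyContinuous.
Context {R : realType} (V : normedModType R).

Definition absolutely_continuous (T : R) (x : R -> V) : Prop :=
  forall e : R, 0 < e -> exists2 del : R, 0 < del &
    forall (n : nat) (a b : 'I_n -> R),
      (forall i, [/\ 0 <= a i, a i <= b i & b i <= T]) ->
      trivIset [set: 'I_n] (fun i => `]a i, b i[%classic) ->
      \sum_i (b i - a i) < del ->
      \sum_i `|x (b i) - x (a i)| < e.

End AbsolutelyContinuous.

Section Young.
Context {R : realType}.

(* As in [itv_partition 0 T s], the dissection 0 = t_0 < ... < t_n = T is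
   represented by the list s = [t_1; ...; t_n]. *)
Definition knot (T : R) (s : seq R) (i : nat) : R := nth T (0 :: s) i.

Definition pvariation (V : normedModType R) (T p : R) (x : R -> V) : \bar R :=
  ((ereal_sup [set (\sum_(0 <= i < size s)
        `|x (knot T s i.+1) - x (knot T s i)| `^ p)%:E | s in itv_partition 0%R T])
    `^ p^-1)%E.

Variable d : nat.
Implicit Types (F : R -> 'Hom('rV[R]_d, R^o)) (eta : R -> 'rV[R]_d).

Definition observation_path (T : R) eta : Prop :=
  {within `[0, T], continuous eta} /\
  forall p : R, 2 < p -> (pvariation T p eta < +oo)%E.

Definition is_young_integral (T : R) F eta (l : R) : Prop :=
  forall e : R, 0 < e -> exists2 del : R, 0 < del &
    forall (s : seq R) (tau : nat -> R), itv_partition 0 T s ->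
      (forall i, (i < size s)%N -> knot T s i.+1 - knot T s i < del) ->
      (forall i, (i < size s)%N -> knot T s i <= tau i <= knot T s i.+1) ->
      `|\sum_(0 <= i < size s)
          F (tau i) (eta (knot T s i.+1) - eta (knot T s i)) - l| < e.

Definition young_integrable (T : R) F eta : Prop :=
  exists l, is_young_integral T F eta l.

(* The limit when it exists (it is then unique), an unspecified real otherwise. *)
Definition young_integral (T : R) F eta : R := get (is_young_integral T F eta).

End Young.

Section Control.
Context {R : realType} {E : normedVectType R} {d : nat}.
Variables (T : R) (U : set E).
Variables (f : R -> E -> E) (g : R -> E -> 'End(E)).
Variables (phi : R -> E -> E -> R) (psi : R -> E -> 'Hom('rV[R]_d, R^o)).
Implicit Types (x u : R -> E) (xi : E) (eta : R -> 'rV[R]_d).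

Definition measurable_control u : Prop :=
  measurable_fun (`[0, T] : set (measurableTypeR R))
    (u : _ -> g_sigma_algebraType (@open E)).

Definition control_constraint u : Prop :=
  {ae lebesgue_measure, forall t : R, t \in `[0, T] -> U (u t)}.

Definition control_class (r : R) u : Prop :=
  [/\ measurable_control u, control_constraint u & (Lnorm_itv T r u < +oo)%E].

Definition solution_upto (T1 : R) xi x u : Prop :=
  [/\ absolutely_continuous T1 x, x 0 = xi &
      {ae lebesgue_measure, forall t : R, t \in `[0, T1] ->
         is_derive t 1 x (f t (x t) + g t (x t) (u t))}].

Definition local_solution xi x u (T1 : R) : Prop :=
  0 < T1 <= T /\ solution_upto T1 xi x u.

Definition process xi x u : Prop :=
  measurable_control u /\ solution_upto T xi x u.

Definition feasible xi x u : Prop := process xi x u /\ control_constraint u.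

(* In the library the first integral is the difference of the integrals of the
   positive and negative parts, with +oo - +oo = -oo: it is finite exactly when
   both of these are.  It ignores null sets, in particular the times at which
   u(t) is not in U, where phi need not be measurable. *)
Definition cost eta x u : \bar R :=
  (\int[lebesgue_measure]_(t in `[0%R, T]) (phi t (x t) (u t))%:E
   + (young_integral T (fun t => psi t (x t)) eta)%:E)%E.

Definition finite_cost eta x u : Prop :=
  young_integrable T (fun t => psi t (x t)) eta /\ cost eta x u \is a fin_num.

Definition admissible xi eta x u : Prop :=
  feasible xi x u /\ finite_cost eta x u.

Definition minimiser xi eta x u : Prop :=
  admissible xi eta x u /\
  forall y v, admissible xi eta y v -> (cost eta x u <= cost eta y v)%E.

End Control.

(* Main.v *)
(* The direct method, along a non-principal ultrafilter F on nat for a minimising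
   sequence (x_n, u_n).

   Coercivity.  In the clock V(t) = t + C \int_0^t |x'| the integrand
   psi(t, x(t)) is a-Hoelder with a > 1/2 close to 1/2, so Young's estimate and
   the growth condition bound the Young integral by C (1 + |u|_r)^rho with
   rho < r.  The running cost therefore dominates and |u_n|_r is bounded.

   Compactness.  |x_n'|_r is bounded, so x_n -> x uniformly (Ascoli).  The u_n
   are equi-integrable, hence their coordinates converge weakly in L^1 to those
   of some u (the limits of their integrals over sets exist along F, and are
   absolutely continuous measures).  The state equation is affine in u and
   passes to the limit; so do the Young integrals, which are limits of Riemann
   sums uniformly in n.

   Lower semicontinuity.  The controls are quantised to finitely many values in
   U, and the weak limits of the frequencies of these values give a convex
   combination u^k in U.  By convexity \int phi(t, x, u^k) exceeds the limit of
   the costs by at most 2^-k, and u^k is 2^-k-close to u in L^1; thus u^k -> u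
   a.e. and Fatou's lemma applies. *)

Require Import Defs.
From HB Require Import structures.
From mathcomp Require Import all_boot all_order all_algebra.
From mathcomp Require Import all_classical all_reals all_analysis.
From mathcomp Require Import measurable_realfun ring lra.

Set Implicit Arguments.
Unset Strict Implicit.
Unset Printing Implicit Defensive.

Import Order.TTheory GRing.Theory Num.Theory.
Import numFieldNormedType.Exports.

Local Open Scope classical_set_scope.
Local Open Scope ring_scope.

(** * Ultrafilters and finite-dimensional coordinates *)

(** The growth condition comes from Young's requirement [a + 1/p > 1]: observation paths have finite
    [p]-variation for every [p > 2], so the integrand needs a Hoelder exponent [a > 1/2]. With
    exponent [a], the Young integral grows at most like the power
    [gamma (alpha + kappa - a) + beta a] of the control norm. At [a = 1/2] this is the quantity
    assumed to be below [r], and a slightly larger [a] still leaves it below [r]. Two obstacles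
    shape the rest. The cost [phi] is continuous only where the control lies in [U], so controls are
    altered on a null set to stay in [U] at all times. And weak convergence passes to the limit only
    in integrals that are linear in the control with bounded coefficients, while [phi] is merely
    convex. Quantisation turns [phi] into finitely many bounded functions of time, weighted by
    indicator functions that do have weak limits. Since all limits are taken along one fixed
    ultrafilter, no subsequence is ever extracted. *)

Lemma ultra_fmap (I J : Type) (h : I -> J) (F : set_system I) :
  UltraFilter F -> UltraFilter (h @ F).
Proof.
move=> FU; split; first exact: fmap_proper_filter.
move=> G GF sFG; rewrite predeqE => A; split; last exact: sFG.
move=> GA; have [//|FnA] := in_ultra_setVsetC (h @^-1` A) FU.
have GnA : G (~` A) by apply: sFG.
by have /filter_ex[z []] : G (A `&` ~` A) by exact: filterI.
Qed.

(** The image of an ultrafilter is an ultrafilter, hence converges in a compact set. As [F] never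
    changes, limits of different quantities combine without a diagonal argument. *)
Lemma ultra_compact_cvg (I : Type) (X : topologicalType) (K : set X)
    (h : I -> X) (F : set_system I) :
  UltraFilter F -> compact K -> (\forall n \near F, K (h n)) ->
  exists2 l, K l & h n @[n --> F] --> l.
Proof.
move=> FU; rewrite compact_ultra => cK FK.
by have [l [Kl hl]] := cK _ (ultra_fmap h FU) FK; exists l.
Qed.

Lemma cvg_sumr (K : numFieldType) (V : normedModType K) (T : Type)
    (F : set_system T) (I : finType) (h : I -> T -> V) (l : I -> V) :
  Filter F -> (forall i, h i x @[x --> F] --> l i) ->
  \sum_i h i x @[x --> F] --> \sum_i l i.
Proof.
move=> FF hl.
have -> : (fun x => \sum_i h i x) = \sum_i h i by apply/funext => x; rewrite fct_sumE.
elim/big_ind2 : _ => [|f1 l1 f2 l2 fl1 fl2|i _]; [exact: cvg_cst|exact: cvgD|exact: hl].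
Qed.

Section Coordinates.
Context {R : realType} {E : normedVectType R}.

Definition edim : nat := \dim {:E}.
Definition ecoord (i : 'I_edim) (w : E) : R := coord (vbasis {:E}) i w.
Definition ebasis (i : 'I_edim) : E := (vbasis {:E})`_i.

Lemma ecoord_sum (w : E) : w = \sum_i ecoord i w *: ebasis i.
Proof. exact: (coord_vbasis (memvf w)). Qed.

Lemma ecoordD i (v w : E) : ecoord i (v + w) = ecoord i v + ecoord i w.
Proof. exact: linearD. Qed.

Lemma ecoordB i (v w : E) : ecoord i (v - w) = ecoord i v - ecoord i w.
Proof. exact: linearB. Qed.

Lemma ecoordZ i a (w : E) : ecoord i (a *: w) = a * ecoord i w.
Proof. exact: linearZ. Qed.

Lemma ecoord0 i : ecoord i 0 = 0.
Proof. exact: linear0. Qed.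

Lemma ecoord_basis i j : ecoord i (ebasis j) = (j == i)%:R.
Proof. by rewrite /ecoord /ebasis coord_free// (basis_free (vbasisP _)). Qed.

Lemma ecoord_lincomb i (a : 'I_edim -> R) :
  ecoord i (\sum_j a j *: ebasis j) = a i.
Proof.
rewrite /ecoord linear_sum (bigD1 i)//= big1 ?addr0 => [|j ji].
  by rewrite linearZ/= -/(ecoord i _) ecoord_basis eqxx mulr1.
by rewrite linearZ/= -/(ecoord i _) ecoord_basis (negbTE ji) mulr0.
Qed.

Lemma eq_ecoord (v w : E) : (forall i, ecoord i v = ecoord i w) -> v = w.
Proof.
by move=> vw; rewrite (ecoord_sum v) (ecoord_sum w); under eq_bigr do rewrite vw.
Qed.

Let rV2e (v : 'rV[R]_edim) : E := \sum_i v 0 i *: ebasis i.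
Let e2rV (w : E) : 'rV[R]_edim := \row_i ecoord i w.

Let rV2eK : cancel rV2e e2rV.
Proof. by move=> v; apply/rowP => i; rewrite mxE ecoord_lincomb. Qed.

Let e2rVK : cancel e2rV rV2e.
Proof.
by move=> w; rewrite [RHS]ecoord_sum; apply: eq_bigr => i _; rewrite mxE.
Qed.

Let rV2e_continuous : continuous rV2e.
Proof.
move=> v; rewrite /rV2e; apply: (@cvg_sumr R E _ (nbhs v) _ (fun i (v : 'rV[R]_edim) => v 0 i *: ebasis i)) => i.
apply: cvgZr_tmp.
exact: coord_continuous.
Qed.

(* The norm attains a positive minimum on the unit sphere of the coordinate
   space. *)
Let coord_norm_bound : exists2 m : R, 0 < m & forall v, m * `|v| <= `|rV2e v|.
Proof.
pose S := [set v : 'rV[R]_edim | `|v| = 1].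
(* The sphere is empty only in dimension zero, where every vector vanishes and any constant will
   do. *)
have [S0|/set0P/negP/negPn/eqP S0] := pselect (S !=set0); last first.
  exists 1 => // v; have [->|v0] := eqVneq v 0.
    by rewrite normr0 mulr0.
  have : S (`|v|^-1 *: v).
    by rewrite /S/= normrZ normfV normr_id mulVf// normr_eq0.
  by rewrite S0.
have cS : compact S.
  apply: bounded_closed_compact.
    exists 1; split; first by rewrite num_real.
    by move=> M M1 v /= ->; exact: ltW.
  apply: (@closed_comp _ _ (fun v : 'rV[R]_edim => `|v|) [set 1]); last exact: closed_eq.
  by move=> v _; exact: norm_continuous.
have [|c cS' cmin] := @compact_EVT_min _ R (fun v => `|rV2e v|) S S0 cS.
  apply: continuous_subspaceT => v.
  by apply: (@continuous_comp _ _ _ rV2e Num.norm); [exact: rV2e_continuous|exact: norm_continuous].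
have c1 : `|c| = 1 by move: cS'; rewrite inE.
have c0 : 0 < `|rV2e c|.
  rewrite normr_gt0; apply/eqP => rc0.
  have : c = 0.
    rewrite -[c]rV2eK rc0; apply/rowP => i; rewrite !mxE; exact: ecoord0.
  by move=> c0; move: c1; rewrite c0 normr0 => /eqP; rewrite eq_sym oner_eq0.
exists (`|rV2e c|) => // v; have [->|v0] := eqVneq v 0.
  by rewrite normr0 mulr0.
have nv0 : 0 < `|v| by rewrite normr_gt0.
rewrite -ler_pdivlMr//.
have -> : `|rV2e v| / `|v| = `|rV2e (`|v|^-1 *: v)|.
  have -> : rV2e (`|v|^-1 *: v) = `|v|^-1 *: rV2e v.
    by rewrite /rV2e scaler_sumr; apply: eq_bigr => i _; rewrite mxE scalerA.
  by rewrite normrZ normfV normr_id mulrC.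
by apply: cmin; rewrite inE /S/= normrZ normfV normr_id mulVf// gt_eqF.
Qed.

Lemma ecoord_bounded : exists2 C : R, 1 <= C & forall i w, `|ecoord i w| <= C * `|w|.
Proof.
have [m m0 hm] := coord_norm_bound.
exists (Num.max 1 m^-1); first by rewrite le_max lexx.
move=> i w; apply: (@le_trans _ _ (m^-1 * `|w|)); last first.
  by rewrite ler_wpM2r// le_max lexx orbT.
rewrite ler_pdivlMl//; apply: le_trans (_ : m * `|e2rV w| <= _); last first.
  by apply: le_trans (hm _) _; rewrite e2rVK.
apply: ler_wpM2l; first exact: ltW.
have -> : ecoord i w = e2rV w 0 i by rewrite mxE.
have -> : `|e2rV w| = \big[Num.max/0]_ij `|e2rV w ij.1 ij.2| by exact: mx_normrE.
exact: (le_bigmax 0 (fun ij : (ordinal 1 * ordinal edim)%type => `|e2rV w ij.1 ij.2|) (0, i)).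
Qed.

Lemma ecoord_continuous i : continuous (ecoord i).
Proof.
have [C C1 hC] := ecoord_bounded.
have C0 : 0 < C by exact: lt_le_trans C1.
move=> w; apply/cvgrPdist_lt => e e0; near=> v.
rewrite -ecoordB; apply: le_lt_trans (hC i _) _.
rewrite -ltr_pdivlMl//; near: v.
by apply: cvgr_dist_lt; rewrite ?mulr_gt0 ?invr_gt0//; exact: cvg_id.
Unshelve. all: by end_near. Qed.

Lemma norm_le_ecoord : exists2 C : R, 1 <= C &
  forall w, `|w| <= C * \sum_i `|ecoord i w|.
Proof.
exists (1 + \sum_i `|ebasis i|) => [|w]; first by rewrite lerDl sumr_ge0.
rewrite {1}(ecoord_sum w); apply: le_trans (ler_norm_sum _ _ _) _.
rewrite mulr_sumr; apply: ler_sum => i _; rewrite normrZ mulrC ler_wpM2r//.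
by rewrite (bigD1 i)//= addrCA lerDl addr_ge0// sumr_ge0.
Qed.

(** The ball is the continuous image of its coordinate set, which is closed, and bounded by the
    lower estimate on [rV2e]. *)
Lemma closed_ball0_compact (M : R) : compact [set w : E | `|w| <= M].
Proof.
have [m m0 hm] := coord_norm_bound.
have -> : [set w : E | `|w| <= M] = rV2e @` [set v | `|rV2e v| <= M].
  apply/seteqP; split => [w /= wM|_ /= [v vM <-]//].
  by exists (e2rV w); rewrite /= e2rVK.
apply: continuous_compact; first exact: continuous_subspaceT.
apply: bounded_closed_compact.
  exists (M / m); split; first by rewrite num_real.
  move=> N MN v /= vM; apply: ltW; apply: le_lt_trans MN.
  by rewrite ler_pdivlMr// mulrC; apply: le_trans (hm v) vM.
apply: (@closed_comp _ _ (fun v => `|rV2e v|) [set x | x <= M]).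
  move=> v _; apply: (@continuous_comp _ _ _ rV2e Num.norm).
    exact: rV2e_continuous.
  exact: norm_continuous.
exact: closed_le.
Qed.

End Coordinates.
Arguments edim {R} E.
Arguments ecoord_bounded {R} E.
Arguments norm_le_ecoord {R} E.

(** * The operator norm *)

Section OperatorNorm.
Context {R : realType} {V W : normedVectType R}.

Lemma lfun_bounded (A : 'Hom(V, W)) : exists2 C : R, 0 <= C & forall v, `|A v| <= C * `|v|.
Proof.
have [C C1 hC] := ecoord_bounded V.
have C0 : 0 <= C by apply: le_trans C1.
exists (C * \sum_i `|A (ebasis i)|); first by rewrite mulr_ge0// sumr_ge0.
move=> v; rewrite {1}(ecoord_sum v) linear_sum; apply: le_trans (ler_norm_sum _ _ _) _.
rewrite mulrAC mulr_sumr; apply: ler_sum => i _.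
by rewrite linearZ/= normrZ ler_wpM2r.
Qed.

Let opnorm_ub (A : 'Hom(V, W)) :
  has_ubound [set `|A v| | v in [set v : V | `|v| <= 1]].
Proof.
have [C C0 hC] := lfun_bounded A.
exists C => _ [v v1 <-]; apply: le_trans (hC v) _.
by rewrite -[leRHS]mulr1 ler_wpM2l.
Qed.

Lemma opnorm_ge0 (A : 'Hom(V, W)) : 0 <= opnorm A.
Proof.
apply: ub_le_sup; first exact: opnorm_ub.
by exists 0; rewrite /= ?normr0 ?linear0 ?normr0.
Qed.

Lemma le_opnorm (A : 'Hom(V, W)) v : `|A v| <= opnorm A * `|v|.
Proof.
have [->|v0] := eqVneq v 0; first by rewrite linear0 !normr0 mulr0.
have nv0 : 0 < `|v| by rewrite normr_gt0.
rewrite -ler_pdivrMr//; apply: ub_le_sup; first exact: opnorm_ub.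
exists (`|v|^-1 *: v); first by rewrite /= normrZ normfV normr_id mulVf// gt_eqF.
by rewrite linearZ normrZ normfV normr_id mulrC.
Qed.

End OperatorNorm.

(** * Absolutely continuous functions *)

Section ZeroDerivative.
Context {R : realType}.
Notation mu := (@lebesgue_measure R).

Let le_mu (A B : set R) : measurable A -> measurable B -> A `<=` B ->
  (mu A <= mu B)%E.
Proof. by move=> mA mB AB; apply: le_measure; rewrite ?inE. Qed.

Lemma absolutely_continuousS (V : normedModType R) (T T1 : R) (x : R -> V) :
  T1 <= T -> absolutely_continuous T x -> absolutely_continuous T1 x.
Proof.
move=> T1T xac e e0; have [del del0 h] := xac e e0.
by exists del => // n a b ab; apply: h => i; have [? ? /le_trans->] := ab i.
Qed.

(** The induction below adds intervals on the right one at a time, which is simpler with increasing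
    sequences on [nat]; such a chain is a disjoint family in the sense of the definition. *)
Lemma absolutely_continuous_chain (V : normedModType R) (T : R) (x : R -> V) :
  absolutely_continuous T x -> forall e : R, 0 < e -> exists2 del : R, 0 < del &
    forall (n : nat) (a b : nat -> R),
      (forall i, (i < n)%N -> [/\ 0 <= a i, a i <= b i & b i <= T]) ->
      (forall i j, (i < j)%N -> (j < n)%N -> b i <= a j) ->
      \sum_(i < n) (b i - a i) < del ->
      \sum_(i < n) `|x (b i) - x (a i)| < e.
Proof.
move=> xac e e0; have [del del0 h] := xac e e0; exists del => // n a b ab sab sum.
apply: (h n (fun i : 'I_n => a i) (fun i : 'I_n => b i)) => //.
  by move=> i; exact: ab.
apply/trivIsetP => i j _ _.
wlog ij : i j / (i < j)%N.
  move=> hw; case: (ltngtP i j) => [ij|ji|/val_inj->]; [exact: hw| |by rewrite eqxx].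
  by rewrite setIC eq_sym; exact: hw.
move=> _; apply/seteqP; split=> // t [] /=; rewrite !in_itv/= => /andP[_ tb] /andP[ta _].
by have := lt_trans ta tb; rewrite ltNge (sab _ _ ij).
Qed.

(** Accounting device: an interval inside [Ob] is paid for by the growth of the measure of [Ob] up
    to its right end, so the total length of successive intervals stays below the measure of
    [Ob]. *)
Lemma lebesgue_measureI_itvcc (Ob : set R) (s t : R) : open Ob ->
  (mu Ob < +oo)%E -> 0 <= s -> s <= t -> `]s, t] `<=` Ob ->
  fine (mu (Ob `&` `[0, s])) + (t - s) <= fine (mu (Ob `&` `[0, t])).
Proof.
move=> oO Ofin s0 st sO; have mO : measurable Ob by exact: open_measurable.
have mI (u : R) : measurable (Ob `&` `[0, u]) by exact: measurableI.
have fI (u : R) : mu (Ob `&` `[0, u]) \is a fin_num.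
  rewrite ge0_fin_numE//; apply: le_lt_trans Ofin.
  by apply: le_mu => //; exact: subIsetl.
rewrite -lee_fin EFinD !fineK//.
have <- : mu (`]s, t]) = (t - s)%:E.
  rewrite lebesgue_measure_itv/= lte_fin; have [|] := ltP s t => //.
  by move=> ts; have -> : s = t by [apply/eqP; rewrite eq_le st]; rewrite subrr.
have dis : (Ob `&` `[0, s]) `&` `]s, t] = set0.
  apply/seteqP; split=> // u [[_ /=]]; rewrite !in_itv/= => /andP[_ us] /andP[su _].
  by have := le_lt_trans us su; rewrite ltxx.
rewrite -(measureU mu (mI s) (measurable_itv _) dis).
apply: le_mu => //; first exact: measurableU.
move=> u [[Ou /=]|/= ust].
  by rewrite in_itv/= => /andP[u0 us]; split=> //=; rewrite in_itv/= u0 (le_trans us).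
split; first exact: sO.
move: ust; rewrite /= !in_itv/= => /andP[su ->]; rewrite andbT.
by apply/ltW: (le_lt_trans s0 su).
Qed.

Lemma derive0_near (y : R -> R) (s e : R) : 0 < e ->
  is_derive s 1 (y : R -> R^o) 0 -> exists2 d : R, 0 < d &
    forall v, `|v - s| < d -> `|y v - y s| <= e * `|v - s|.
Proof.
move=> e0 [dy dy0].
have : h^-1 *: ((y \o shift s) (h *: 1) - y s) @[h --> (0 : R)^'] --> (0 : R^o).
  by rewrite -[X in _ --> X]dy0; exact: dy.
move=> /cvgrPdist_lt /(_ e e0); rewrite near_withinE => /nbhs_ballP[d /= d0 hd].
exists d => // v vs; have [->|vs0] := eqVneq v s; first by rewrite !subrr normr0 mulr0.
have vs1 : 0 < `|v - s| by rewrite normr_gt0 subr_eq0.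
have : `|0 - (v - s)^-1 *: (y ((v - s) *: 1 + s) - y s)| < e.
  by apply: hd; rewrite ?subr_eq0// /ball/= sub0r normrN.
rewrite sub0r normrN [_ *: 1]mulr1 subrK => /ltW.
by rewrite normrZ normfV ler_pdivrMl// mulrC.
Qed.

(* Real induction: the increment of y over [0,t] is at most e*t, plus the
   increments over finitely many non-overlapping intervals inside an open set Ob
   of small measure containing the exceptional null set. *)
Lemma ac_derive0_cst (T : R) (y : R -> R) : 0 <= T ->
  absolutely_continuous T (y : R -> R^o) ->
  {ae mu, forall t : R, t \in `[0, T] -> is_derive t 1 (y : R -> R^o) 0} ->
  y T = y 0.
Proof.
move=> T0 yac [A [mA A0 AE]].
suff h : forall e : R, 0 < e -> `|y T - y 0| <= e * T + e.
  apply/eqP; rewrite -subr_eq0 -normr_le0; apply/ler_addgt0Pl => e e0.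
  have T1 : 0 < T + 1 by rewrite ltr_wpDl.
  have /h : 0 < e / (T + 1) by rewrite divr_gt0.
  move/le_trans; apply; rewrite addr0 -[X in _ + X]mulr1 -mulrDr.
  by rewrite mulfVK// gt_eqF.
move=> e e0; have [del del0 hdel] := absolutely_continuous_chain yac e0.
have [Ob [oO AO muO]] : exists U : set R, [/\ open U , A `<=` U & (mu (U `\` A) < del%:E)%E].
  by apply: lebesgue_regularity_outer => //; exact: (eq_ind_r (fun z => (z < +oo)%E) (ltry 0) A0).
have mO : measurable Ob by exact: open_measurable.
have Odel : (mu Ob < del%:E)%E.
  apply: le_lt_trans muO; have -> : mu Ob = (mu (Ob `\` A) + mu A)%E.
    have dis : (Ob `\` A) `&` A = set0 by rewrite setDE -setIA setICl setI0.
    by rewrite -(measureU mu (measurableD mO mA) mA dis) setUC setDUK.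
  by rewrite [X in (_ + X)%E](_ : _ = 0%E) ?adde0//; exact: A0.
have Ofin : (mu Ob < +oo)%E by apply: lt_trans Odel _; rewrite ltry.
pose l t := fine (mu (Ob `&` `[0, t])).
pose P (t : R) := exists (n : nat) (a b : nat -> R),
  [/\ forall i, (i < n)%N -> [/\ 0 <= a i, a i <= b i & b i <= t],
      forall i j, (i < j)%N -> (j < n)%N -> b i <= a j,
      \sum_(i < n) (b i - a i) <= l t &
      `|y t - y 0| <= e * t + \sum_(i < n) `|y (b i) - y (a i)|].
have P0 : P 0.
  exists 0%N, (fun=> 0), (fun=> 0); split => //.
    by rewrite big_ord0 fine_ge0.
  by rewrite big_ord0 subrr normr0 mulr0 addr0.
have lS s t : 0 <= s -> s <= t -> `]s, t] `<=` Ob -> l s + (t - s) <= l t.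
  exact: lebesgue_measureI_itvcc.
have l_nd s t : s <= t -> l s <= l t.
  move=> st; have mI (u : R) : measurable (Ob `&` `[0, u]) by exact: measurableI.
  have fI (u : R) : mu (Ob `&` `[0, u]) \is a fin_num.
    rewrite ge0_fin_numE//; apply: le_lt_trans Ofin.
    by apply: le_mu => //; exact: subIsetl.
  apply: fine_le => //; apply: le_mu => //; apply: setIS.
  by apply: subset_itvl; rewrite bnd_simp.
have stepE s t : 0 <= s -> s <= t -> `|y t - y s| <= e * (t - s) -> P s -> P t.
  move=> s0 st yst [n [a [b [ab sab suml sumy]]]]; exists n, a, b; split => //.
  - by move=> i /ab[? ? /le_trans->].
  - by apply: le_trans suml (l_nd _ _ st).
  - have -> : y t - y 0 = (y t - y s) + (y s - y 0) by rewrite addrA subrK.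
    apply: le_trans (ler_normD _ _) _; apply: le_trans (lerD yst sumy) _.
    by rewrite addrA -mulrDr subrK.
have stepO s t : 0 <= s -> s <= t -> `]s, t] `<=` Ob -> P s -> P t.
  move=> s0 st sO [n [a [b [ab sab suml sumy]]]].
  exists n.+1, (fun i => if i == n then s else a i), (fun i => if i == n then t else b i).
  have nE i : (i < n)%N -> (i == n) = false by move=> /ltn_eqF.
  split => [i|i j ij|  |].
  - rewrite ltnS leq_eqVlt => /orP[/eqP->|ilt]; rewrite ?eqxx ?(nE _ ilt)//.
    by have [? ? /le_trans->] := ab _ ilt.
  - rewrite ltnS leq_eqVlt => /orP[/eqP jn|jlt].
      by rewrite jn eqxx nE -?jn//; have [_ _] := ab i (eq_ind _ (fun k => (i < k)%N) ij _ jn).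
    by rewrite !nE//; [exact: sab|exact: ltn_trans jlt].
  - rewrite big_ord_recr/= eqxx; under eq_bigr => i _ do rewrite nE//.
    by apply: le_trans (lS _ _ s0 st sO); rewrite lerD2r.
  - rewrite big_ord_recr/= eqxx; under eq_bigr => i _ do rewrite nE//.
    have -> : y t - y 0 = (y s - y 0) + (y t - y s) by ring.
    apply: le_trans (ler_normD _ _) _; rewrite addrA lerD2r; apply: le_trans sumy _.
    by rewrite lerD2r ler_wpM2l// ltW.
pose S := [set t | 0 <= t <= T /\ P t].
have S0 : S 0 by split; rewrite ?lexx.
have hS : has_sup S by split; [exists 0|exists T => t [/andP[]]].
pose s := sup S.
have s0 : 0 <= s by apply: ub_le_sup => //; exact: (proj2 hS).
have sT : s <= T by apply: ge_sup; [exists 0|move=> t [/andP[]]].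
(* Crossing the supremum: if [s] is exceptional, a neighbourhood of it lies in [Ob] and the whole of
   []t, v]] joins the family; otherwise the derivative at [s] vanishes, and the increment from [t]
   to [v] is split at [s]. *)
have [d d0 hd] : exists2 d : R, 0 < d & forall t v, 0 <= t -> t <= s -> s <= v ->
    `|t - s| < d -> `|v - s| < d -> P t -> P v.
  have [sA|sA] := pselect (A s).
    have /nbhs_ballP[d /= d0 hd] : nbhs s Ob by apply: open_nbhs_nbhs; split=> //; exact: AO.
    exists d => // t v t0 ts sv td vd; apply: stepO => //; first exact: le_trans sv.
    move=> u /=; rewrite in_itv/= => /andP[tu uv]; apply: hd => /=; rewrite /ball/=.
    rewrite ltr_norml in td; rewrite ltr_norml in vd; rewrite ltr_norml.
    by move: td vd => /andP[? ?] /andP[? ?]; apply/andP; split; lra.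
  have ders : is_derive s 1 (y : R -> R^o) 0.
    apply: contrapT => nd; apply: sA; apply: AE => /= /(_ _) h; apply: nd; apply: h.
    by rewrite in_itv/= s0 sT.
  have [d d0 hd] := derive0_near e0 ders.
  exists d => // t v t0 ts sv td vd; apply: stepE => //; first exact: le_trans sv.
  have -> : y v - y t = (y v - y s) - (y t - y s) by rewrite opprB addrA subrK.
  apply: le_trans (ler_normB _ _) _; apply: le_trans (lerD (hd _ vd) (hd _ td)) _.
  rewrite -mulrDr ler_wpM2l//; first exact: ltW.
  by rewrite ger0_norm ?subr_ge0// distrC ger0_norm ?subr_ge0//; lra.
have [t [/andP[t0 tT] Pt] st] := sup_adherent d0 hS.
have ts : t <= s by apply: ub_le_sup; [exact: (proj2 hS)|split=> //; rewrite t0].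
have td : `|t - s| < d by rewrite distrC ger0_norm ?subr_ge0// ltrBlDr -ltrBlDl.
have sTE : s = T.
  apply/eqP; rewrite eq_le sT leNgt; apply/negP => sltT.
  pose v := Num.min T (s + d / 2).
  have sv : s < v by rewrite lt_min sltT ltrDl divr_gt0.
  have /(ub_le_sup (proj2 hS)) : S v.
    split; first by rewrite (le_trans s0 (ltW sv))/= ge_min lexx.
    apply: (hd t) => //; first exact: ltW.
    rewrite ger0_norm ?subr_ge0 ?(ltW sv)// ltrBlDl.
    by apply: (@le_lt_trans _ _ (s + d / 2)); [rewrite ge_min lexx orbT|rewrite ltrD2l ltr_pdivrMr// ltr_pMr// ltr1n].
  by rewrite -/s leNgt sv.
have : P T by apply: (hd t) => //; rewrite -sTE ?subrr ?normr0.
move=> [n [a [b [ab sab suml sumy]]]].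
apply: le_trans sumy _; rewrite lerD2l; apply/ltW/hdel => //.
apply: le_lt_trans suml _; rewrite -lte_fin.
have lO : (mu (Ob `&` `[0%R, T]) <= mu Ob)%E.
  by apply: le_mu; [exact: measurableI|exact: mO|exact: subIsetl].
by rewrite fineK ?ge0_fin_numE//; [exact: le_lt_trans lO Odel|exact: le_lt_trans lO Ofin].
Qed.

End ZeroDerivative.

(** * Primitives of integrable functions and the fundamental theorem of calculus *)

Section Primitive.
Context {R : realType}.
Notation mu := (@lebesgue_measure R).
Implicit Types (T s t : R) (h x : R -> R).

Lemma ae_mono (P Q : R -> Prop) : (forall t, P t -> Q t) ->
  {ae mu, forall t, P t} -> {ae mu, forall t, Q t}.
Proof. by move=> PQ; apply: (@filterS _ _ (ae_filter_ringOfSetsType mu)). Qed.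

Lemma ae_and (P Q : R -> Prop) : {ae mu, forall t, P t} ->
  {ae mu, forall t, Q t} -> {ae mu, forall t, P t /\ Q t}.
Proof. exact: (@filterI _ _ (ae_filter_ringOfSetsType mu)). Qed.

Lemma ae_neq (a : R) : {ae mu, forall t : R, t != a}.
Proof.
exists [set a]; split; [exact: measurable_set1|exact: lebesgue_measure_set1|].
by move=> t /= /negP/negPn/eqP.
Qed.

Lemma integrable_itvS T h (s t : R) : mu.-integrable `[0, T] (EFin \o h) ->
  0 <= s -> t <= T -> mu.-integrable `]s, t] (EFin \o h).
Proof.
move=> hi s0 tT; apply: integrableS hi => //.
by apply: subset_itvScc; rewrite bnd_simp.
Qed.

Lemma RintegralcB T h s t : mu.-integrable `[0, T] (EFin \o h) ->
  0 <= s -> s <= t -> t <= T ->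
  \int[mu]_(z in `[0, t]) h z - \int[mu]_(z in `[0, s]) h z = \int[mu]_(z in `]s, t]) h z.
Proof.
move=> hi s0 st tT; apply: Rintegral_itvB; rewrite ?bnd_simp//.
by apply: integrableS hi => //; apply: subset_itvl; rewrite bnd_simp.
Qed.

(** Absolute continuity of the integral of [|h|], applied to the union of the intervals: its measure
    is their total length, and each increment is bounded by the integral over its piece. *)
Lemma primitive_absolutely_continuous T h : mu.-integrable `[0, T] (EFin \o h) ->
  absolutely_continuous T (fun t => \int[mu]_(z in `[0, t]) h z : R^o).
Proof.
move=> hi e e0.
have hiT : mu.-integrable setT (EFin \o (h \_ `[0, T])).
  have := hi; rewrite integrable_mkcond// restrict_EFin; exact.
have [del [del0 hdel]] := integral_normr_continuous hiT e0.
exists del => // n a b ab tri sum.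
pose F (i : 'I_n) := `]a i, b i[%classic : set R.
pose B := \big[setU/set0]_(i < n) F i.
have mF i : measurable (F i) by exact: measurable_itv.
have mB : measurable B by exact: bigsetU_measurable.
have FT i : F i `<=` `[0, T].
  by have [? ? ?] := ab i; apply: subset_itvScc; rewrite bnd_simp.
have triF : trivIset [set` index_enum 'I_n] F.
  by apply: sub_trivIset tri.
have muB : mu B = (\sum_(i < n) (b i - a i))%:E.
  rewrite /B measure_semi_additive_ord//= -?sumEFin.
  apply: eq_bigr => i _; rewrite lebesgue_measure_itv/= lte_fin.
  have [_ + _] := ab i; rewrite le_eqVlt => /orP[/eqP->|->//].
  by rewrite ltxx subrr.
have hB : (mu B < del%:E)%E by rewrite muB lte_fin.
apply: le_lt_trans (hdel B mB hB).
have hnT : mu.-integrable setT (EFin \o (fun z => `|(h \_ `[0, T]) z|)).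
  exact: integrable_norm.
have hnF i : mu.-integrable (F i) (EFin \o (fun z => `|(h \_ `[0, T]) z|)).
  by apply: integrableS hnT => //; exact: mF.
have -> : \int[mu]_(z in B) `|(h \_ `[0, T]) z| =
    \sum_(i < n) \int[mu]_(z in F i) `|(h \_ `[0, T]) z|.
  apply: EFin_inj; rewrite -sumEFin /Rintegral fineK; last first.
    by apply: integrable_fin_num => //; apply: integrableS hnT.
  rewrite (@ge0_integral_bigsetU _ _ _ mu _ F _ _ mF (index_enum_uniq _) triF).
  - by apply: eq_bigr => i _; rewrite fineK//; apply: integrable_fin_num => //; exact: mF.
  - by apply: measurable_funTS; exact: measurable_int hnT.
  - by move=> z _; rewrite lee_fin.
apply: ler_sum => i _; have [ai0 aib biT] := ab i.
rewrite (RintegralcB hi)//; apply: le_trans (le_normr_Rintegral _ _) _ => //.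
  exact: integrable_itvS hi _ _.
have hFi : mu.-integrable (F i) (EFin \o h).
  by apply: integrableS hi => //; exact: mF.
rewrite -Rintegral_itv_bndo_bndc; last exact: (integrable_norm hFi).
rewrite le_eqVlt; apply/orP; left; apply/eqP; apply: eq_Rintegral => z zF.
by rewrite patchE ifT// inE; apply: (FT i); exact: (set_mem zF).
Qed.

Lemma primitive_derive T h : mu.-integrable `[0, T] (EFin \o h) ->
  {ae mu, forall t, t \in `[0, T] ->
    is_derive t 1 (fun t => \int[mu]_(z in `[0, t]) h z : R^o) (h t)}.
Proof.
move=> hi.
have hiT : mu.-integrable setT (EFin \o (h \_ `[0, T])).
  by have := hi; rewrite integrable_mkcond// restrict_EFin; exact.
have hl : locally_integrable [set: R] (h \_ `[0, T]) by exact: integrable_locally_restrict.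
have hic y : mu.-integrable [set` Interval (BLeft 0) (BRight y)] (EFin \o (h \_ `[0, T])).
  by apply: integrableS hiT.
(* The end points are discarded: the derivative is two-sided, and only inside []0, T[] does the
   primitive of [h] agree near [t] with that of its extension by zero. *)
have := ae_and (FTC1 hic hl) (ae_and (ae_neq 0) (ae_neq T)).
apply: ae_mono => t [ht [t0 tT]].
rewrite in_itv/= => /andP[t0' tT'].
have {}t0 : 0 < t by rewrite lt_neqAle eq_sym t0.
have {}tT : t < T by rewrite lt_neqAle tT.
have [dF F't] := ht (ltac:(rewrite /= lte_fin; exact: t0)).
have dE : is_derive t 1 (fun x : R => \int[mu]_(t in `[0, x]) (h \_ `[0, T]) t : R^o) (h t).
  split; first exact: dF.
  by rewrite -derive1E F't patchE ifT// inE/= in_itv/= !ltW.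
apply: near_eq_is_derive dE; near=> s.
apply: eq_Rintegral => z; rewrite inE/= in_itv/= => /andP[z0 zs].
rewrite patchE ifT// inE/= in_itv/= z0/= (le_trans zs)//; near: s.
apply/nbhs_ballP; exists (T - t); rewrite /= ?subr_gt0// => v.
by rewrite /ball/= ltr_norml => /andP[? ?]; lra.
Unshelve. all: by end_near. Qed.

(** The difference between [x] and the primitive of [h] is absolutely continuous with derivative
    zero almost everywhere, hence constant. *)
Lemma ac_is_derive_integral T h x : mu.-integrable `[0, T] (EFin \o h) ->
  absolutely_continuous T (x : R -> R^o) ->
  {ae mu, forall t, t \in `[0, T] -> is_derive t 1 (x : R -> R^o) (h t)} ->
  forall s t, 0 <= s -> s <= t -> t <= T -> x t - x s = \int[mu]_(z in `]s, t]) h z.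
Proof.
move=> hi xac dx s t s0 st tT.
have h0 v : 0 <= v -> v <= T -> x v - x 0 = \int[mu]_(z in `[0, v]) h z.
  move=> v0 vT.
  pose y (w : R) := x w - \int[mu]_(z in `[0, w]) h z.
  have : y v = y 0.
    apply: ac_derive0_cst => //.
      move=> e e0; have e2 : 0 < e / 2 by rewrite divr_gt0.
      have [d1 d10 h1] := absolutely_continuousS vT xac e2.
      have [d2 d20 h2] := absolutely_continuousS vT (primitive_absolutely_continuous hi) e2.
      exists (Num.min d1 d2); first by rewrite lt_min d10.
      move=> n a b ab tri; rewrite lt_min => /andP[ltd1 ltd2].
      rewrite (splitr e); apply: le_lt_trans (ltrD (h1 n a b ab tri ltd1) (h2 n a b ab tri ltd2)).
      rewrite -big_split/=; apply: ler_sum => i _; rewrite /y.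
      set A := \int[mu]_(z in _) _; set B := \int[mu]_(z in _) _.
      have -> : x (b i) - A - (x (a i) - B) = (x (b i) - x (a i)) - (A - B) by ring.
      exact: ler_normB.
    have := ae_and dx (primitive_derive hi); apply: ae_mono => w [dw1 dw2].
    rewrite in_itv/= => /andP[w0 wv]; have wT : w \in `[0, T] by rewrite in_itv/= w0 (le_trans wv).
    have := is_deriveB (dw1 wT) (dw2 wT); rewrite subrr.
    by apply.
  by rewrite /y set_itv1 Rintegral_set1 subr0 => <-; ring.
have sT : s <= T by exact: le_trans tT.
have t0 : 0 <= t by exact: le_trans st.
rewrite -(RintegralcB hi)// -(h0 _ t0 tT) -(h0 _ s0 sT); ring.
Qed.

End Primitive.

(** * Weak compactness in L^1 *)

Section UltraDensity.
Context {R : realType} {I : Type}.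
Notation mu := (@lebesgue_measure R).
Variables (F : set_system I) (m : I -> set R -> R) (M : R) (D : set R).
Hypotheses (FU : UltraFilter F) (mD : measurable D) (Dfin : (mu D < +oo)%E).
Hypothesis m_bound : forall n A, measurable A -> 0 <= m n A <= M.
Hypothesis m_add : forall n A B, measurable A -> measurable B ->
  A `&` B = set0 -> m n (A `|` B) = m n A + m n B.
Hypothesis m_supp : forall n A, measurable A -> m n A = m n (A `&` D).
Hypothesis m_ac : forall e : R, 0 < e -> exists2 del : R, 0 < del &
  forall n A, measurable A -> (mu A < del%:E)%E -> m n A < e.

(** The default value 0 on non-measurable sets keeps the function nonnegative on all sets, as the
    measure structure requires. *)
Let ul (A : set R) : R := if `[< measurable A >] then lim (m n A @[n --> F]) else 0.

Let ul_cvg A : measurable A -> m n A @[n --> F] --> ul A.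
Proof.
move=> mA; rewrite /ul asboolT//.
have [l _ hl] : exists2 l, `[0, M]%classic l & m n A @[n --> F] --> l.
  apply: ultra_compact_cvg FU (@segment_compact _ 0 M) _.
  by apply: nearW => n /=; rewrite in_itv/= m_bound.
by apply/cvg_ex; exists l.
Qed.

Let FF : ProperFilter F. Proof. exact: ultra_proper. Qed.

Let ul_ge0 A : 0 <= ul A.
Proof.
have [mA|mA] := pselect (measurable A); last by rewrite /ul asboolF.
apply: (cvgr_to_ge (ul_cvg mA)); apply: nearW => n.
by have /andP[] := m_bound n mA.
Qed.

Let ul_le A c : measurable A -> (forall n, m n A <= c) -> ul A <= c.
Proof. by move=> mA h; apply: (cvgr_to_le (ul_cvg mA)); apply: nearW. Qed.

Let m0 n : m n set0 = 0.
Proof.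
have := @m_add n set0 set0 measurable0 measurable0; rewrite setU0 setI0 => /(_ erefl) /eqP.
by rewrite -subr_eq subrr eq_sym => /eqP.
Qed.

Let ul0 : ul set0 = 0.
Proof.
by apply/eqP; rewrite eq_le ul_ge0 andbT; apply: ul_le => // n; rewrite m0.
Qed.

Let ulU A B : measurable A -> measurable B -> A `&` B = set0 ->
  ul (A `|` B) = ul A + ul B.
Proof.
move=> mA mB AB; apply: (@cvg_unique _ _ (m n (A `|` B) @[n --> F])).
- exact: Rhausdorff.
- by apply: ul_cvg; exact: measurableU.
- have -> : (fun n => m n (A `|` B)) = (fun n => m n A + m n B).
    by apply/funext => n; rewrite m_add.
  by apply: cvgD; exact: ul_cvg.
Qed.

Let ul_bigsetU (G : nat -> set R) k : (forall i, measurable (G i)) ->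
  trivIset setT G -> ul (\big[setU/set0]_(i < k) G i) = \sum_(i < k) ul (G i).
Proof.
move=> mG tG; elim: k => [|k ih]; first by rewrite !big_ord0 ul0.
rewrite !big_ord_recr/= ulU ?ih//; first exact: bigsetU_measurable.
apply/seteqP; split=> // t [] /=; rewrite -bigcup_mkord => -[i /= ik Gi] Gk.
have := (trivIsetP.1 tG) i k Logic.I Logic.I; rewrite ltn_eqF// => /(_ isT) h.
by have : (G i `&` G k) t by []; rewrite h.
Qed.

(** Finite additivity passes to the limit. The tails of a disjoint union, cut to [D], have measure
    tending to 0, and [m_ac] makes their mass small uniformly in [n], hence also in the limit. *)
Let ul_sigma_additive : semi_sigma_additive (fun A : set (measurableTypeR R) => (ul A)%:E).
Proof.
move=> G mG tG mUG /=.
have -> : (fun n => (\sum_(0 <= i < n) (ul (G i))%:E)%E) =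
    (fun n => (ul (\big[setU/set0]_(i < n) G i))%:E).
  by apply/funext => k; rewrite sumEFin big_mkord ul_bigsetU.
apply: cvg_EFin; first exact: nearW.
apply/cvgrPdist_lt => e e0.
pose H k := (\bigcup_(i in [set i | (k <= i)%N]) G i) `&` D.
have mtail k : measurable (\bigcup_(i in [set i | (k <= i)%N]) G i).
  by apply: bigcup_measurable => i _.
have mH k : measurable (H k) by exact: measurableI.
have H0 : mu (H k) @[k --> \oo] --> 0%E.
  have <- : mu (\bigcap_k H k) = 0%E.
    rewrite (_ : \bigcap_k H k = set0) ?measure0//.
    apply/seteqP; split=> // t Ht.
    have [[i _ Git] _] := Ht 0%N Logic.I.
    have [[j /= ij Gjt] _] := Ht i.+1 Logic.I.
    have := (trivIsetP.1 tG) i j Logic.I Logic.I; rewrite ltn_eqF// => /(_ isT) h.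
    by have : (G i `&` G j) t by []; rewrite h.
  apply: nonincreasing_cvg_mu => //.
  - by apply: le_lt_trans Dfin; apply: le_measure; rewrite ?inE//; apply: subIsetr.
  - exact: bigcapT_measurable.
  - apply/nonincreasing_seqP => k; rewrite subsetEset; apply: setSI => t [i /= ki Gi].
    by exists i => //=; exact: ltnW.
have e2 : 0 < e / 2 by rewrite divr_gt0.
have [del del0 hdel] := m_ac e2.
have Hlt : \forall k \near \oo, (mu (H k) < del%:E)%E.
  by apply: (H0 [set z | (z < del%:E)%E]); apply: open_ereal_lt'; rewrite lte_fin.
near=> k.
have -> : ul (\bigcup_n G n) = ul (\big[setU/set0]_(i < k) G i) +
    ul (\bigcup_(i in [set i | (k <= i)%N]) G i).
  rewrite -ulU//.
  - congr ul; rewrite -bigcup_mkord -bigcup_setU; congr bigcup.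
    by apply/seteqP; split=> // i _ /=; case: (ltnP i k); [left|right].
  - by apply: bigsetU_measurable => i _; exact: mG.
  - exact: mtail.
  - apply/seteqP; split=> // t [] /=; rewrite -bigcup_mkord => -[i /= ik Gi] [j /= kj Gj].
    have := (trivIsetP.1 tG) i j Logic.I Logic.I.
    rewrite ltn_eqF//; last exact: leq_trans kj.
    by move=> /(_ isT) h; have : (G i `&` G j) t by []; rewrite h.
rewrite addrAC subrr add0r ger0_norm//; apply: (@le_lt_trans _ _ (e / 2)).
  apply: ul_le => [|n]; first exact: mtail.
  rewrite m_supp; last exact: mtail.
  by apply/ltW/hdel; [exact: mH|near: k].
by rewrite ltr_pdivrMr// ltr_pMr// ltr1n.
Unshelve. all: by end_near. Qed.

(** The Dunford-Pettis argument: the limit set function is a finite measure, [m_ac] makes it vanish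
    on null sets, and [theta] is its Radon-Nikodym derivative, made real-valued by [fine]. *)
Lemma ultra_density : exists theta : R -> R,
  [/\ forall t, 0 <= theta t, mu.-integrable setT (EFin \o theta) &
      forall A, measurable A -> m n A @[n --> F] --> \int[mu]_(t in A) theta t].
Proof.
pose nu0 (A : set (measurableTypeR R)) : \bar R := (ul A)%:E.
have nu00 : nu0 set0 = 0%E by rewrite /nu0 ul0.
have nu0_ge0 A : (0 <= nu0 A)%E by rewrite lee_fin.
have nu0_fin : fin_num_fun nu0 by [].
pose nu1 : {measure set (measurableTypeR R) -> \bar R} := HB.pack nu0
  (@isMeasure.Build _ (measurableTypeR R) R nu0 nu00 nu0_ge0 ul_sigma_additive).
pose H3 := (@Measure_isFinite.Build _ (measurableTypeR R) R nu1 nu0_fin).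
pose nu : {finite_measure set (measurableTypeR R) -> \bar R} := HB.pack (Measure.sort nu1) H3.
have numu : nu `<< mu.
  apply/null_content_dominatesP => A mA muA.
  rewrite /= /nu0; congr EFin; apply/eqP; rewrite eq_le ul_ge0 andbT.
  apply/ler_addgt0Pl => e e0; rewrite addr0; apply: ul_le => // n.
  have [del del0 hdel] := m_ac e0.
  by apply/ltW/hdel => //; rewrite [X in (X < _)%E]muA lte_fin.
have [f [f0 ffin fint fE]] := radon_nikodym_sigma_finite numu.
have fK : EFin \o (fine \o f) = f by apply/funext => t /=; rewrite fineK.
exists (fine \o f); split => [t| |A mA].
- by rewrite /= fine_ge0.
- by rewrite fK.
- have := ul_cvg mA; have -> // : ul A = \int[mu]_(t in A) (fine \o f) t.
  have := fE A mA; rewrite /= /nu0 /Rintegral.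
  by rewrite -[X in fine X](_ : (\int[mu]_(x in A) f x)%E = _) => [<-//|]; rewrite -fK.
Qed.

End UltraDensity.

(** * Weak convergence against bounded functions *)

Section RintegralFacts.
Context {R : realType}.
Notation mu := (@lebesgue_measure R).
Implicit Types (A B D : set (measurableTypeR R)) (h v : R -> R).

Lemma bounded_fun_on A h (K : R) : (forall t, A t -> `|h t| <= K) ->
  [bounded h t | t in A].
Proof.
move=> hK; exists K; split; first by rewrite num_real.
by move=> M KM t At /=; apply: le_trans (hK t At) (ltW KM).
Qed.

Lemma integrable_mulr_bounded A v h (K : R) : measurable A ->
  mu.-integrable A (EFin \o v) -> measurable_fun A h ->
  (forall t, A t -> `|h t| <= K) -> mu.-integrable A (EFin \o (fun t => v t * h t)).
Proof.
move=> mA vi mh hK.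
have := integrableMl mA vi mh (bounded_fun_on hK).
by apply: eq_integrable => // t _; rewrite /= EFinM.
Qed.

Lemma integrable_bounded A h (K : R) : measurable A -> (mu A < +oo)%E ->
  measurable_fun A h -> (forall t, A t -> `|h t| <= K) -> mu.-integrable A (EFin \o h).
Proof.
by move=> mA Afin mh hK; apply: measurable_bounded_integrable => //; exact: bounded_fun_on hK.
Qed.

Lemma integrable_measurable A v : mu.-integrable A (EFin \o v) -> measurable_fun A v.
Proof. by move=> /measurable_int/measurable_EFinP. Qed.

Lemma Rintegral_nd_set A B v : measurable A -> measurable B -> A `<=` B ->
  mu.-integrable B (EFin \o v) -> (forall t, B t -> 0 <= v t) ->
  \int[mu]_(t in A) v t <= \int[mu]_(t in B) v t.
Proof.
move=> mA mB AB vi v0; have viA : mu.-integrable A (EFin \o v) by exact: integrableS vi.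
rewrite /Rintegral fine_le//; [exact: integrable_fin_num|exact: integrable_fin_num|].
apply: ge0_subset_integral => //; first exact: measurable_int vi.
Qed.

Lemma Rintegral_bound_mul A v h (K : R) : measurable A ->
  mu.-integrable A (EFin \o v) -> measurable_fun A h ->
  (forall t, A t -> `|h t| <= K) ->
  `|\int[mu]_(t in A) (v t * h t)| <= K * \int[mu]_(t in A) `|v t|.
Proof.
move=> mA vi mh hK; have vhi := integrable_mulr_bounded mA vi mh hK.
have nvi : mu.-integrable A (EFin \o (fun t => `|v t|)) by exact: integrable_norm.
apply: le_trans (le_normr_Rintegral mA vhi) _.
rewrite -RintegralZl//; apply: le_Rintegral => //.
- exact: integrable_norm.
- apply: eq_integrable (integrableZl mA K nvi) => // t _.
- by move=> t At; rewrite normrM mulrC ler_wpM2r// hK.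
Qed.

Section Quantisation.
Variables (A : set (measurableTypeR R)) (h : R -> R) (K e : R).
Hypotheses (mA : measurable A) (mh : measurable_fun A h) (e0 : 0 < e).
Hypothesis hK : forall t, A t -> `|h t| <= K.

Let lev (j : nat) : R := - K + j%:R * e.
Let Al (j : nat) := A `&` h @^-1` `]-oo, lev j[.
Let Bl (j : nat) := A `&` h @^-1` `[lev j, lev j.+1[.

Let mAl j : measurable (Al j). Proof. by apply: mh. Qed.
Let mBl j : measurable (Bl j). Proof. by apply: mh. Qed.

Let AlS j : Al j.+1 = Al j `|` Bl j.
Proof.
have jj : lev j <= lev j.+1 by rewrite lerD2l ler_wpM2r ?(ltW e0)// ler_nat.
apply/seteqP; split => [t [At /=]|t [] [At /=]]; rewrite ?in_itv/=.
- by move=> hj; case: (ltP (h t) (lev j)) => hl; [left|right]; split=> //=; rewrite in_itv/= ?hl.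
- by move=> hl; split=> //=; rewrite in_itv/= (lt_le_trans hl).
- by move=> /andP[_ hl]; split=> //=; rewrite in_itv.
Qed.

Let AlBl j : [disjoint Al j & Bl j]%classic.
Proof.
apply/disj_setPS => t [] [_ /=]; rewrite in_itv/= => hl [_ /=]; rewrite in_itv/= => /andP[].
by rewrite leNgt hl.
Qed.

(** Slabs of height [e] cut the range of [h]. Levels and sets depend on [h] only, so one finite
    combination serves all weights [v]: a whole sequence and its limit. *)
Lemma quantised_integral : exists (N : nat) (b : nat -> R) (B : nat -> set (measurableTypeR R)),
  (forall j, measurable (B j) /\ B j `<=` A) /\
  forall v, mu.-integrable A (EFin \o v) -> (forall t, A t -> 0 <= v t) ->
    `|\int[mu]_(t in A) (v t * h t) - \sum_(j < N) b j * \int[mu]_(t in B j) v t|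
      <= e * \int[mu]_(t in A) v t.
Proof.
(* The successor puts the last level strictly above [K], so that the half-open slabs exhaust [A]. *)
pose N := (Num.truncn (2 * K / e)).+1.
exists N, lev, Bl; split => [j|v vi v0]; first by split; [exact: mBl|exact: subIsetl].
have AlN : Al N = A.
  apply/seteqP; split => [t []//|t At]; split=> //=; rewrite in_itv/=.
  have := hK At; rewrite ler_norml => /andP[_ /le_lt_trans]; apply.
  rewrite /lev -ltrBlDl opprK -mulr2n -[K *+ 2]mulr_natl -ltr_pdivrMr//.
  exact: truncnS_gt.
have viS C : measurable C -> C `<=` A -> mu.-integrable C (EFin \o v).
  by move=> mC CA; exact: integrableS vi.
have mhS C : measurable C -> C `<=` A -> measurable_fun C h.
  by move=> mC CA; exact: measurable_funS mh.
rewrite -[in X in `|X - _|]AlN -[in X in _ <= _ * X]AlN.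
elim: N {AlN} => [|N ih].
  have -> : Al 0%N = set0.
    apply/seteqP; split=> // t [At /=]; rewrite in_itv/= /lev mul0r addr0.
    by have := hK At; rewrite ler_norml => /andP[h1 _] /lt_le_trans /(_ h1); rewrite ltxx.
  by rewrite !Rintegral_set0 big_ord0 subrr normr0 mulr0.
have AA : Al N `<=` A by exact: subIsetl.
have BA : Bl N `<=` A by exact: subIsetl.
have UA : Al N `|` Bl N `<=` A by rewrite subUset.
have mU : measurable (Al N `|` Bl N) by exact: measurableU.
have vhU : mu.-integrable (Al N `|` Bl N) (EFin \o (fun t => v t * h t)).
  apply: (@integrable_mulr_bounded _ _ _ K) => //; [exact: viS|exact: mhS|].
  by move=> t /UA; exact: hK.
rewrite AlS !Rintegral_setU//; last exact: viS.
rewrite big_ord_recr/= opprD addrACA mulrDr.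
apply: le_trans (ler_normD _ _) _; apply: lerD ih _.
have cB : mu.-integrable (Bl N) (EFin \o (fun t => v t * lev N)).
  by apply: (@integrable_mulr_bounded _ _ _ `|lev N|) => //; exact: viS.
have vhB : mu.-integrable (Bl N) (EFin \o (fun t => v t * h t)).
  by apply: integrableS vhU => //; exact: subsetUr.
rewrite -RintegralZl//; last exact: viS.
under [X in _ - X]eq_Rintegral do rewrite mulrC.
rewrite -RintegralB//; under eq_Rintegral do rewrite -mulrBr.
apply: le_trans (Rintegral_bound_mul (K := e) _ _ _ _) _ => //.
- exact: viS.
- by apply: measurable_funB => //; exact: mhS.
- move=> t [At /=]; rewrite in_itv/= => /andP[h1 h2].
  rewrite ger0_norm ?subr_ge0// lerBlDl; apply: le_trans (ltW h2) _.
  by rewrite /lev -natr1 mulrDl mul1r addrA.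
- rewrite ler_wpM2l ?(ltW e0)// le_eqVlt; apply/orP; left; apply/eqP.
  by apply: eq_Rintegral => t; rewrite inE => Bt; rewrite ger0_norm// v0//; exact: BA.
Qed.

End Quantisation.

(** Convergence over sets gives convergence against the quantised [h]; the quantisation error is at
    most [q M] for all [rho n] and for [theta] alike. *)
Lemma weak_cvg_bounded (I : Type) (F : set_system I) A (rho : I -> R -> R)
    (theta h : R -> R) (K M : R) :
  ProperFilter F -> measurable A ->
  (forall n, mu.-integrable A (EFin \o rho n)) -> mu.-integrable A (EFin \o theta) ->
  (forall n t, A t -> 0 <= rho n t) -> (forall t, A t -> 0 <= theta t) ->
  (forall n, \int[mu]_(t in A) rho n t <= M) ->
  (forall B, measurable B -> B `<=` A ->
     \int[mu]_(t in B) rho n t @[n --> F] --> \int[mu]_(t in B) theta t) ->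
  measurable_fun A h -> (forall t, A t -> `|h t| <= K) ->
  \int[mu]_(t in A) (rho n t * h t) @[n --> F] --> \int[mu]_(t in A) (theta t * h t).
Proof.
move=> FF mA ri ti r0 t0 rM rt mh hK.
apply/cvgrPdist_lt => e e0.
have tM : \int[mu]_(t in A) theta t <= M.
  by apply: (cvgr_to_le (rt A mA (@subset_refl _ A))); exact: nearW.
have M0 : 0 <= M by apply: le_trans tM; exact: Rintegral_ge0.
pose q := e / (4 * (M + 1)).
have q0 : 0 < q by rewrite divr_gt0// mulr_gt0// ltr_wpDl.
have qM : q * M <= e / 4.
  rewrite /q -mulrA; apply: ler_wpM2l; first exact: ltW.
  by rewrite invfM -mulrA ger_pMr// ler_pdivrMl ?mulr1 ?lerDl// ltr_wpDl.
have [N [b [B [mB hB]]]] := quantised_integral mA mh q0 hK.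
have sumcvg : \sum_(j < N) b j * \int[mu]_(t in B j) rho n t @[n --> F] -->
    \sum_(j < N) b j * \int[mu]_(t in B j) theta t.
  apply: cvg_sumr => j; apply: cvgMr.
  by have [mBj BjA] := mB j; exact: rt.
have e4 : 0 < e / 4 by rewrite divr_gt0.
move/cvgrPdist_lt: sumcvg => /(_ _ e4); apply: filterS => n hn.
have hth := le_trans (hB theta ti t0) (le_trans (ler_wpM2l (ltW q0) tM) qM).
have hrh := le_trans (hB (rho n) (ri n) (r0 n)) (le_trans (ler_wpM2l (ltW q0) (rM n)) qM).
move: hn hth hrh; rewrite ltr_norml !ler_norml => /andP[? ?] /andP[? ?] /andP[? ?].
by rewrite ltr_norml; apply/andP; split; lra.
Qed.

Lemma weak_compact_ge0 (I : Type) (F : set_system I) D (rho : I -> R -> R) (M : R) :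
  UltraFilter F -> measurable D -> (mu D < +oo)%E ->
  (forall n, mu.-integrable D (EFin \o rho n)) ->
  (forall n t, D t -> 0 <= rho n t) ->
  (forall n, \int[mu]_(t in D) rho n t <= M) ->
  (forall e : R, 0 < e -> exists2 del : R, 0 < del &
     forall n A, measurable A -> A `<=` D -> (mu A < del%:E)%E ->
       \int[mu]_(t in A) rho n t < e) ->
  exists theta : R -> R, [/\ forall t, 0 <= theta t, mu.-integrable setT (EFin \o theta) &
    forall A h (K : R), measurable A -> A `<=` D -> measurable_fun A h ->
      (forall t, A t -> `|h t| <= K) ->
      \int[mu]_(t in A) (rho n t * h t) @[n --> F] --> \int[mu]_(t in A) (theta t * h t)].
Proof.
move=> FU mD Dfin ri r0 rM rac.
have mI A : measurable A -> measurable (A `&` D) by move=> mA; exact: measurableI.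
have riS n A : measurable A -> mu.-integrable (A `&` D) (EFin \o rho n).
  by move=> mA; apply: integrableS (ri n) => //; exact: mI.
(* Intersecting with [D] extends the integrals to set functions on all measurable sets of the
   line. *)
have [||||theta [t0 ti tc]] := @ultra_density R I F
    (fun n A => \int[mu]_(t in A `&` D) rho n t) M D FU mD Dfin.
- move=> n A mA; apply/andP; split.
    by apply: Rintegral_ge0 => t [_ Dt]; exact: r0.
  apply: le_trans (rM n); apply: Rintegral_nd_set => //; [exact: mI|exact: r0].
- move=> n A B mA mB AB; rewrite setIUl Rintegral_setU//; [exact: mI|exact: mI| |].
    by rewrite -setIUl; apply: riS; exact: measurableU.
  by apply/disj_setPS; rewrite setIACA AB set0I.
- by move=> n A mA; rewrite -setIA setIid.
- move=> e e0; have [del del0 hdel] := rac e e0; exists del => // n A mA muA.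
  apply: hdel; [exact: mI|exact: subIsetr|].
  by apply: le_lt_trans muA; apply: le_measure; rewrite ?inE; [exact: mI|exact: mA|exact: subIsetl].
exists theta; split=> // A h K mA AD mh hK.
have tiS C : measurable C -> mu.-integrable C (EFin \o theta).
  by move=> mC; exact: integrableS ti.
apply: (@weak_cvg_bounded _ _ _ _ _ _ K M) => //.
- by move=> n; exact: integrableS (ri n).
- exact: tiS.
- by move=> n t At; apply: r0; exact: AD.
- move=> n; apply: le_trans (rM n); apply: Rintegral_nd_set => //; exact: r0.
- move=> B mB BA; have := tc B mB; suff -> : B `&` D = B by [].
  by apply: setIidl; exact: subset_trans AD.
Qed.

End RintegralFacts.

(** * Young integrals *)

Section DissectionSums.
Context {R : realType}.
Implicit Types (H P Q : R -> R -> R) (x z w : R) (s : seq R) (q : seq (R * bool)).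

(** Dissection sums by recursion on the list of points, so that removing a point becomes a
    computation on concatenations. *)
Fixpoint lsum H x s : R := if s is z :: s' then H x z + lsum H z s' else 0.

Lemma lsum_cat H x s1 s2 : lsum H x (s1 ++ s2) = lsum H x s1 + lsum H (last x s1) s2.
Proof. by elim: s1 x => [|z s1 ih] x /=; rewrite ?add0r// ih addrA. Qed.

Lemma lsum_nth H T x s : \sum_(0 <= i < size s) H (nth T (x :: s) i) (nth T (x :: s) i.+1) = lsum H x s.
Proof.
elim: s x => [|z s ih] x; first by rewrite big_geq.
by rewrite big_nat_recl//= -ih.
Qed.

Lemma lsum_knot H T s : \sum_(0 <= i < size s) H (knot T s i) (knot T s i.+1) = lsum H 0 s.
Proof. exact: lsum_nth. Qed.

Lemma lsum_telescope (V : R -> R) x s : lsum (fun a b => V b - V a) x s = V (last x s) - V x.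
Proof.
elim: s x => [|z s ih] x /=; first by rewrite subrr.
by rewrite ih addrC addrA subrK.
Qed.

Lemma lsumZ H c x s : lsum (fun a b => c * H a b) x s = c * lsum H x s.
Proof. by elim: s x => [|z s ih] x /=; rewrite ?mulr0// ih mulrDr. Qed.

(* The points flagged [false] are those to be removed; the weight of such a
   point is computed from its two neighbours. *)
Fixpoint wsum P Q x q : R :=
  if q is (z, fl) :: q' then
    (if fl then 0 else P x z + (if q' is (w, _) :: _ then Q z w else 0)) + wsum P Q z q'
  else 0.

Definition removable q : nat := count (fun zf => ~~ zf.2) q.

(** A removable point is charged by [P] for the step into it and by [Q] for the step out of it, so
    each step is charged at most once by each of them; [Q] never charges the initial step. *)
Lemma wsum_le P Q x q : (forall a b, a < b -> 0 <= P a b) -> (forall a b, a < b -> 0 <= Q a b) ->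
  path <%R x (unzip1 q) ->
  wsum P Q x q <= lsum P x (unzip1 q) + (if q is (z, _) :: q' then lsum Q z (unzip1 q') else 0).
Proof.
move=> P0 Q0; elim: q x => [|[z fl] q ih] x /=; first by rewrite addr0.
move=> /andP[xz zq]; have := ih z zq.
case: q ih zq => [|[w fw] q] ih /= zq hq.
  by rewrite !addr0; case: fl; rewrite ?P0// addr0.
have /andP[zw _] := zq.
have hP := P0 _ _ xz; have hQ := Q0 _ _ zw.
by case: fl; lra.
Qed.

Lemma wsum_le_lsum P Q x q : (forall a b, a < b -> 0 <= P a b) -> (forall a b, a < b -> 0 <= Q a b) ->
  path <%R x (unzip1 q) -> wsum P Q x q <= lsum P x (unzip1 q) + lsum Q x (unzip1 q).
Proof.
move=> P0 Q0 pq; apply: le_trans (wsum_le P0 Q0 pq) _; rewrite lerD2l.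
by case: q pq => [|[z fl] q]//= /andP[xz _]; rewrite lerDr Q0.
Qed.

(** Since the last point is not removable, every removable point has a right neighbour and
    contributes more than [c]. The case without removable points is separate because the inequality
    is strict. *)
Lemma wsum_gt P Q c x q : last true (unzip2 q) ->
  (forall q1 z w fw q2, q = q1 ++ (z, false) :: (w, fw) :: q2 ->
     c < P (last x (unzip1 q1)) z + Q z w) ->
  if removable q == 0%N then wsum P Q x q = 0 else c * (removable q)%:R < wsum P Q x q.
Proof.
elim: q x => [|[z fl] q ih] x //= lq hc.
have lq' : last true (unzip2 q) by case: q lq {ih hc}.
have {}ih := ih z lq' (fun q1 z' w fw q2 e => hc ((z, fl) :: q1) z' w fw q2 (congr1 (cons _) e)).
case: fl lq hc => lq hc; first by rewrite /removable /= add0n add0r.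
case: q lq lq' hc ih => [|[w fw] q] //= _ lq' hc ih.
have hcz := hc [::] z w fw q erefl.
rewrite /removable/= -/(removable q).
move: ih; rewrite /removable/= -/(removable q).
set n := (~~ fw + removable q)%N; rewrite natrD mulrDr mulr1.
by case: eqP => [->|_] ih; [rewrite mulr0 addr0 ih addr0|exact: ltrD].
Qed.

(** Pigeonhole principle: some removable point has at most the average weight. This is the point
    that Young's argument removes. *)
Lemma wsum_small P Q x q : last true (unzip2 q) -> (0 < removable q)%N ->
  exists q1 z w fw q2, q = q1 ++ (z, false) :: (w, fw) :: q2 /\
     (P (last x (unzip1 q1)) z + Q z w) * (removable q)%:R <= wsum P Q x q.
Proof.
move=> lq q0; apply: contrapT => hn.
have hm : 0 < (removable q)%:R :> R by rewrite ltr0n.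
have := @wsum_gt P Q (wsum P Q x q / (removable q)%:R) x q lq.
rewrite gtn_eqF// -mulrA mulVf ?gt_eqF// mulr1 ltxx => h.
suff : false by []; apply: h => q1 z w fw q2 qE.
rewrite ltNge; apply/negP => h; apply: hn; exists q1, z, w, fw, q2; split => //.
by rewrite -ler_pdivlMr.
Qed.

Lemma path_lt_last x s y : path <%R x s -> y \in x :: s -> y <= last x s.
Proof.
elim: s x y => [|z s ih] x y /=; first by rewrite inE => _ /eqP->.
move=> /andP[xz zs]; rewrite inE => /orP[/eqP->|]; last exact: ih.
by apply: le_trans (ltW xz) (ih z z zs _); rewrite inE eqxx.
Qed.

Lemma path_lt_head x s y : path <%R x s -> y \in x :: s -> x <= y.
Proof.
move=> xs; rewrite inE => /orP[/eqP->//|ys].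
by have /allP/(_ y ys)/ltW := order_path_min lt_trans xs.
Qed.

Lemma lsum_remove H x s1 z w s2 :
  lsum H x (s1 ++ z :: w :: s2) - lsum H x (s1 ++ w :: s2) =
  H (last x s1) z + H z w - H (last x s1) w.
Proof. rewrite !lsum_cat/=; ring. Qed.

Definition kept (q : seq (R * bool)) : seq R := [seq zf.1 | zf <- q & zf.2].

Lemma kept_sub q y : y \in kept q -> y \in unzip1 q.
Proof.
by move=> /mapP[zf]; rewrite mem_filter => /andP[_ zfq] ->; exact: map_f.
Qed.

Lemma kept_removable0 q : removable q = 0%N -> kept q = unzip1 q.
Proof.
rewrite /removable /kept => /eqP; rewrite -leqn0 leqNgt -has_count -all_predC => /allP h.
by congr map; apply/all_filterP/allP => z /h/=; rewrite negbK.
Qed.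

End DissectionSums.

(** Cauchy condensation: the terms from [2^k] to [2^(k+1) - 1] contribute at most [rho^k], where
    [rho = 2^(1 - th) < 1]. *)
Lemma sum_powRN_bound (R : realType) (th : R) : 1 < th -> exists2 Z : R, 0 < Z &
  forall m, \sum_(j < m) (j.+1)%:R `^ (- th) <= Z.
Proof.
move=> th1; pose rho : R := 2 `^ (1 - th).
have rho0 : 0 < rho by exact: powR_gt0.
have rho1 : rho < 1.
  rewrite /rho /powR pnatr_eq0/= expR_lt1 nmulr_rlt0 ?subr_lt0//.
  by rewrite ln_gt0// ltr1n.
have geom k : \sum_(i < k) rho ^+ i <= (1 - rho)^-1.
  have := subrX1 rho k => h.
  have -> : \sum_(i < k) rho ^+ i = (1 - rho ^+ k) / (1 - rho).
    apply: (mulIf (x := 1 - rho)); first by rewrite subr_eq0 gt_eqF.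
    rewrite mulfVK ?subr_eq0 ?gt_eqF//; lra.
  rewrite ler_pdivrMr ?subr_gt0// mulVf ?subr_eq0 ?gt_eqF//.
  by rewrite gerBl exprn_ge0// ltW.
exists ((1 - rho)^-1); first by rewrite invr_gt0 subr_gt0.
have dyad k : \sum_(j < (2 ^ k).-1) (j.+1)%:R `^ (- th) <= \sum_(i < k) rho ^+ i.
  elim: k => [|k ih]; first by rewrite expn0 !big_ord0.
  have -> : (2 ^ k.+1).-1 = ((2 ^ k).-1 + 2 ^ k)%N.
    by rewrite expnS mul2n -addnn -[X in (X + _).-1](@prednK (2 ^ k)) ?expn_gt0// addSn.
  rewrite big_split_ord/= big_ord_recr/=; apply: lerD ih _.
  have -> : rho ^+ k = \sum_(i < 2 ^ k) (2 ^+ k) `^ (- th).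
    have e1 : 2 ^+ k = 2 `^ k%:R :> R by rewrite powR_mulrn.
    have e2 : rho ^+ k = 2 `^ ((1 - th) * k%:R) by rewrite powRrM powR_mulrn// ltW.
    rewrite sumr_const card_ord -[RHS]mulr_natl natrX e2 e1 -powRrM -powRD.
      by congr powR; ring.
    by rewrite pnatr_eq0 implybT.
  apply: ler_sum => i _; rewrite !powRN lef_pV2 ?posrE ?powR_gt0 ?exprn_gt0//.
  rewrite ge0_ler_powR ?nnegrE ?exprn_ge0//; first by lra.
  rewrite -natrX ler_nat -addnS -[X in (X <= _)%N](@prednK (2 ^ k)) ?expn_gt0//.
  by rewrite addnS ltnS leq_addr.
move=> m; apply: le_trans (geom m); apply: le_trans (dyad m).
have mk : (m <= (2 ^ m).-1)%N by rewrite -ltnS prednK ?expn_gt0// ltn_expl.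
rewrite -!(big_mkord xpredT (fun j => (j.+1)%:R `^ (- th))).
rewrite [leRHS](big_cat_nat (leq0n _) mk)//= lerDl; apply: sumr_ge0 => j _; exact: powR_ge0.
Qed.

Lemma powRN_inv (R : realType) (x y : R) : 0 <= x -> x `^ (- y) = x^-1 `^ y.
Proof. by move=> x0; rewrite -(powR_inv1 x0) -powRrM mulN1r. Qed.

(** * Young's estimate for sums over dissections *)

Section YoungSums.
Context {R : realType} {d : nat}.
Variables (T : R) (F : R -> 'Hom('rV[R]_d, R^o)) (eta : R -> 'rV[R]_d) (V : R -> R).
Variables (C A B a a' p : R).
Hypotheses (T0 : 0 < T) (p1 : 1 < p) (C0 : 0 <= C) (A0 : 0 < A) (B0 : 0 < B) (p0 : 0 < p) (a'0 : 0 < a') (a'a : a' < a).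
Hypothesis hF : forall s t, 0 <= s -> s <= t -> t <= T ->
  opnorm (F t - F s) <= C * (V t - V s) `^ a.
Hypothesis Vnd : forall s t, s <= t -> V s <= V t.
Hypothesis VA : V T - V 0 <= A.
Hypothesis hB : forall s, itv_partition 0 T s ->
  lsum (fun x y => `|eta y - eta x| `^ p) 0 s <= B.

Definition ysum s : R := lsum (fun x y => F x (eta y - eta x)) 0 s.

(** Only the exponent [a' < a] is spent on the convergence of the series; the remainder [a - a'] is
    kept as a power of the mesh. *)
Let th := a' + p^-1.

Lemma powR_inv_le (x y : R) : 0 <= x -> x `^ p <= y -> x <= y `^ p^-1.
Proof.
move=> x0 xy; have <- : (x `^ p) `^ p^-1 = x by rewrite -powRrM mulfV ?gt_eqF// powRr1.
by apply: ge0_ler_powR; rewrite ?nnegrE ?invr_ge0 ?(ltW p0) ?powR_ge0 ?(le_trans _ xy)// powR_ge0.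
Qed.

(** Young's removal argument. Among [m + 1] removable points one has normalised weight at most
    [2 / (m + 1)]; removing it changes the sum by [(F z - F y) (eta w - eta z)], where [y] and [w]
    are its neighbours. Of the power [a] of [V z - V y], the part [a - a'] is bounded through the
    mesh [e] and the part [a'] through the weight, which produces the term of index [m] of the
    series. *)
Lemma young_remove (e : R) (q : seq (R * bool)) : 0 <= e ->
  itv_partition 0 T (unzip1 q) -> last true (unzip2 q) ->
  (forall z, (z, false) \in q -> exists y, [/\ y \in 0 :: kept q, y < z & V z - V y <= e]) ->
  `|ysum (unzip1 q) - ysum (kept q)| <=
    C * (e `^ (a - a') * ((2 * A) `^ a' * (2 * B) `^ p^-1)) *
    \sum_(j < removable q) (j.+1)%:R `^ (- th).
Proof.
move=> e0; have [m mE] := ubnP (removable q); move: mE.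
elim: m q => [//|m ih] q; rewrite ltnS leq_eqVlt => /orP[/eqP mE|]; last exact: ih.
move=> qT lq hq; case: m => [|m] in ih mE *.
  by rewrite mE kept_removable0// subrr normr0 big_ord0 mulr0.
have q0 : (0 < removable q)%N by rewrite mE.
have [pq /eqP lastq] := qT.
(* The weights are normalised by [A] and [B], so that each family totals at most 1; hence the
   factors [2 A] and [2 B]. *)
have [q1 [z [w [fw [q2 [qE]]]]]] :=
  wsum_small (fun x y => A^-1 * (V y - V x)) (fun x y => B^-1 * `|eta y - eta x| `^ p) 0 lq q0.
set y := last 0 (unzip1 q1) => hw.
pose q' := q1 ++ (w, fw) :: q2.
have uq : unzip1 q = unzip1 q1 ++ z :: w :: unzip1 q2 by rewrite qE /unzip1 map_cat.
have uq' : unzip1 q' = unzip1 q1 ++ w :: unzip1 q2 by rewrite /q' /unzip1 map_cat.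
move: (pq); rewrite {1}uq cat_path/= -/y => /and4P[pq1 yz zw pq2].
have lastw : last w (unzip1 q2) = T by rewrite -lastq uq last_cat.
have y0 : 0 <= y by apply: path_lt_head pq1 _; rewrite mem_last.
have wT : w <= T by rewrite -lastw; apply: path_lt_last pq2 _; rewrite inE eqxx.
have zT : z <= T by apply: le_trans wT; exact: ltW.
have z0 : 0 <= z by apply: le_trans (ltW yz).
have keptE : kept q = kept q' by rewrite qE /q' /kept !filter_cat.
have remE : removable q = (removable q').+1.
  by rewrite qE /q' /removable !count_cat/= addnS.
have q'T : itv_partition 0 T (unzip1 q').
  split; last by rewrite uq' last_cat/= lastw.
  by rewrite uq' cat_path/= -/y pq1 pq2 (lt_trans yz zw).
have lq' : last true (unzip2 q').
  by move: lq; rewrite qE /q' /unzip2 !map_cat !last_cat.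
have hq' z' : (z', false) \in q' -> exists y, [/\ y \in 0 :: kept q', y < z' & V z' - V y <= e].
  move=> z'q; rewrite -keptE; apply: hq; move: z'q.
  by rewrite qE /q' !mem_cat => /orP[->//|h]; rewrite [X in _ || X]inE h !orbT.
have remq' : removable q' = m by apply: succn_inj; rewrite -remE.
have /ih : (removable q' < m.+1)%N by rewrite remq'.
move=> /(_ q'T lq' hq'); rewrite -keptE => ihq'.
rewrite mE -remq' big_ord_recr/= remq' mulrDr.
have -> : ysum (unzip1 q) - ysum (kept q) =
   (ysum (unzip1 q') - ysum (kept q)) + (ysum (unzip1 q) - ysum (unzip1 q')) by ring.
apply: le_trans (ler_normD _ _) _; apply: lerD; first by rewrite remq' in ihq'.
rewrite /ysum uq uq' lsum_remove -/y.
have -> : F y (eta z - eta y) + F z (eta w - eta z) - F y (eta w - eta y)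
    = (F z - F y) (eta w - eta z).
  rewrite add_lfunE opp_lfunE.
  have -> : eta w - eta y = (eta z - eta y) + (eta w - eta z).
    by rewrite [RHS]addrC [RHS]addrA subrK.
  by rewrite linearD/=; ring.
apply: le_trans (le_opnorm _ _) _.
have Vzy0 : 0 <= V z - V y by rewrite subr_ge0; apply: Vnd => //; exact: ltW.
have nd0 : 0 <= `|eta w - eta z| `^ p by exact: powR_ge0.
(* The neighbour [y] may itself be removable, but the kept point [y1] below [z] is still in the
   list, so [y1 <= y]. *)
have Vzye : V z - V y <= e.
  have /hq[y1 [y1q y1z y1e]] : (z, false) \in q by rewrite qE mem_cat inE eqxx orbT.
  apply: le_trans y1e; rewrite lerD2l lerN2.
  have y1q' : y1 \in 0 :: unzip1 q.
    by move: y1q; rewrite !inE => /orP[->//|/kept_sub->]; rewrite orbT.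
  have y1y : y1 \in 0 :: unzip1 q1.
    move: y1q'; rewrite uq !inE mem_cat => /or3P[->//|->|]; rewrite ?orbT//.
    move=> h; have pz : path <%R z (w :: unzip1 q2) by rewrite /= zw.
    by have := path_lt_head pz h; rewrite leNgt y1z.
  by apply: Vnd; exact: path_lt_last.
have wle : (A^-1 * (V z - V y) + B^-1 * `|eta w - eta z| `^ p) * (m.+1)%:R <= 2.
  rewrite -mE; apply: le_trans hw _; apply: le_trans (wsum_le_lsum _ _ pq) _.
  - by move=> u v /ltW uv; apply: mulr_ge0; [rewrite invr_ge0 ltW|rewrite subr_ge0; exact: Vnd].
  - by move=> u v _; apply: mulr_ge0; [rewrite invr_ge0 ltW|exact: powR_ge0].
  - rewrite !lsumZ lsum_telescope lastq -[2]/(1 + 1).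
    by apply: lerD; rewrite ler_pdivrMl// mulr1//; exact: hB.
have m1 : 0 < m.+1%:R :> R by rewrite ltr0n.
have x1 : 0 <= A^-1 * (V z - V y) * m.+1%:R.
  by rewrite mulr_ge0// mulr_ge0// invr_ge0 ltW.
have x2 : 0 <= B^-1 * `|eta w - eta z| `^ p * m.+1%:R.
  by rewrite mulr_ge0// mulr_ge0// invr_ge0 ltW.
have vle : V z - V y <= 2 * A / m.+1%:R.
  rewrite ler_pdivlMr//.
  have -> : (V z - V y) * m.+1%:R = A^-1 * (V z - V y) * m.+1%:R * A by field; rewrite gt_eqF.
  rewrite ler_wpM2r ?(ltW A0)//; move: wle; rewrite mulrDl; lra.
have nle : `|eta w - eta z| `^ p <= 2 * B / m.+1%:R.
  rewrite ler_pdivlMr//.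
  have -> : `|eta w - eta z| `^ p * m.+1%:R = B^-1 * `|eta w - eta z| `^ p * m.+1%:R * B.
    by field; rewrite gt_eqF.
  rewrite ler_wpM2r ?(ltW B0)//; move: wle; rewrite mulrDl; lra.
have im0 : 0 <= m.+1%:R^-1 :> R by rewrite invr_ge0.
have A2 : 0 <= 2 * A by rewrite mulr_ge0// ltW.
have B2 : 0 <= 2 * B by rewrite mulr_ge0// ltW.
have aa' : 0 <= a - a' by rewrite subr_ge0 ltW.
have vaE : (V z - V y) `^ a <= e `^ (a - a') * ((2 * A) `^ a' * m.+1%:R `^ (- a')).
  have -> : (V z - V y) `^ a = (V z - V y) `^ (a - a') * (V z - V y) `^ a'.
    by rewrite -powRD subrK// gt_eqF// (lt_trans a'0).
  apply: ler_pM; rewrite ?powR_ge0//.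
    by apply: ge0_ler_powR; rewrite ?nnegrE.
  rewrite powRN_inv// -powRM//; apply: ge0_ler_powR; rewrite ?nnegrE ?mulr_ge0//; exact: ltW.
have ndE : `|eta w - eta z| <= (2 * B) `^ p^-1 * m.+1%:R `^ (- p^-1).
  apply: le_trans (powR_inv_le (normr_ge0 _) nle) _.
  by rewrite powRM// powRN_inv.
have -> : m.+1%:R `^ (- th) = m.+1%:R `^ (- a') * m.+1%:R `^ (- p^-1) :> R.
  by rewrite -powRD ?pnatr_eq0 ?implybT// -opprD.
rewrite -[leRHS]mulrA; apply: (@le_trans _ _ (C * (V z - V y) `^ a * `|eta w - eta z|)).
  by rewrite ler_wpM2r// hF// ltW.
rewrite -mulrA ler_wpM2l//; apply: (le_trans (ler_pM _ _ vaE ndE)) => //.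
  exact: powR_ge0.
rewrite le_eqVlt; apply/orP; left; apply/eqP; ring.
Qed.

(* [knot T s i] is the last point of the dissection before z. *)
Lemma dissection_block s z : itv_partition 0 T s -> 0 <= z -> z < T ->
  exists i, [/\ (i < size s)%N, knot T s i <= z & z < knot T s i.+1].
Proof.
rewrite /knot; move: (0 : R) => x; elim: s x => [|w s ih] x [/= ps /eqP lT] xz zT.
  by move: (le_lt_trans xz zT); rewrite lT ltxx.
move: ps => /andP[xw ws]; case: (ltP z w) => zw; first by exists 0%N.
have [|i [is_ iz zi]] := ih w _ zw zT; first by split=> //; rewrite lT.
by exists i.+1.
Qed.

(** The mesh is measured in the clock [V], not in time. *)
Definition fine_dissection (e : R) s := forall i, (i < size s)%N ->
  V (knot T s i.+1) - V (knot T s i) <= e.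

(** The points of [s] outside [s1] are the removable ones. Each lies inside a block of [s1], on
    which [V] grows by at most [e] and whose left end is the kept point required. The end point [T]
    belongs to [s1] and is kept. *)
Lemma ysum_refine (Z e : R) s1 s : (forall m, \sum_(j < m) (j.+1)%:R `^ (- th) <= Z) -> 0 <= e ->
  itv_partition 0 T s1 -> itv_partition 0 T s -> {subset s1 <= s} -> fine_dissection e s1 ->
  `|ysum s - ysum s1| <= C * (e `^ (a - a') * ((2 * A) `^ a' * (2 * B) `^ p^-1)) * Z.
Proof.
move=> hZ e0 s1T sT s1s fs1.
pose q := [seq (z, z \in s1) | z <- s].
have [ps /eqP ls] := sT; have [ps1 /eqP ls1] := s1T.
have uq : unzip1 q = s by rewrite /unzip1 -map_comp map_id.
have kq : kept q = s1.
  rewrite /kept /q filter_map -map_comp map_id.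
  apply: (irr_sorted_eq lt_trans (@ltxx _ _)).
  - by apply: sorted_filter; [exact: lt_trans|exact: path_sorted ps].
  - exact: path_sorted ps1.
  - by move=> z; rewrite mem_filter /=; case: (boolP (z \in s1)) => //= /s1s ->.
have memT z : z \in s -> z < T \/ z = T.
  move=> zs; have := path_lt_last ps (_ : z \in 0 :: s); rewrite inE zs orbT => /(_ isT).
  by rewrite ls le_eqVlt => /orP[/eqP->|]; [right|left].
have := @young_remove e q e0; rewrite uq kq => /(_ sT) h.
apply: le_trans (h _ _) _; last first.
- by rewrite ler_wpM2l// !mulr_ge0 ?powR_ge0.
- move=> z /mapP[z' z's [-> /esym/negbT zs1]].
  have z'0 : 0 < z' by have /allP/(_ z' z's) := order_path_min lt_trans ps.
  have z'T : z' < T.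
    case: (memT _ z's) => // zT; move: zs1; rewrite zT -ls1.
    have := mem_last 0 s1; rewrite inE ls1 => /orP[/eqP TE|->//].
    by move: z'0; rewrite zT TE ltxx.
  have [i [is_ iz zi]] := dissection_block s1T (ltW z'0) z'T.
  exists (knot T s1 i); split.
  - by rewrite /knot mem_nth//= ltnW.
  - rewrite lt_neqAle iz andbT; apply/eqP => iE.
    case: i is_ iz zi iE => [|i] is_ iz zi iE; first by move: z'0; rewrite -iE ltxx.
    by move: zs1; rewrite -iE /knot/= mem_nth// ltnW.
  - by apply: le_trans (fs1 i is_); rewrite lerD2r Vnd// ltW.
- have Ts1 : T \in s1.
    have := mem_last 0 s1; rewrite ls1 inE => /orP[/eqP TE|//].
    by move: T0; rewrite TE ltxx.
  rewrite /q /unzip2 -map_comp; case: (s) ls => [TE|w s' /= ls].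
    by move: T0; rewrite -TE ltxx.
  by rewrite (last_map (fun z => z \in s1)) ls.
Qed.

(** With [v] and [n] the increments of [V] and [eta] on a block, moving the tag costs at most
    [C v^a n], and [v^a n <= e^(a + 1/p - 1) (v + n^p)], whose sum over the blocks is controlled by
    [A + B]. *)
Lemma ysum_tag (e : R) s (tau : nat -> R) : 0 <= e -> 1 < a + p^-1 ->
  itv_partition 0 T s -> fine_dissection e s ->
  (forall i, (i < size s)%N -> knot T s i <= tau i <= knot T s i.+1) ->
  `|\sum_(0 <= i < size s) F (tau i) (eta (knot T s i.+1) - eta (knot T s i)) - ysum s|
    <= C * (e `^ (a + p^-1 - 1) * (A + B)).
Proof.
move=> e0 ap sT fs htau.
rewrite /ysum -(lsum_knot (fun x y => F x (eta y - eta x)) T).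
rewrite -sumrB; apply: le_trans (ler_norm_sum _ _ _) _.
have [ps /eqP ls] := sT.
have kn i : (i < size s)%N -> [/\ 0 <= knot T s i, knot T s i <= knot T s i.+1 & knot T s i.+1 <= T].
  move=> is_; have k0 j : (j <= size s)%N -> knot T s j \in 0 :: s.
    by move=> js; rewrite /knot mem_nth.
  split; [by apply: path_lt_head ps _; rewrite k0// ltnW| |].
  - by rewrite /knot /= ltW//; move/(pathP T): ps => /(_ i is_).
  - by rewrite -[leRHS]ls; apply: path_lt_last ps _; rewrite k0.
apply: (@le_trans _ _ (\sum_(0 <= i < size s) C * (e `^ (a + p^-1 - 1) *
  ((V (knot T s i.+1) - V (knot T s i)) + `|eta (knot T s i.+1) - eta (knot T s i)| `^ p)))).
  rewrite !big_mkord; apply: ler_sum => -[i is_] _ /=.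
  have [k0 kk kT] := kn i is_; have /andP[t1 t2] := htau i is_.
  have -> : F (tau i) (eta (knot T s i.+1) - eta (knot T s i)) -
      F (knot T s i) (eta (knot T s i.+1) - eta (knot T s i)) =
      (F (tau i) - F (knot T s i)) (eta (knot T s i.+1) - eta (knot T s i)).
    by rewrite add_lfunE opp_lfunE.
  apply: le_trans (le_opnorm _ _) _.
  set n := `|eta _ - eta _|; set v := V (knot T s i.+1) - V (knot T s i).
  have v0 : 0 <= v by rewrite subr_ge0 Vnd.
  have n0 : 0 <= n by exact: normr_ge0.
  have ve : v <= e by exact: fs.
  apply: (@le_trans _ _ (C * v `^ a * n)).
    have hFi := hF k0 t1 (le_trans t2 kT).
    apply: ler_wpM2r; first exact: normr_ge0.
    apply: (le_trans hFi); apply: ler_wpM2l => //; apply: ge0_ler_powR; rewrite ?nnegrE ?subr_ge0 ?Vnd//.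
      by rewrite ltW// (lt_trans a'0).
    by rewrite lerD2r Vnd.
  rewrite -mulrA ler_wpM2l//.
  have -> : v `^ a = v `^ (a + p^-1 - 1) * v `^ (1 - p^-1).
    rewrite -powRD; first by congr powR; ring.
    by rewrite (_ : _ + _ = a); [rewrite gt_eqF// (lt_trans a'0)|ring].
  rewrite -mulrA; apply: ler_pM; rewrite ?powR_ge0 ?mulr_ge0 ?powR_ge0//.
    by apply: ge0_ler_powR; rewrite ?nnegrE// subr_ge0 ltW.
  (* x^(1-b) y^b <= x + y *)
  have nE : n = (n `^ p) `^ p^-1 by rewrite -powRrM mulfV ?gt_eqF// powRr1.
  set M := v + n `^ p; have np0 : 0 <= n `^ p by exact: powR_ge0.
  have M0 : 0 <= M by rewrite addr_ge0.
  have pi0 : 0 <= p^-1 by rewrite invr_ge0 ltW.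
  have pi1 : 0 <= 1 - p^-1 by rewrite subr_ge0 invf_le1 ?(ltW p1).
  have -> : M = M `^ (1 - p^-1) * M `^ p^-1.
    by rewrite -powRD subrK ?oner_eq0// powRr1.
  rewrite [X in _ * X <= _]nE; apply: ler_pM; rewrite ?powR_ge0//.
    by apply: ge0_ler_powR; rewrite ?nnegrE// lerDl.
  by apply: ge0_ler_powR; rewrite ?nnegrE// lerDr.
rewrite -mulr_sumr ler_wpM2l// -mulr_sumr ler_wpM2l ?powR_ge0//.
rewrite big_split/=; apply: lerD; last first.
  by rewrite (lsum_knot (fun x y => `|eta y - eta x| `^ p)); exact: hB.
by rewrite (lsum_knot (fun x y => V y - V x)) lsum_telescope ls.
Qed.

End YoungSums.

(** * Existence of the Young integral, with an error estimate *)

Section YoungIntegral.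
Context {R : realType} {d : nat}.
Variables (T p B a : R) (eta : R -> 'rV[R]_d).
Hypotheses (T0 : 0 < T) (p1 : 1 < p) (B0 : 0 < B) (ap : 1 < a + p^-1) (a1 : a <= 1).
Hypothesis hB : forall s, itv_partition 0 T s ->
  lsum (fun x y => `|eta y - eta x| `^ p) 0 s <= B.

Lemma fine_dissection_exists (del : R) : 0 < del -> exists2 s, itv_partition 0 T s &
  forall i, (i < size s)%N -> knot T s i.+1 - knot T s i < del.
Proof.
move=> del0; pose N := (Num.truncn (T / del)).+1.
have N0 : 0 < N%:R :> R by rewrite ltr0n.
pose t (i : nat) : R := i%:R * (T / N%:R).
have TN : 0 < T / N%:R by rewrite divr_gt0.
pose s := [seq t i | i <- iota 1 N].
have pathP k n : path <%R (t k) [seq t i | i <- iota k.+1 n].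
  by elim: n k => [//|n ih] k /=; rewrite ih andbT /t ltr_pM2r// ltr_nat.
have lastP k n : last (t k) [seq t i | i <- iota k.+1 n] = t (k + n)%N.
  by elim: n k => [|n ih] k /=; rewrite ?addn0// ih addSnnS.
have t0 : t 0%N = 0 by rewrite /t mul0r.
exists s.
  split; first by rewrite -t0; exact: pathP.
  by rewrite -[X in last X]t0 lastP add0n /t mulrC divfK// gt_eqF.
move=> i; rewrite size_map size_iota => iN.
have kE j : (j <= N)%N -> knot T s j = t j.
  rewrite /knot; case: j => [|j] jN; first by rewrite t0.
  by rewrite /= (nth_map 0%N) ?size_iota// nth_iota// add1n.
rewrite !kE//; last exact: ltnW.
rewrite /t -natr1 mulrDl mul1r addrAC subrr add0r.
rewrite ltr_pdivrMr// mulrC -ltr_pdivrMr//; exact: truncnS_gt.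
Qed.

Lemma is_young_integral_unique F (l1 l2 : R) :
  is_young_integral T F eta l1 -> is_young_integral T F eta l2 -> l1 = l2.
Proof.
move=> h1 h2; apply/eqP; rewrite -subr_eq0 -normr_le0; apply/ler_addgt0Pl => e e0.
have e2 : 0 < e / 2 by rewrite divr_gt0.
have [d1 d10 hd1] := h1 _ e2; have [d2 d20 hd2] := h2 _ e2.
have [|s sT fs] := @fine_dissection_exists (Num.min d1 d2); first by rewrite lt_min d10.
have [ps _] := sT.
have tg i : (i < size s)%N -> knot T s i <= knot T s i <= knot T s i.+1.
  by move=> is_; rewrite lexx ltW//; move/(pathP T): ps => /(_ i is_).
have f1 i : (i < size s)%N -> knot T s i.+1 - knot T s i < d1.
  by move=> /fs; rewrite lt_min => /andP[].
have f2 i : (i < size s)%N -> knot T s i.+1 - knot T s i < d2.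
  by move=> /fs; rewrite lt_min => /andP[].
have := hd1 s _ sT f1 tg; have := hd2 s _ sT f2 tg; rewrite addr0.
set S := \sum_(_ <= _ < _) _; rewrite !ltr_norml => /andP[? ?] /andP[? ?].
by rewrite ler_norml; apply/andP; split; lra.
Qed.

Lemma young_integralE F (l : R) : is_young_integral T F eta l -> young_integral T F eta = l.
Proof.
move=> hl; rewrite /young_integral; case: xgetP => [y _ hy|/(_ l)//].
exact: is_young_integral_unique hy hl.
Qed.

(** The constants [K] and [sg] are chosen before [F], [V], [C] and [A]. The explicit dependence of
    the error on [C] and [A] later gives both the growth in the control norm and the uniformity
    along sequences. *)
Lemma young_sums_cvg : exists2 K : R, 0 <= K & exists sg : R, [/\ 0 < sg, sg <= a &
  forall (F : R -> 'Hom('rV[R]_d, R^o)) (V : R -> R) (C A : R),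
    0 <= C -> 0 < A -> (forall s t, s <= t -> V s <= V t) -> V T - V 0 <= A ->
    (forall s t, 0 <= s -> s <= t -> t <= T -> opnorm (F t - F s) <= C * (V t - V s) `^ a) ->
    (forall e, 0 < e -> exists2 del : R, 0 < del & forall s t, 0 <= s -> s <= t -> t <= T ->
       t - s < del -> V t - V s <= e) ->
    exists2 l, is_young_integral T F eta l &
      forall e s, 0 <= e -> itv_partition 0 T s -> fine_dissection T V e s ->
        `|ysum F eta s - l| <= C * K * (e `^ sg * A `^ (a - sg))].
Proof.
have [b bE] : exists b, b = p^-1 by exists p^-1.
have b0 : 0 < b by rewrite bE invr_gt0 (lt_trans _ p1).
have b1 : b < 1 by rewrite bE invf_lt1// (lt_trans _ p1).
have ab : 1 < a + b by rewrite bE.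
(* Midpoint of [1 - b] and [a]: the series with exponent [a' + b] converges, while [a - a'] remains
   positive. *)
pose a' := (a + 1 - b) / 2.
have a'0 : 0 < a' by rewrite /a'; lra.
have a'a : a' < a by rewrite /a'; lra.
have th1 : 1 < a' + p^-1 by rewrite -bE /a'; lra.
have [Z Z0 hZ] := sum_powRN_bound th1.
pose K := 2 `^ a' * (2 * B) `^ p^-1 * Z.
have K0 : 0 <= K by rewrite !mulr_ge0 ?powR_ge0// ltW.
exists K => //; exists (a - a'); split; [lra|lra|].
move=> F V C A C0 A0 Vnd VA hF Vuc.
have p0 : 0 < p by exact: lt_trans p1.
have refine e s1 s : 0 <= e -> itv_partition 0 T s1 -> itv_partition 0 T s ->
    {subset s1 <= s} -> fine_dissection T V e s1 ->
    `|ysum F eta s - ysum F eta s1| <= C * K * (e `^ (a - a') * A `^ (a - (a - a'))).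
  move=> e0 s1T sT s1s f1.
  have := ysum_refine T0 C0 A0 B0 p0 a'0 a'a hF Vnd VA hB hZ e0 s1T sT s1s f1.
  rewrite powRM ?(ltW A0)// (_ : a - (a - a') = a'); last by ring.
  by move/le_trans; apply; rewrite le_eqVlt; apply/orP; left; apply/eqP; rewrite /K; ring.
have merge s1 s2 : itv_partition 0 T s1 -> itv_partition 0 T s2 ->
    exists s, [/\ itv_partition 0 T s, {subset s1 <= s} & {subset s2 <= s}].
  move=> s1T s2T; pose s := sort <=%R (undup (s1 ++ s2)).
  have ms z : (z \in s) = (z \in s1) || (z \in s2).
    by rewrite mem_sort mem_undup mem_cat.
  have [ps1 /eqP ls1] := s1T; have [ps2 /eqP ls2] := s2T.
  have bnd s' : path <%R 0 s' -> last 0 s' = T -> forall z, z \in s' -> 0 < z <= T.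
    move=> ps' ls' z zs'; have /allP/(_ z zs') -> := order_path_min lt_trans ps'.
    by rewrite -ls'; apply: path_lt_last ps' _; rewrite inE zs' orbT.
  have bs z : z \in s -> 0 < z <= T by rewrite ms => /orP[]; exact: bnd.
  have ps : path <%R 0 s.
    rewrite path_sortedE; last exact: lt_trans.
    by rewrite sort_lt_sorted undup_uniq andbT; apply/allP => z /bs/andP[].
  have Ts : T \in s.
    rewrite ms -ls1; have := mem_last 0 s1; rewrite inE ls1 => /orP[/eqP TE|->//].
    by move: T0; rewrite TE ltxx.
  exists s; split.
  - split => //; rewrite eq_le; apply/andP; split; last first.
      by apply: path_lt_last ps _; rewrite inE Ts orbT.
    by have := mem_last 0 s; rewrite inE => /orP[/eqP->|/bs/andP[]//]; exact: ltW.
  - by move=> z zs; rewrite ms zs.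
  - by move=> z zs; rewrite ms zs orbT.
pose E (e : R) := C * K * (e `^ (a - a') * A `^ (a - (a - a'))).
have cmp e1 e2 s1 s2 : 0 <= e1 -> 0 <= e2 -> itv_partition 0 T s1 -> itv_partition 0 T s2 ->
    fine_dissection T V e1 s1 -> fine_dissection T V e2 s2 ->
    ysum F eta s1 - E e1 <= ysum F eta s2 + E e2.
  move=> e10 e20 s1T s2T f1 f2; have [s [sT s1s s2s]] := merge _ _ s1T s2T.
  have := refine _ _ _ e10 s1T sT s1s f1; have := refine _ _ _ e20 s2T sT s2s f2.
  rewrite -/(E e1) -/(E e2) !ler_norml => /andP[? ?] /andP[? ?]; lra.
have fineE e : 0 < e -> exists2 del : R, 0 < del &
    forall s, itv_partition 0 T s -> (forall i, (i < size s)%N -> knot T s i.+1 - knot T s i < del) ->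
      fine_dissection T V e s.
  move=> e0; have [del del0 hdel] := Vuc _ e0; exists del => // s [ps /eqP ls] fs i is_.
  apply: hdel; [| | |exact: fs].
  - by apply: path_lt_head ps _; rewrite /knot mem_nth// /= ltnW.
  - by rewrite ltW//; move/(pathP T): ps => /(_ i is_).
  - by rewrite -[leRHS]ls; apply: path_lt_last ps _; rewrite /knot mem_nth.
(* The integral is the supremum of the lower bounds [ysum - E e]; by comparison through common
   refinements each [ysum + E e] is an upper bound of them. *)
pose X := [set y | exists e s, [/\ 0 <= e, itv_partition 0 T s, fine_dissection T V e s &
  y = ysum F eta s - E e]].
have [s0 s0T s0f] : exists2 s, itv_partition 0 T s & fine_dissection T V 1 s.
  have [del del0 hdel] := fineE 1 ltr01.
  by have [s sT fs] := fine_dissection_exists del0; exists s => //; exact: hdel.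
have X0 : X !=set0 by exists (ysum F eta s0 - E 1), 1, s0.
have Xub e s : 0 <= e -> itv_partition 0 T s -> fine_dissection T V e s ->
    ubound X (ysum F eta s + E e).
  by move=> e0 sT fs _ [e' [s' [e'0 s'T fs' ->]]]; exact: cmp.
have Xhub : has_ubound X by exists (ysum F eta s0 + E 1); exact: Xub.
pose l := sup X.
have lE e s : 0 <= e -> itv_partition 0 T s -> fine_dissection T V e s ->
    `|ysum F eta s - l| <= E e.
  move=> e0 sT fs; rewrite distrC ler_norml; apply/andP; split.
    by rewrite lerBrDl; apply: ub_le_sup => //; exists e, s.
  by rewrite lerBlDl; apply: ge_sup => //; exact: Xub.
exists l => // eps eps0.
pose Q := C * K * A `^ (a - (a - a')) + C * (A + B).
have AB0 : 0 <= A + B by rewrite addr_ge0// ltW.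
have Q0 : 0 <= Q.
  by apply: addr_ge0; [apply: mulr_ge0; [exact: mulr_ge0|exact: powR_ge0]|exact: mulr_ge0].
(* This will be the value of [e^(a - a')]. The tag error is of order [e^(2 (a - a'))], that is
   [x^2], which is at most [x] because [x <= 1]. *)
pose x := Num.min 1 (eps / (2 * (Q + 1))).
have x0 : 0 < x by rewrite lt_min ltr01 divr_gt0// mulr_gt0// ltr_wpDl.
have x1 : x <= 1 by rewrite ge_min lexx.
have xQ : x * Q < eps.
  apply: (@le_lt_trans _ _ (eps / (2 * (Q + 1)) * (Q + 1))).
    apply: ler_pM => //; [exact: ltW|by rewrite ge_min lexx orbT|by rewrite lerDl].
  rewrite invfM mulrA -mulrA mulVf ?mulr1 ?gt_eqF ?ltr_wpDl//.
  by rewrite ltr_pdivrMr// ltr_pMr// ltr1n.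
have sg0 : 0 < a - a' by rewrite subr_gt0.
pose e := x `^ (a - a')^-1.
have exE : e `^ (a - a') = x by rewrite -powRrM mulVf ?gt_eqF// powRr1// ltW.
have e0 : 0 < e by exact: powR_gt0.
have [del del0 hdel] := fineE e e0; exists del => // s tau sT fs htau.
have fV := hdel s sT fs.
have h1 := lE e s (ltW e0) sT fV.
have h2 := ysum_tag p1 C0 p0 a'0 a'a hF Vnd VA hB (ltW e0) ap sT fV htau.
have exE2 : e `^ (a + p^-1 - 1) <= x.
  have -> : a + p^-1 - 1 = (a - a') + (a - a') by rewrite -bE /a'; lra.
  rewrite powRD ?exE; last by rewrite (gt_eqF e0) implybT.
  by rewrite ger_pMl.
set S := \sum_(_ <= _ < _) _ in h2 *.
have -> : S - l = (S - ysum F eta s) + (ysum F eta s - l) by ring.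
apply: le_lt_trans (ler_normD _ _) _; apply: le_lt_trans (lerD h2 h1) _.
apply: le_lt_trans xQ.
have -> : x * Q = C * (x * (A + B)) + C * K * (x * A `^ (a - (a - a'))).
  by rewrite /Q; ring.
rewrite /E exE lerD2r; apply: ler_wpM2l => //; exact: ler_wpM2r.
Qed.

End YoungIntegral.

(** * Measurability, uniform continuity and convexity *)

Section LowerIntegral.
Context d (X : measurableType d) {R : realType} (mu : {measure set X -> \bar R}).
Implicit Types (D : set X) (f g : X -> \bar R).
Local Open Scope ereal_scope.
Import HBNNSimple.

(* The integral of a nonnegative function is a supremum over simple functions
   below it, so monotonicity needs no measurability. *)
Lemma ge0_le_lower_integral D f g : (forall x, D x -> 0 <= f x) ->
  (forall x, D x -> f x <= g x) -> \int[mu]_(x in D) f x <= \int[mu]_(x in D) g x.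
Proof.
move=> f0 fg; have g0 x : D x -> 0 <= g x by move=> Dx; exact: le_trans (f0 _ Dx) (fg _ Dx).
rewrite !ge0_integralE//; apply: ereal_sup_le => _ [h hf <-].
exists h => //= x.
apply: le_trans (hf x) _; rewrite /patch; case: ifPn => //; rewrite inE; exact: fg.
Qed.

(** Meant for the running cost, which may be non-measurable on the null set where the control leaves
    [U]. The null set is removed from the simple functions below [f], which are measurable. *)
Lemma ge0_integral_ae_subset D D' f : measurable D -> measurable D' -> D' `<=` D ->
  mu (D `\` D') = 0 -> (forall x, D x -> 0 <= f x) ->
  \int[mu]_(x in D) f x = \int[mu]_(x in D') f x.
Proof.
move=> mD mD' D'D D0 f0; have f0' x : D' x -> 0 <= f x by move=> /D'D; exact: f0.
apply/eqP; rewrite eq_le; apply/andP; split.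
  rewrite [X in X <= _]ge0_integralE//; apply: ge_ereal_sup => _ [h hf <-].
  have hfD x : ~ D x -> h x = 0%R.
    move=> nDx; have := hf x; rewrite patchE memNset// lee_fin => h0.
    by apply/eqP; rewrite eq_le h0/=.
  rewrite -integralT_nnsfun.
  have -> : \int[mu]_x (h x)%:E = \int[mu]_(x in D) (h x)%:E.
    rewrite [RHS]integral_mkcond; apply: eq_integral => x _.
    by rewrite patchE; case: ifPn => //; rewrite notin_setE => /hfD ->.
  have mN : measurable (D `\` D') by exact: measurableD.
  rewrite (ge0_negligible_integral mN mD _ _ D0); last 2 first.
  - by apply/measurable_EFinP; exact: measurable_funTS.
  - by move=> x _; rewrite lee_fin.
  rewrite setDD (setIidr D'D); apply: ge0_le_lower_integral => x D'x; first by rewrite lee_fin.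
  by have := hf x; rewrite patchE mem_set//; exact: D'D.
rewrite integral_mkcond [X in _ <= X]integral_mkcond; apply: ge0_le_lower_integral => x _.
  by rewrite /patch; case: ifPn => //; rewrite inE; exact: f0'.
rewrite /patch; case: ifPn => [|_]; first by rewrite inE => /D'D/mem_set ->.
by case: ifPn => //; rewrite inE; exact: f0.
Qed.

Lemma integral_ae_subset D D' f : measurable D -> measurable D' -> D' `<=` D ->
  mu (D `\` D') = 0 -> \int[mu]_(x in D) f x = \int[mu]_(x in D') f x.
Proof.
move=> mD mD' D'D D0; rewrite integralE [RHS]integralE.
by rewrite !(@ge0_integral_ae_subset D D').
Qed.

End LowerIntegral.

(** * Continuity within a set and compactness *)

Section Continuity.
Context {R : realType}.

Lemma within_comp (X Y Z : topologicalType) (A : set X) (S : set Y) (k : X -> Y) (h : Y -> Z) :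
  (forall t, A t -> S (k t)) -> {within A, continuous k} -> {within S, continuous h} ->
  {within A, continuous (h \o k)}.
Proof.
move=> AS /subspace_continuousP ck /subspace_continuousP ch.
apply/subspace_continuousP => t At B hB.
have hk : nbhs t (fun z => A z -> S (k z) -> B (h (k z))) := ck _ At _ (ch _ (AS _ At) _ hB).
suff : nbhs t (fun z => A z -> B (h (k z))) by [].
by apply: filterS hk => z hz Az; apply: (hz Az); exact: AS.
Qed.

(** Otherwise pairs of points of [K] at distance below [1/(n + 1)] whose values stay [e] apart would
    have a common limit along an ultrafilter. *)
Lemma heine (X : pseudoMetricType R) (V : normedModType R) (K S : set X) (h : X -> V) :
  compact K -> K `<=` S -> {within S, continuous h} ->
  forall e : R, 0 < e -> exists2 del : R, 0 < del &
    forall x y, K x -> K y -> ball x del y -> `|h x - h y| < e.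
Proof.
move=> cK KS /subspace_continuousP ch e e0; apply: contrapT => hn.
have hn' (n : nat) : exists xy : X * X,
    [/\ K xy.1, K xy.2, ball xy.1 n.+1%:R^-1 xy.2 & e <= `|h xy.1 - h xy.2|].
  apply: contrapT => hn'; apply: hn; exists n.+1%:R^-1; first by rewrite invr_gt0.
  move=> x y Kx Ky xy; rewrite ltNge; apply/negP => ehxy.
  by apply: hn'; exists (x, y).
have [xy hxy] := choice hn'.
have [F [FU Foo]] := ultraFilterLemma (@eventually_filter).
have FF : ProperFilter F by exact: ultra_proper.
have [l Kl xl] : exists2 l, K l & (xy n).1 @[n --> F] --> l.
  by apply: (ultra_compact_cvg FU cK); apply: nearW => n; have [] := hxy n.
have yl : (xy n).2 @[n --> F] --> l.
  apply/cvg_ballP => eps eps0; have e2 : 0 < eps / 2 by rewrite divr_gt0.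
  move/cvg_ballP: xl => /(_ _ e2) xl.
  have small : \forall n \near F, n.+1%:R^-1 < eps / 2.
    by apply: Foo; exact: near_infty_natSinv_lt (PosNum e2).
  near=> n; have [_ _ b _] := hxy n; rewrite (splitr eps); apply: (@ball_triangle _ _ (xy n).1).
    by near: n.
  by apply: le_ball b; apply: ltW; near: n.
have cv (k : nat -> X) : (forall n, K (k n)) -> k n @[n --> F] --> l -> h (k n) @[n --> F] --> h l.
  move=> Kk kl; apply: cvg_trans (ch l (KS _ Kl)) => A hA.
  have := kl _ hA; rewrite /nbhs/= => h'; apply: filterS h' => n; apply; exact/KS/Kk.
have h1 : h (xy n).1 @[n --> F] --> h l by apply: cv => // n; have [] := hxy n.
have h2 : h (xy n).2 @[n --> F] --> h l by apply: cv => // n; have [] := hxy n.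
have /cvgr0Pnorm_lt he : h (xy n).1 - h (xy n).2 @[n --> F] --> (0 : V).
  by rewrite -(subrr (h l)); exact: cvgB.
have [n] := filter_ex (he _ e0); have [_ _ _ + hlt] := hxy n.
by rewrite leNgt hlt.
Unshelve. all: by end_near. Qed.

Lemma compact_norm_bounded (X : topologicalType) (V : normedModType R) (K : set X) (h : X -> V) :
  compact K -> {within K, continuous h} ->
  exists2 C : R, 0 <= C & forall x, K x -> `|h x| <= C.
Proof.
move=> cK ch; have [M [_ hM]] := compact_bounded (continuous_compact ch cK).
exists (`|M| + 1) => [|x Kx]; first by rewrite addr_ge0.
have := hM (`|M| + 1); rewrite (le_lt_trans (ler_norm M)) ?ltrDl// => /(_ isT).
by apply; exists x.
Qed.

End Continuity.

(** * Borel measurability of controls *)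

Section BorelE.
Context {R : realType} {E : normedVectType R} (T : R).
Notation BE := (g_sigma_algebraType (@open E)).
Implicit Type u : R -> E.

Lemma open_measurableE (A : set E) : open A -> @measurable _ BE A.
Proof. exact: sub_sigma_algebra. Qed.

Lemma closed_measurableE (A : set E) : closed A -> @measurable _ BE A.
Proof.
by move=> cA; rewrite -(setCK A); apply: measurableC; apply: open_measurableE; exact: closed_openC.
Qed.

Lemma control_comp_measurable u (h : E -> R) : measurable_control T u -> continuous h ->
  measurable_fun (`[0, T] : set (measurableTypeR R)) (h \o u).
Proof.
move=> mu_ ch; apply: (measurability _ (RGenOpens.measurableE R)) => //= _ [_ [a [b ->] <-]].
rewrite comp_preimage; apply: mu_ => //; apply: open_measurableE.
by move/continuousP: ch; apply; exact: interval_open.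
Qed.

(** An open set of [E] is a countable union of coordinate boxes with rational centres, and the
    preimage of a box is a finite intersection of preimages under the coordinates. *)
Lemma coord_measurable_control u :
  (forall i, measurable_fun (`[0, T] : set (measurableTypeR R)) (fun t => ecoord i (u t))) ->
  measurable_control T u.
Proof.
move=> mc; rewrite /measurable_control; apply: (measurability (@open E : set (set BE))) => //.
move=> _ [A oA <-].
have [C C1 hC] := norm_le_ecoord E.
have C0 : 0 < C by exact: lt_le_trans C1.
pose box (q : {ffun 'I_(edim E) -> rat}) (m : nat) : set E :=
  [set w | forall i, `|ecoord i w - ratr (q i)| < m.+1%:R^-1].
pose G (z : {ffun 'I_(edim E) -> rat} * nat) := box z.1 z.2 `<=` A.
have AE : A = \bigcup_(z in G) box z.1 z.2.
  apply/seteqP; split; last by move=> w [z]; apply.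
  move=> w Aw.
  have /nbhs_ballP[e /= e0 he] : nbhs w A by exact: open_nbhs_nbhs.
  pose n := (edim E)%:R : R.
  have n1 : 0 < n + 1 by rewrite ltr_wpDl.
  (* Points of one box differ by less than [2/(m + 1)] in each coordinate, and [C] converts this
     into the norm; [n + 1] instead of [n] avoids a division by zero in dimension zero. *)
  have [m hm] : exists m : nat, m.+1%:R^-1 < e / (2 * C * (n + 1)).
    have e' : 0 < e / (2 * C * (n + 1)) by rewrite divr_gt0// !mulr_gt0.
    by have /filter_ex := near_infty_natSinv_lt (PosNum e').
  have hq i : exists q : rat, `|ecoord i w - ratr q| < m.+1%:R^-1.
    have m0 : 0 < m.+1%:R^-1 :> R by rewrite invr_gt0.
    have [q] := @rat_in_itvoo R (ecoord i w) (ecoord i w + m.+1%:R^-1) (ltac:(by rewrite ltrDl)).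
    rewrite in_itv/= => /andP[q1 q2]; exists q.
    by rewrite distrC ger0_norm ?subr_ge0 ?(ltW q1)// ltrBlDl.
  have [q hq'] := choice hq.
  exists ([ffun i => q i], m); last by move=> i; rewrite ffunE; exact: hq'.
  move=> v hv; apply: he; rewrite -ball_normE/=.
  apply: le_lt_trans (hC _) _; rewrite mulrC -ltr_pdivlMr//.
  apply: (@le_lt_trans _ _ (\sum_(i < edim E) 2 * m.+1%:R^-1)).
    apply: ler_sum => i _; rewrite ecoordB.
    have := hv i; rewrite /= ffunE => h1; have h2 := hq' i.
    have -> : ecoord i w - ecoord i v = (ecoord i w - ratr (q i)) - (ecoord i v - ratr (q i)) by ring.
    by apply: le_trans (ler_normB _ _) _; rewrite mulr_natl mulr2n; apply: lerD; exact: ltW.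
  rewrite sumr_const card_ord -[ltLHS]mulr_natl -/n.
  apply: (@le_lt_trans _ _ ((n + 1) * (2 * m.+1%:R^-1))).
    by rewrite ler_wpM2r ?mulr_ge0 ?invr_ge0// lerDl.
  have := hm; rewrite ltr_pdivlMr ?mulr_gt0// => hm'; rewrite ltr_pdivlMr//.
  by apply: le_lt_trans hm'; rewrite le_eqVlt; apply/orP; left; apply/eqP; ring.
rewrite AE bigcup_mkcond preimage_bigcup setI_bigcupr.
apply: countable_bigcupT_measurable => [|z]; first exact: countableP.
case: ifPn => _; last by rewrite preimage_set0 setI0; exact: measurable0.
have -> : `[0, T] `&` u @^-1` box z.1 z.2 = `[0, T] `&` \bigcap_(i in [set: 'I_(edim E)])
    (`[0, T] `&` (fun t => ecoord i (u t)) @^-1` `]ratr (z.1 i) - z.2.+1%:R^-1, ratr (z.1 i) + z.2.+1%:R^-1[).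
  apply/seteqP; split => t [It ht]; split => // i; last first.
    by have [_ /=] := ht i Logic.I; rewrite in_itv/= ltr_distl.
  by move=> _; split=> //=; rewrite in_itv/= -ltr_distl; exact: ht.
apply: measurableI; first exact: measurable_itv.
apply: fin_bigcap_measurable; first exact: finite_finset.
by move=> i _; apply: mc; exact: measurable_itv.
Qed.

Lemma closed_preimage_measurable u (U : set E) : measurable_control T u -> closed U ->
  measurable (`[0, T] `&` u @^-1` U : set (measurableTypeR R)).
Proof.
move=> mu_ cU; apply: mu_; first exact: measurable_itv.
exact: closed_measurableE.
Qed.

End BorelE.

(** * Finite convex combinations *)

Section ConvexCombinations.
Context {R : realType} {E : lmodType R}.
Implicit Type U : set E.

Lemma convex_set_pair U : convex_set U -> forall (a : R) v w, 0 <= a -> a <= 1 ->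
  U v -> U w -> U (a *: v + (1 - a) *: w).
Proof.
move=> cU a v w a0 a1 Uv Uw.
by have := cU v w (Itv01 a0 a1) (mem_set Uv) (mem_set Uw); rewrite inE.
Qed.

(** Convexity is taken in its two-point form so that the lemma also applies to an epigraph. *)
Lemma convex_set_sum U : (forall (a : R) v w, 0 <= a -> a <= 1 -> U v -> U w ->
    U (a *: v + (1 - a) *: w)) ->
  forall (n : nat) (a : nat -> R) (w : nat -> E), (forall i, 0 <= a i) -> (forall i, U (w i)) ->
  \sum_(i < n) a i = 1 -> U (\sum_(i < n) a i *: w i).
Proof.
move=> cU n a w a0 Uw; elim: n a a0 => [|n ih] a a0.
  by rewrite big_ord0 => /eqP; rewrite eq_sym oner_eq0.
rewrite !big_ord_recr/= => sE; pose s := \sum_(i < n) a i.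
have s0 : 0 <= s by exact: sumr_ge0.
have [s0'|sn0] := eqVneq s 0.
  have az i : (i < n)%N -> a i = 0.
    move=> ilt; have /psumr_eq0P : \sum_(i < n) a i = 0 by [].
    by move=> /(_ (fun i _ => a0 i)) /(_ (Ordinal ilt) isT).
  rewrite big1 => [|i _]; last by rewrite az// scale0r.
  by move: sE; rewrite -/s s0' !add0r => ->; rewrite scale1r.
have sgt0 : 0 < s by rewrite lt_neqAle eq_sym sn0.
have s1 : s <= 1 by rewrite -sE -/s lerDl.
have -> : \sum_(i < n) a i *: w i = s *: (\sum_(i < n) (s^-1 * a i) *: w i).
  by rewrite scaler_sumr; apply: eq_bigr => i _; rewrite scalerA mulrA mulfV// mul1r.
have -> : a n = 1 - s by rewrite -sE -/s; ring.
apply: cU => //; apply: (ih (fun i => s^-1 * a i)) => [i|]; first by rewrite mulr_ge0// invr_ge0.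
by rewrite -mulr_sumr mulVf.
Qed.

End ConvexCombinations.

(* The epigraph is convex. *)
Lemma convex_function_sum (R : realType) (E : lmodType R) (U : set E) (h : E -> R) :
  convex_set U -> convex_function U h ->
  forall (n : nat) (a : nat -> R) (w : nat -> E), (forall i, 0 <= a i) -> (forall i, U (w i)) ->
  \sum_(i < n) a i = 1 -> h (\sum_(i < n) a i *: w i) <= \sum_(i < n) a i * h (w i).
Proof.
move=> cU ch n a w a0 Uw s1.
pose G : set (E * R^o)%type := [set z | U z.1 /\ h z.1 <= z.2].
have cG (b : R) v z : 0 <= b -> b <= 1 -> G v -> G z -> G (b *: v + (1 - b) *: z).
  move=> b0 b1 [Uv hv] [Uz hz]; split; first exact: convex_set_pair.
  have := ch (Itv01 b0 b1) v.1 z.1 (mem_set Uv) (mem_set Uz) => /le_trans; apply.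
  rewrite convRE/=; apply: lerD; apply: ler_wpM2l => //.
  by rewrite subr_ge0.
have := convex_set_sum cG a0 (w := fun i => (w i, h (w i))) (fun i => conj (Uw i) (lexx _)) s1.
have -> : \sum_(i < n) a i *: ((w i, h (w i)) : E * R^o) =
    (\sum_(i < n) a i *: w i, \sum_(i < n) a i * h (w i)).
  by elim: (n) => [|k ih]; rewrite ?big_ord0// !big_ord_recr/= ih.
by case.
Qed.

(** * Quantisation of controls with values in [U] *)

Section Quantiser.
Context {R : realType} {E : normedVectType R}.

Lemma norm_control_measurable (T : R) (u : R -> E) : measurable_control T u ->
  measurable_fun (`[0, T] : set (measurableTypeR R)) (fun t => `|u t|).
Proof.
by move=> mu_; apply: (control_comp_measurable (h := fun v => `|v|)) => //; exact: norm_continuous.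
Qed.

Lemma dist_control_measurable (T : R) (u : R -> E) (c : E) : measurable_control T u ->
  measurable_fun (`[0, T] : set (measurableTypeR R)) (fun t => `|u t - c|).
Proof.
move=> mu_; apply: (control_comp_measurable (h := fun v => `|v - c|)) => // v.
apply: (@continuous_comp _ _ _ (fun v : E => v - c) Num.norm); last exact: norm_continuous.
by apply: cvgB; [exact: cvg_id|exact: cvg_cst].
Qed.

(** A finite cover of the compact set [U] intersected with the ball of radius [K], by balls of
    radius [e] centred in that set; the index of [v] is that of the first centre close to it.
    Vectors longer than [K] get the index past the end of the list, where [nth] returns [w0]. *)
Lemma quantiser (U : set E) (w0 : E) (K e : R) : closed U -> U w0 -> 0 < e ->
  exists (m : nat) (w : nat -> E) (idx : E -> nat),
  [/\ forall l, U (w l), forall v, (idx v <= m)%N,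
      forall v, U v -> `|v| <= K -> `|v - w (idx v)| < e,
      forall v, K < `|v| -> w (idx v) = w0 &
      forall (T : R) u, measurable_control T u -> forall l,
        measurable (`[0, T] `&` [set t | idx (u t) = l] : set (measurableTypeR R))].
Proof.
move=> cU Uw0 e0; pose B := U `&` [set v : E | `|v| <= K].
have cB : compact B.
  by rewrite /B setIC; apply: compact_closedI => //; exact: closed_ball0_compact.
move: (cB); rewrite compact_cover => /(_ E B (fun c => ball c e)) [].
- by move=> c _; exact: ball_open.
- by move=> v Bv; exists v => //; exact: ballxx.
move=> D DB BD.
pose cs : seq E := finmap.enum_fset D.
have csU c : c \in cs -> U c.
  by move=> cD; have := DB c cD; rewrite inE => -[].
pose idx (v : E) := if `|v| <= K then find (fun c => `|v - c| < e) cs else size cs.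
pose w l := nth w0 cs l.
exists (size cs), w, idx; split.
- by move=> l; rewrite /w; case: (ltnP l (size cs)) => [/(mem_nth w0)/csU//|h]; rewrite nth_default.
- by move=> v; rewrite /idx; case: ifPn => // _; exact: find_size.
- move=> v Uv vK; rewrite /idx vK /w.
  apply: (nth_find w0 (a := fun c => `|v - c| < e)); apply/hasP.
  have [c cD /= vc] := BD v (conj Uv vK); exists c => //.
  by move: vc; rewrite -ball_normE/= distrC.
- by move=> v Kv; rewrite /idx leNgt Kv/= /w nth_default.
- move=> T u mu_ l.
  have mI : measurable (`[0, T] : set (measurableTypeR R)) by exact: measurable_itv.
  have mfind s k : measurable (`[0, T] `&` [set t | find (fun c => `|u t - c| < e) s = k]
      : set (measurableTypeR R)).
    elim: s k => [|c s ih] k /=.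
      case: k => [|k].
        by have -> : [set t : R | 0%N = 0%N] = setT; [apply/seteqP; split|rewrite setIT].
      by have -> : [set t : R | 0%N = k.+1] = set0; [apply/seteqP; split|rewrite setI0].
    have mc : measurable (`[0, T] `&` [set t | `|u t - c| < e] : set (measurableTypeR R)).
      have := dist_control_measurable c mu_ mI (measurable_itv `]-oo, e[).
      by congr (measurable (_ `&` _)); apply/seteqP; split => t /=; rewrite in_itv.
    case: k => [|k].
      suff -> : [set t | (if `|u t - c| < e then 0%N else (find (fun c => `|u t - c| < e) s).+1) = 0%N]
        = [set t | `|u t - c| < e] by [].
      by apply/seteqP; split => t /=; case: ifP.
    rewrite (_ : _ `&` _ = (`[0, T] `&` [set t | find (fun c => `|u t - c| < e) s = k]) `\`
        (`[0, T] `&` [set t | `|u t - c| < e])); first exact: measurableD.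
    apply/seteqP; split => t /=.
      by move=> [It]; case: ifPn => // /negP h [<-]; split => // -[].
    move=> [[It fk] h]; split => //; case: ifPn => [h'|_]; last by rewrite fk.
    by case: h.
  have mK : measurable (`[0, T] `&` [set t | `|u t| <= K] : set (measurableTypeR R)).
    have := norm_control_measurable mu_ mI (measurable_itv `]-oo, K]).
    by congr (measurable (_ `&` _)); apply/seteqP; split => t /=; rewrite in_itv.
  rewrite (_ : _ `&` _ = ((`[0, T] `&` [set t | find (fun c => `|u t - c| < e) cs = l]) `&`
      (`[0, T] `&` [set t | `|u t| <= K])) `|`
      (if size cs == l then `[0, T] `\` (`[0, T] `&` [set t | `|u t| <= K]) else set0)).
    apply: measurableU; first exact: measurableI.
    by case: ifP => _ //; exact: measurableD.
  apply/seteqP; split => t /=.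
    move=> [It]; rewrite /idx; case: ifPn => [tK <-|tK <-]; first by left.
    by right; rewrite eqxx; split=> // -[_ /(negP tK)].
  case=> [[[It fl] [_ tK]]|]; first by split => //; rewrite /idx tK.
  case: eqP => // <- [It h]; split => //; rewrite /idx ifF//.
  by apply/negP => tK; apply: h.
Qed.

End Quantiser.

(** * Weak compactness for signed functions and equi-integrability *)

Section MoreIntegrals.
Context {R : realType}.
Notation mu := (@lebesgue_measure R).
Implicit Types (A B D : set (measurableTypeR R)) (h v : R -> R).

Lemma integrableD_fun D h v : measurable D -> mu.-integrable D (EFin \o h) ->
  mu.-integrable D (EFin \o v) -> mu.-integrable D (EFin \o (fun t => h t + v t)).
Proof.
move=> mD hi vi; have := integrableD mD hi vi.
by apply: eq_integrable => // t _; rewrite /= EFinD.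
Qed.

Lemma integrableB_fun D h v : measurable D -> mu.-integrable D (EFin \o h) ->
  mu.-integrable D (EFin \o v) -> mu.-integrable D (EFin \o (fun t => h t - v t)).
Proof.
move=> mD hi vi; have := integrableB mD hi vi.
by apply: eq_integrable => // t _; rewrite /= EFinB.
Qed.

Lemma integrableZ_fun D (c : R) h : measurable D -> mu.-integrable D (EFin \o h) ->
  mu.-integrable D (EFin \o (fun t => c * h t)).
Proof.
move=> mD hi; have := integrableZl mD c hi.
by apply: eq_integrable => // t _; rewrite /= EFinM.
Qed.

Lemma integrable_cst_fun D (c : R) : measurable D -> (mu D < +oo)%E ->
  mu.-integrable D (EFin \o (fun=> c)).
Proof. by move=> mD Dfin; apply: (@integrable_bounded _ _ _ `|c|). Qed.

Lemma integrable_finsum (J : finType) D (h : J -> R -> R) : measurable D -> (mu D < +oo)%E ->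
  (forall j, mu.-integrable D (EFin \o h j)) ->
  mu.-integrable D (EFin \o (fun t => \sum_j h j t)).
Proof.
move=> mD Dfin hi; elim: (index_enum J) => [|j s ih].
  under [X in EFin \o X]eq_fun do rewrite big_nil.
  exact: integrable_cst_fun.
under [X in EFin \o X]eq_fun do rewrite big_cons.
exact: integrableD_fun.
Qed.

Lemma Rintegral_finsum (J : finType) D (h : J -> R -> R) : measurable D -> (mu D < +oo)%E ->
  (forall j, mu.-integrable D (EFin \o h j)) ->
  \int[mu]_(t in D) (\sum_j h j t) = \sum_j \int[mu]_(t in D) h j t.
Proof.
move=> mD Dfin hi.
suff [] : mu.-integrable D (EFin \o (fun t => \sum_j h j t)) /\
  \int[mu]_(t in D) (\sum_j h j t) = \sum_j \int[mu]_(t in D) h j t by [].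
elim: (index_enum J) => [|j s [ih1 ih2]].
  split; first by under [X in EFin \o X]eq_fun do rewrite big_nil; exact: integrable_cst_fun.
  rewrite big_nil; under eq_Rintegral do rewrite big_nil.
  by rewrite /Rintegral integral0.
split; first by under [X in EFin \o X]eq_fun do rewrite big_cons; exact: integrableD_fun.
rewrite big_cons -ih2 -RintegralD//.
by apply: eq_Rintegral => t _; rewrite big_cons.
Qed.

Lemma integrable_le D h v : measurable D -> mu.-integrable D (EFin \o v) ->
  measurable_fun D h -> (forall t, D t -> `|h t| <= v t) -> mu.-integrable D (EFin \o h).
Proof.
move=> mD vi mh hv; apply: (le_integrable mD _ _ vi); first exact/measurable_EFinP.
by move=> t Dt; rewrite /= lee_fin (le_trans (hv t Dt))// ler_norm.
Qed.

Lemma Rintegral_norm_le D h v : measurable D -> mu.-integrable D (EFin \o v) ->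
  measurable_fun D h -> (forall t, D t -> `|h t| <= v t) ->
  `|\int[mu]_(t in D) h t| <= \int[mu]_(t in D) v t.
Proof.
move=> mD vi mh hv; have hi := integrable_le mD vi mh hv.
apply: le_trans (le_normr_Rintegral mD hi) _; apply: le_Rintegral => //.
exact: integrable_norm.
Qed.

Lemma measurable_fun_ifset D S (p : R -> bool) (a b : R -> R) : measurable D -> measurable S ->
  D `&` [set t | p t] = S -> measurable_fun D a -> measurable_fun D b ->
  measurable_fun D (fun t => if p t then a t else b t).
Proof.
move=> mD mS DpS ma mb.
have mp : measurable_fun D p.
  by apply: (measurable_fun_bool true); rewrite (_ : _ `&` _ = S)// -DpS.
apply: measurable_fun_if => //.
  by apply: measurable_funS mD _ ma; exact: subIsetl.
by apply: measurable_funS mD _ mb; exact: subIsetl.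
Qed.

Lemma measurable_glue D (idx : R -> nat) (h : nat -> R -> R) : measurable D ->
  (forall l, measurable (D `&` [set t | idx t = l])) ->
  (forall l, measurable_fun D (h l)) -> measurable_fun D (fun t => h (idx t) t).
Proof.
move=> mD midx mh _ B mB.
have -> : D `&` (fun t => h (idx t) t) @^-1` B =
    \bigcup_l ((D `&` [set t | idx t = l]) `&` (D `&` h l @^-1` B)).
  apply/seteqP; split => [t [Dt hB]|t [l _ [[Dt /= <-] [_ hB]]]//].
  by exists (idx t).
by apply: bigcupT_measurable => l; apply: measurableI => //; exact: mh.
Qed.

(** Positive and negative parts have weak limits separately; writing them as [max (s v) 0] with
    [s = 1] and [s = -1] treats both at once. *)
Lemma weak_compact (I : Type) (F : set_system I) D (v : I -> R -> R) (M : R) :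
  UltraFilter F -> measurable D -> (mu D < +oo)%E ->
  (forall n, mu.-integrable D (EFin \o v n)) ->
  (forall n, \int[mu]_(t in D) `|v n t| <= M) ->
  (forall e : R, 0 < e -> exists2 del : R, 0 < del &
     forall n A, measurable A -> A `<=` D -> (mu A < del%:E)%E ->
       \int[mu]_(t in A) `|v n t| < e) ->
  exists2 w : R -> R, mu.-integrable setT (EFin \o w) &
    forall A h (K : R), measurable A -> A `<=` D -> measurable_fun A h ->
      (forall t, A t -> `|h t| <= K) ->
      \int[mu]_(t in A) (v n t * h t) @[n --> F] --> \int[mu]_(t in A) (w t * h t).
Proof.
move=> FU mD Dfin vi vM vac.
have half (s : R) : `|s| = 1 -> exists theta : R -> R, [/\ forall t, 0 <= theta t,
    mu.-integrable setT (EFin \o theta) & forall A h (K : R), measurable A -> A `<=` D ->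
      measurable_fun A h -> (forall t, A t -> `|h t| <= K) ->
      \int[mu]_(t in A) (Num.max (s * v n t) 0 * h t) @[n --> F] -->
      \int[mu]_(t in A) (theta t * h t)].
  move=> s1.
  have le_abs n t : Num.max (s * v n t) 0 <= `|v n t|.
    rewrite ge_max normr_ge0 andbT; apply: le_trans (ler_norm _) _.
    by rewrite normrM s1 mul1r.
  have ge0 n t : 0 <= Num.max (s * v n t) 0 by rewrite le_max lexx orbT.
  have mi n : mu.-integrable D (EFin \o (fun t => Num.max (s * v n t) 0)).
    apply: (@integrable_le _ _ (fun t => `|v n t|)) => //; first exact: integrable_norm.
      apply: measurable_maxr => //; apply: measurable_funM => //.
      exact: integrable_measurable.
    by move=> t _; rewrite ger0_norm.
  have cmp n A : measurable A -> A `<=` D ->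
      \int[mu]_(t in A) Num.max (s * v n t) 0 <= \int[mu]_(t in A) `|v n t|.
    move=> mA AD; apply: le_Rintegral => //; first by apply: integrableS (mi n).
    by apply: integrableS (integrable_norm (vi n)).
  apply: (@weak_compact_ge0 _ _ _ _ _ M) => //.
  - by move=> n; apply: le_trans (vM n); exact: cmp.
  - move=> e e0; have [del del0 hdel] := vac e e0; exists del => // n A mA AD muA.
    by apply: le_lt_trans (hdel n A mA AD muA); exact: cmp.
have [|p [p0 pi pc]] := half 1; first by rewrite normr1.
have [|q [q0 qi qc]] := half (-1); first by rewrite normrN1.
exists (fun t => p t - q t); first exact: integrableB_fun.
move=> A h K mA AD mh hK.
have piA : mu.-integrable A (EFin \o p) by exact: integrableS pi.
have qiA : mu.-integrable A (EFin \o q) by exact: integrableS qi.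
have E1 : \int[mu]_(t in A) ((p t - q t) * h t) =
    \int[mu]_(t in A) (p t * h t) - \int[mu]_(t in A) (q t * h t).
  rewrite -RintegralB//; [|exact: integrable_mulr_bounded hK|exact: integrable_mulr_bounded hK].
  by apply: eq_Rintegral => t _; rewrite mulrBl.
rewrite E1.
have E2 : (fun n => \int[mu]_(t in A) (v n t * h t)) =
    (fun n => \int[mu]_(t in A) (Num.max (1 * v n t) 0 * h t) -
              \int[mu]_(t in A) (Num.max (-1 * v n t) 0 * h t)).
  apply/funext => n.
  have viA : mu.-integrable A (EFin \o v n) by exact: integrableS (vi n).
  have mi s : `|s| = 1 :> R -> mu.-integrable A (EFin \o (fun t => Num.max (s * v n t) 0)).
    move=> s1; apply: (@integrable_le _ _ (fun t => `|v n t|)) => //; first exact: integrable_norm.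
      apply: measurable_maxr => //; apply: measurable_funM => //.
      exact: integrable_measurable.
    move=> t _; rewrite ger0_norm ?le_max ?lexx ?orbT// ge_max normr_ge0 andbT.
    by apply: le_trans (ler_norm _) _; rewrite normrM s1 mul1r.
  rewrite -RintegralB//; last 2 first.
  - by apply: (@integrable_mulr_bounded _ _ _ _ K) => //; apply: mi; rewrite normr1.
  - by apply: (@integrable_mulr_bounded _ _ _ _ K) => //; apply: mi; rewrite normrN1.
  apply: eq_Rintegral => t _; rewrite -mulrBl mul1r mulN1r; congr (_ * _).
  by rewrite /Order.max; case: (ltP (v n t) 0); case: (ltP (- v n t) 0) => ? ?; lra.
rewrite E2; apply: cvgB; [exact: pc hK|exact: qc hK].
Qed.

(** The function [y^(1 - r)] decreases. The gain [K^(1 - r)], small for large [K], is the source of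
    equi-integrability and of all absorption arguments below. *)
Lemma ge_powR_mul (K r y : R) : 0 < K -> 1 < r -> K <= y -> y <= K `^ (1 - r) * y `^ r.
Proof.
move=> K0 r1 Ky; have y0 : 0 < y by exact: lt_le_trans Ky.
have yE : y = y `^ (1 - r) * y `^ r.
  by rewrite -powRD ?subrK ?powRr1 ?(ltW y0)// (gt_eqF y0) implybT.
rewrite {1}yE ler_wpM2r ?powR_ge0//.
rewrite -(opprB r 1) !powRN lef_pV2 ?posrE ?powR_gt0//.
apply: ge0_ler_powR; rewrite ?nnegrE ?(ltW K0) ?(ltW y0)// subr_ge0; exact: ltW.
Qed.

Lemma le_powR_add (K r y : R) : 0 < K -> 1 < r -> 0 <= y -> y <= K + K `^ (1 - r) * y `^ r.
Proof.
move=> K0 r1 y0; case: (leP y K) => [yK|/ltW Ky].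
  by apply: le_trans yK _; rewrite lerDl mulr_ge0 ?powR_ge0.
by apply: le_trans (ge_powR_mul K0 r1 Ky) _; rewrite lerDr ltW.
Qed.

Section LrBound.
Variables (D : set (measurableTypeR R)) (r : R) (v : R -> R).
Hypotheses (mD : measurable D) (Dfin : (mu D < +oo)%E) (r1 : 1 < r).
Hypothesis mv : measurable_fun D v.
Hypothesis v0 : forall t, D t -> 0 <= v t.
Hypothesis vi : mu.-integrable D (EFin \o (fun t => v t `^ r)).

Lemma Lr_integrable : mu.-integrable D (EFin \o v).
Proof.
apply: (@integrable_le _ _ (fun t => 1 + v t `^ r)) => //.
  by apply: integrableD_fun => //; exact: integrable_cst_fun.
move=> t Dt; rewrite ger0_norm ?v0//.
have := le_powR_add ltr01 r1 (v0 Dt).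
by rewrite powR1 mul1r.
Qed.

(** Truncation at level [K]: the first term is small with the measure of [A], the second for large
    [K]. *)
Lemma Lr_integral_le A (K : R) : measurable A -> A `<=` D -> 0 < K ->
  \int[mu]_(t in A) v t <= K * fine (mu A) + K `^ (1 - r) * \int[mu]_(t in D) v t `^ r.
Proof.
move=> mA AD K0.
have Afin : (mu A < +oo)%E by apply: le_lt_trans Dfin; apply: le_measure; rewrite ?inE.
have viA : mu.-integrable A (EFin \o (fun t => v t `^ r)) by exact: integrableS vi.
have KviA := @integrableZ_fun A (K `^ (1 - r)) _ mA viA.
apply: (@le_trans _ _ (\int[mu]_(t in A) (K + K `^ (1 - r) * v t `^ r))).
  apply: le_Rintegral => //.
  - by apply: integrableS Lr_integrable.
  - by apply: integrableD_fun => //; exact: integrable_cst_fun.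
  - by move=> t At; apply: le_powR_add => //; exact/v0/AD.
rewrite RintegralD//; last exact: integrable_cst_fun.
rewrite Rintegral_cst// lerD2l RintegralZl// ler_wpM2l ?powR_ge0//.
by apply: Rintegral_nd_set => // t _; exact: powR_ge0.
Qed.

End LrBound.

Lemma Lr_equi_integrable (I : Type) D (r M : R) (v : I -> R -> R) :
  measurable D -> (mu D < +oo)%E -> 1 < r -> 
  (forall n, measurable_fun D (v n)) -> (forall n t, D t -> 0 <= v n t) ->
  (forall n, mu.-integrable D (EFin \o (fun t => v n t `^ r))) ->
  (forall n, \int[mu]_(t in D) v n t `^ r <= M) ->
  forall e : R, 0 < e -> exists2 del : R, 0 < del &
     forall n A, measurable A -> A `<=` D -> (mu A < del%:E)%E ->
       \int[mu]_(t in A) v n t < e.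
Proof.
move=> mD Dfin r1 mv v0 vi vM e e0.
pose M' := Num.max M 1; have M'0 : 0 < M' by rewrite lt_max ltr01 orbT.
(* Solves [K^(1 - r) M' = e / 2]; the maximum with 1 makes [M'] positive. *)
pose K := (e / (2 * M')) `^ (1 - r)^-1.
have eM : 0 < e / (2 * M') by rewrite divr_gt0// mulr_gt0.
have K0 : 0 < K by exact: powR_gt0.
have KE : K `^ (1 - r) * M' = e / 2.
  rewrite /K -powRrM mulVf ?powRr1 ?(ltW eM)//; last by rewrite subr_eq0 lt_eqF.
  by field; rewrite gt_eqF.
exists (e / (2 * K)); first by rewrite divr_gt0// mulr_gt0.
move=> n A mA AD muA.
apply: le_lt_trans (Lr_integral_le mD Dfin r1 (mv n) (v0 n) (vi n) mA AD K0) _.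
have h1 : K * fine (mu A) < e / 2.
  have Afin : mu A \is a fin_num by rewrite ge0_fin_numE//; apply: lt_trans muA _; rewrite ltry.
  move: muA; rewrite -{1}(fineK Afin) lte_fin => h.
  rewrite -ltr_pdivlMl//; apply: lt_le_trans h _.
  by rewrite le_eqVlt; apply/orP; left; apply/eqP; field; rewrite gt_eqF.
have h2 : K `^ (1 - r) * \int[mu]_(t in D) v n t `^ r <= e / 2.
  rewrite -KE ler_wpM2l ?powR_ge0//; apply: le_trans (vM n) _; by rewrite le_max lexx.
lra.
Qed.

End MoreIntegrals.

(** * Lower semicontinuity of the running cost *)

Section L1FromSets.
Context {R : realType}.
Notation mu := (@lebesgue_measure R).

Lemma Rintegral_ae_subset (D D' : set (measurableTypeR R)) (h : R -> R) : measurable D ->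
  measurable D' -> D' `<=` D -> mu (D `\` D') = 0%E ->
  \int[mu]_(t in D) h t = \int[mu]_(t in D') h t.
Proof.
by move=> mD mD' D'D D0; rewrite /Rintegral (integral_ae_subset _ mD mD' D'D D0).
Qed.

(** The sets where [h] is nonnegative and where it is negative each contribute at most [e], hence
    the factor 2. *)
Lemma L1_norm_le_sets (D : set (measurableTypeR R)) (h : R -> R) (e : R) : measurable D ->
  mu.-integrable D (EFin \o h) ->
  (forall A, measurable A -> A `<=` D -> `|\int[mu]_(t in A) h t| <= e) ->
  \int[mu]_(t in D) `|h t| <= 2 * e.
Proof.
move=> mD hi hA.
have mh := integrable_measurable hi.
pose P : set (measurableTypeR R) := D `&` h @^-1` `[0, +oo[.
pose N : set (measurableTypeR R) := D `&` h @^-1` `]-oo, 0[.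
have mP : measurable P by apply: mh => //; exact: measurable_itv.
have mN : measurable N by apply: mh => //; exact: measurable_itv.
have DE : D = P `|` N.
  apply/seteqP; split => [t Dt|t [] []//].
  by case: (leP 0 (h t)) => ht; [left|right]; split => //=; rewrite in_itv/= ?andbT.
have PD : P `<=` D by exact: subIsetl.
have ND : N `<=` D by exact: subIsetl.
have hni : mu.-integrable D (EFin \o (fun t => `|h t|)) by exact: integrable_norm.
rewrite {1}DE Rintegral_setU//; last 2 first.
- by rewrite -DE.
- apply/disj_setPS => t [] [_ /=]; rewrite in_itv/= andbT => h0 [_ /=].
  by rewrite in_itv/= ltNge h0.
have -> : \int[mu]_(t in P) `|h t| = \int[mu]_(t in P) h t.
  apply: eq_Rintegral => t; rewrite inE => -[_ /=]; rewrite in_itv/= andbT => h0.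
  by rewrite ger0_norm.
have -> : \int[mu]_(t in N) `|h t| = - \int[mu]_(t in N) h t.
  rewrite -[RHS]mulN1r -RintegralZl//; last by exact: integrableS hi.
  apply: eq_Rintegral => t; rewrite inE => -[_ /=]; rewrite in_itv/= => h0.
  by rewrite ltr0_norm// mulN1r.
have := hA P mP PD; have := hA N mN ND.
by rewrite !ler_norml => /andP[? ?] /andP[? ?]; lra.
Qed.

(** The integral of [h - 1] vanishes over every measurable subset, so its L^1 norm is zero. To be
    applied to the sum of the limiting frequencies. *)
Lemma ae_eq1_of_sets (D : set (measurableTypeR R)) (h : R -> R) : measurable D ->
  (mu D < +oo)%E -> mu.-integrable D (EFin \o h) ->
  (forall A, measurable A -> A `<=` D -> \int[mu]_(t in A) h t = fine (mu A)) ->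
  mu (D `\` (D `&` [set t | h t = 1])) = 0%E /\ measurable (D `&` [set t | h t = 1]).
Proof.
move=> mD Dfin hi hA.
have mh := integrable_measurable hi.
have mS : measurable (D `&` [set t | h t = 1]).
  by apply: (mh mD [set 1]); exact: measurable_set1.
split => //.
have ci : mu.-integrable D (EFin \o (fun=> 1 : R)) by exact: integrable_cst_fun.
have di : mu.-integrable D (EFin \o (fun t => h t - 1)) by exact: integrableB_fun.
have d0 : \int[mu]_(t in D) `|h t - 1| <= 0.
  rewrite -(mulr0 2); apply: L1_norm_le_sets => // A mA AD.
  rewrite RintegralB//; [|exact: integrableS hi|exact: integrableS ci].
  by rewrite hA// Rintegral_cst// mul1r subrr normr0.
have dni : mu.-integrable D (EFin \o (fun t => `|h t - 1|)) by exact: integrable_norm.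
have : (\int[mu]_(t in D) `|(h t - 1)%:E| = 0)%E.
  have := integrable_fin_num mD dni => /fineK <- /=.
  by apply/eqP; rewrite eqe eq_le d0/=; apply: Rintegral_ge0.
have mdE : measurable_fun D (fun t => (h t - 1)%:E).
  by apply/measurable_EFinP; exact: integrable_measurable di.
move=> /(ae_eq_integral_abs mu mD mdE).1 [N [mN N0 hN]].
apply/eqP; rewrite eq_le measure_ge0 andbT -N0; apply: le_measure; rewrite ?inE//.
  exact: measurableD.
move=> t [Dt nt]; apply: hN => /= h1; apply: nt; split => //=.
by have := h1 Dt => -[] /eqP; rewrite subr_eq0 => /eqP.
Qed.

End L1FromSets.

Lemma powR_small (R : realType) (r D e : R) : 1 < r -> 0 <= D -> 0 < e ->
  exists2 K : R, 1 <= K & K `^ (1 - r) * D <= e.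
Proof.
move=> r1 D0 e0; have De : 0 <= D / e by rewrite divr_ge0// ltW.
have b0 : 0 < 1 + D / e by rewrite ltr_pwDl.
exists ((1 + D / e) `^ (r - 1)^-1).
  rewrite -[leLHS](powRr0 (1 + D / e)); apply: ler_powR; rewrite ?lerDl//.
  by rewrite invr_ge0 subr_ge0 ltW.
rewrite -powRrM.
have -> : (r - 1)^-1 * (1 - r) = - 1.
  by rewrite -(opprB r 1) mulrN mulVf// subr_eq0 gt_eqF.
rewrite powR_inv1 ?(ltW b0)// ler_pdivrMl// mulrDl mul1r divfK ?gt_eqF//.
by rewrite lerDr ltW.
Qed.

(** The bounds on the integrals are summable, so the sum of the [h k] is integrable, hence finite
    almost everywhere, and the terms of a convergent series tend to 0. *)
Lemma L1_fast_cvg_ae (R : realType) (D : set (measurableTypeR R)) (h : nat -> R -> R) : measurable D ->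
  (forall k, (@lebesgue_measure R).-integrable D (EFin \o h k)) -> (forall k t, D t -> 0 <= h k t) ->
  (forall k, \int[@lebesgue_measure R]_(t in D) h k t <= 1 / (2 ^ (k + 1))%:R) ->
  {ae @lebesgue_measure R, forall t, D t -> h k t @[k --> \oo] --> 0}.
Proof.
set mu := @lebesgue_measure R; move=> mD hi h0 hle.
pose G t := (\sum_(0 <= k <oo) (h k t)%:E)%E.
have mh k : measurable_fun D (fun t => (h k t)%:E).
  by apply/measurable_EFinP; exact: integrable_measurable (hi k).
have mG : measurable_fun D G.
  by apply: ge0_emeasurable_sum => [k t Dt _|k _]; [rewrite lee_fin; exact: h0|exact: mh].
have G0 t : D t -> (0 <= G t)%E.
  by move=> Dt; apply: nneseries_ge0 => k _ _; rewrite lee_fin; exact: h0.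
have Gi : mu.-integrable D G.
  apply/integrableP; split => //.
  have -> : (\int[mu]_(t in D) `|G t| = \int[mu]_(t in D) G t)%E.
    by apply: eq_integral => t; rewrite inE => Dt; rewrite gee0_abs// G0.
  rewrite integral_nneseries//.
  have cg := @cvg_geometric_eseries_half R 1 0.
  apply: (@le_lt_trans _ _ (\sum_(0 <= k <oo) (1 / (2 ^ (k + 1))%:R : R)%:E)%E).
    apply: lee_nneseries => k _ //.
      by move=> _; apply: integral_ge0 => t Dt; rewrite lee_fin; exact: h0.
    rewrite -(fineK (integrable_fin_num mD (hi k))) lee_fin; exact: hle.
  by move/cvg_lim : cg => ->//; rewrite ltry.
apply: filterS (integrable_ae mD Gi) => t Gt Dt.
apply: cvg_series_cvg_0.
pose hp k := `|h k t|.
have hE k : h k t = hp k by rewrite /hp ger0_norm// h0.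
have -> : h^~ t = hp by apply/funext.
apply: nnseries_is_cvg => [k|]; first exact: normr_ge0.
have -> : (\sum_(0 <= k <oo) (hp k)%:E = G t)%E by apply: eq_eseriesr => k _; rewrite -hE.
by rewrite -ge0_fin_numE ?Gt ?G0.
Qed.

Lemma cvg_pairf (S : Type) (NX : nbhsType) (NY : nbhsType) (F : set_system S)
    (f : S -> NX) (g : S -> NY) (a : NX) (b : NY) : Filter F ->
  f t @[t --> F] --> a -> g t @[t --> F] --> b -> (f t, g t) @[t --> F] --> (a, b).
Proof.
move=> FF fa gb A [[P Q] [/= Pa Qb] PQ].
have fP : F [set t | P (f t)] := fa _ Pa.
have gQ : F [set t | Q (g t)] := gb _ Qb.
suff : F [set t | A (f t, g t)] by [].
by apply: filterS (filterI fP gQ) => t [Pt Qt]; exact: (PQ (_, _) (conj Pt Qt)).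
Qed.

Lemma ecoord_integrable (R : realType) (E : normedVectType R) (T : R) (u : R -> E) i :
  measurable_control T u ->
  (@lebesgue_measure R).-integrable `[0, T] (EFin \o (fun t => `|u t|)) ->
  (@lebesgue_measure R).-integrable `[0, T] (EFin \o (fun t => ecoord i (u t))).
Proof.
move=> mu ui; have [C C1 hC] := ecoord_bounded E.
have mI : measurable (`[0, T] : set (measurableTypeR R)) by exact: measurable_itv.
apply: (@integrable_le _ _ _ (fun t => C * `|u t|)) => //; first exact: integrableZ_fun.
by apply: control_comp_measurable => //; exact: ecoord_continuous.
Qed.

(** * The running cost along a weakly convergent sequence of controls *)

Section RunningCost.
Context {R : realType} {E : normedVectType R}.
Notation mu := (@lebesgue_measure R).
Variables (T : R) (U : set E) (phi : R -> E -> E -> R).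
Hypotheses (T0 : 0 < T) (cU : closed U) (vU : convex_set U).
Hypothesis hphi : {within [set z : R * E * E | z.1.1 \in `[0, T] /\ U z.2],
            continuous (fun z => phi z.1.1 z.1.2 z.2)}.
Hypothesis hphi_convex : forall (t : R) (x : E), t \in `[0, T] -> convex_function U (phi t x).
Variables (Cphi delta r : R).
Hypotheses (Cphi0 : 0 < Cphi) (delta0 : 0 < delta) (r1 : 1 < r).
Hypothesis coercive : forall (t : R) (x u : E), t \in `[0, T] -> U u ->
     Cphi * (`|u| `^ r - `|x| `^ delta) <= phi t x u.

Let I : set (measurableTypeR R) := `[0, T]%classic.
Let mI : measurable I. Proof. exact: measurable_itv. Qed.

Lemma lebesgue_measure_0T : mu I = T%:E.
Proof. by rewrite /I lebesgue_measure_itv/= lte_fin T0 sube0. Qed.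

Let Ifin : (mu I < +oo)%E. Proof. by rewrite lebesgue_measure_0T ltry. Qed.

Lemma running_cost_cst_continuous x w : {within `[0, T], continuous x} -> U w ->
  {within `[0, T], continuous (fun t => phi t (x t) w)}.
Proof.
move=> cx Uw.
apply: (@within_comp _ _ _ `[0, T]%classic _ (fun t => ((t, x t), w)) _ _ _ hphi) => [t It//|].
apply/subspace_continuousP => t It; move/subspace_continuousP: cx => /(_ t It) cx.
apply: cvg_pairf; last exact: cvg_cst.
by apply: cvg_pairf; [exact: cvg_within|exact: cx].
Qed.

Lemma running_cost_cst_bounded x w : {within `[0, T], continuous x} -> U w ->
  exists2 C : R, 0 <= C & forall t, I t -> `|phi t (x t) w| <= C.
Proof.
move=> cx Uw.
exact: compact_norm_bounded (@segment_compact _ 0 T) (running_cost_cst_continuous cx Uw).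
Qed.

(** Quantised controls take values in [U] and converge to [u] at every time, the [k]-th being
    accurate to [1/(k + 1)] on the ball of radius [k]; for them the cost is glued from continuous
    functions of time. *)
Lemma running_cost_measurable x u : {within `[0, T], continuous x} ->
  measurable_control T u -> (forall t, I t -> U (u t)) ->
  measurable_fun I (fun t => phi t (x t) (u t)).
Proof.
move=> cx mu_ Uu.
have U0 : U (u 0) by apply: Uu; rewrite /I/= in_itv/= lexx ltW.
have hq (k : nat) : exists wi : (nat -> E) * (E -> nat),
  [/\ forall l, U (wi.1 l), forall v, U v -> `|v| <= k%:R -> `|v - wi.1 (wi.2 v)| < k.+1%:R^-1 &
    forall l, measurable (I `&` [set t | wi.2 (u t) = l])].
  have k0 : 0 < k.+1%:R^-1 :> R by rewrite invr_gt0.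
  have [m [w [idx [h1 _ h2 _ h3]]]] := quantiser k%:R cU U0 k0.
  by exists (w, idx); split => //= l; exact: h3 mu_ l.
have [q hq'] := choice hq.
apply: (@measurable_fun_cvg _ _ _ _ (fun k t => phi t (x t) ((q k).1 ((q k).2 (u t))))) => [k|t It].
  have [h1 _ h3] := hq' k.
  apply: (measurable_glue (h := fun l t => phi t (x t) ((q k).1 l))) => // l.
  by apply: subspace_continuous_measurable_fun => //; exact: running_cost_cst_continuous.
have qcvg : (q k).1 ((q k).2 (u t)) @[k --> \oo] --> u t.
  apply/cvgrPdist_lt => e e0; near=> k.
  have [_ h2 _] := hq' k; apply: (@lt_trans _ _ k.+1%:R^-1).
    by apply: h2; [exact: Uu|near: k; exact: nbhs_infty_ger].
  by near: k; exact: (near_infty_natSinv_lt (PosNum e0)).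
move/subspace_continuousP: hphi => /(_ (t, x t, u t) (conj It (Uu t It))) hc.
apply: cvg_trans hc => A hA.
have kc : (t, x t, (q k).1 ((q k).2 (u t))) @[k --> \oo] --> (t, x t, u t).
  by apply: cvg_pairf => //; exact: cvg_cst.
have := kc _ hA; rewrite /nbhs/=; apply: filterS => k; apply; split => //=.
by have [h1 _ _] := hq' k.
Unshelve. all: by end_near. Qed.

Section LowerSemicontinuity.
Variables (F : set_system nat) (x_ u_ : nat -> R -> E) (x : R -> E) (rho M : R).
Hypothesis FU : UltraFilter F.
Hypothesis xc : {within `[0, T], continuous x}.
Hypothesis x_rho : forall n t, I t -> `|x_ n t| <= rho.
Hypothesis x_unif : forall e : R, 0 < e -> \forall n \near F, forall t, I t -> `|x_ n t - x t| < e.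
Hypothesis mu_ : forall n, measurable_control T (u_ n).
Hypothesis Uu_ : forall n t, I t -> U (u_ n t).
Hypothesis ui : forall n, mu.-integrable I (EFin \o (fun t => `|u_ n t| `^ r)).
Hypothesis uM : forall n, \int[mu]_(t in I) `|u_ n t| `^ r <= M.
Hypothesis phi_i : forall n, mu.-integrable I (EFin \o (fun t => phi t (x_ n t) (u_ n t))).

Let FF : ProperFilter F. Proof. exact: ultra_proper. Qed.

Lemma x_rho_lim t : I t -> `|x t| <= rho.
Proof.
move=> It; apply/ler_addgt0Pl => e e0.
have [n hn] := filter_ex (x_unif e0).
have -> : x t = x_ n t - (x_ n t - x t) by rewrite opprB addrC subrK.
apply: le_trans (ler_normB _ _) _; rewrite addrC; apply: lerD; last exact: x_rho.
exact/ltW/hn.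
Qed.

Let rho0 : 0 <= rho.
Proof. by apply: le_trans (normr_ge0 (x 0)) (x_rho_lim _); rewrite /I/= in_itv/= lexx ltW. Qed.

Let M0 : 0 <= M.
Proof. by apply: le_trans (uM 0); apply: Rintegral_ge0 => t _; exact: powR_ge0. Qed.

Let mnu n : measurable_fun I (fun t => `|u_ n t|).
Proof. exact: norm_control_measurable. Qed.

Definition weak_limit (i : 'I_(edim E)) (w : R -> R) : Prop :=
  forall (A : set (measurableTypeR R)) (h : R -> R) (K : R),
    measurable A -> A `<=` I -> measurable_fun A h -> (forall t, A t -> `|h t| <= K) ->
    \int[mu]_(t in A) (ecoord i (u_ n t) * h t) @[n --> F] --> \int[mu]_(t in A) (w t * h t).

Lemma control_weak_limit : exists om : 'I_(edim E) -> R -> R,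
  forall i, mu.-integrable setT (EFin \o om i) /\ weak_limit i (om i).
Proof.
have [C C1 hC] := ecoord_bounded E; have C0 : 0 < C by exact: lt_le_trans C1.
have uL n : mu.-integrable I (EFin \o (fun t => `|u_ n t|)).
  exact: (Lr_integrable mI Ifin r1).
have cui i n : mu.-integrable I (EFin \o (fun t => ecoord i (u_ n t))).
  exact: ecoord_integrable.
have le_int i n (A : set (measurableTypeR R)) : measurable A -> A `<=` I ->
    \int[mu]_(t in A) `|ecoord i (u_ n t)| <= C * \int[mu]_(t in A) `|u_ n t|.
  move=> mA AI; have uA : mu.-integrable A (EFin \o (fun t => `|u_ n t|)).
    exact: integrableS (uL n).
  rewrite -RintegralZl//; apply: le_Rintegral => //.
  - by apply: integrable_norm; apply: integrableS (cui i n).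
  - exact: integrableZ_fun.
have h i : exists w : R -> R, mu.-integrable setT (EFin \o w) /\ weak_limit i w.
  have [|||w wi wc] := @weak_compact _ _ F I (fun n t => ecoord i (u_ n t)) (C * (T + M)) FU mI Ifin.
  - exact: cui.
  - move=> n; apply: le_trans (le_int i n _ mI (@subset_refl _ _)) _.
    rewrite ler_wpM2l ?(ltW C0)//.
    apply: le_trans (Lr_integral_le mI Ifin r1 (mnu n) _ (ui n) mI (@subset_refl _ _) ltr01) _ => //.
    by rewrite powR1 !mul1r lebesgue_measure_0T lerD2l.
  - move=> e e0; have eC : 0 < e / C by rewrite divr_gt0.
    have [del del0 hdel] := @Lr_equi_integrable _ _ _ _ M (fun n t => `|u_ n t|) mI Ifin r1
      mnu (fun _ _ _ => normr_ge0 _) ui uM _ eC.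
    exists del => // n A mA AI muA; apply: le_lt_trans (le_int i n _ mA AI) _.
    by rewrite -ltr_pdivlMl// mulrC; exact: hdel.
  - by exists w; split.
by have [om hom] := choice h; exists om.
Qed.

Lemma coord_control_integrable i n : mu.-integrable I (EFin \o (fun t => ecoord i (u_ n t))).
Proof.
by apply: ecoord_integrable => //; exact: (Lr_integrable mI Ifin r1).
Qed.

Lemma weak_limit_integral i w (A : set (measurableTypeR R)) : weak_limit i w ->
  measurable A -> A `<=` I ->
  \int[mu]_(t in A) ecoord i (u_ n t) @[n --> F] --> \int[mu]_(t in A) w t.
Proof.
move=> wl mA AI.
have := wl A (fun=> 1) 1 mA AI (measurable_cst _) (fun _ _ => _).
under eq_Rintegral do rewrite mulr1.
under eq_fun do under eq_Rintegral do rewrite mulr1.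
by apply=> t; rewrite normr1.
Qed.

Section Level.
Variables (om : 'I_(edim E) -> R -> R).
Hypothesis om_i : forall i, mu.-integrable setT (EFin \o om i).
Hypothesis om_c : forall i, weak_limit i (om i).

(* The Young measure of the quantised controls: [th l t] is the limiting frequency
   of the value with index l near time t. *)
Lemma value_frequencies (idx : E -> nat) (m : nat) : (forall v, (idx v <= m)%N) ->
  (forall n l, measurable (I `&` [set t | idx (u_ n t) = l])) ->
  exists th : nat -> R -> R, [/\ forall l t, 0 <= th l t,
    forall l, mu.-integrable setT (EFin \o th l),
    mu (I `\` (I `&` [set t | \sum_(l < m.+1) th l t = 1])) = 0%E,
    measurable (I `&` [set t | \sum_(l < m.+1) th l t = 1]) &
    forall (A : set (measurableTypeR R)) (h : nat -> R -> R) (K : R), measurable A -> A `<=` I ->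
      (forall l, measurable_fun A (h l)) -> (forall l t, A t -> `|h l t| <= K) ->
      \int[mu]_(t in A) h (idx (u_ n t)) t @[n --> F] -->
      \int[mu]_(t in A) (\sum_(l < m.+1) th l t * h l t)].
Proof.
move=> idxm midx.
pose ro (l n : nat) (t : R) : R := (idx (u_ n t) == l)%:R.
have ro0 l n t : 0 <= ro l n t by rewrite /ro.
have ro1 l n t : `|ro l n t| <= 1 by rewrite /ro; case: eqP; rewrite ?normr1 ?normr0.
have mro l n : measurable_fun I (ro l n).
  apply: (measurable_glue (idx := fun t => idx (u_ n t)) (h := fun k _ => (k == l)%:R)) => //.
have roi l n : mu.-integrable I (EFin \o ro l n).
  by apply: (@integrable_bounded _ _ _ 1).
have le_ro l n (A : set (measurableTypeR R)) : measurable A -> A `<=` I ->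
    \int[mu]_(t in A) ro l n t <= fine (mu A).
  move=> mA AI; have Afin : (mu A < +oo)%E.
    by apply: le_lt_trans Ifin; apply: le_measure; rewrite ?inE.
  rewrite -[leRHS]mul1r -Rintegral_cst//; apply: le_Rintegral => //.
  - by apply: integrableS (roi l n).
  - exact: integrable_cst_fun.
  - by move=> t _; apply: le_trans (ler_norm _) (ro1 _ _ _).
have h l : exists th : R -> R, [/\ forall t, 0 <= th t, mu.-integrable setT (EFin \o th) &
    forall (A : set (measurableTypeR R)) (h : R -> R) (K : R), measurable A -> A `<=` I -> measurable_fun A h ->
      (forall t, A t -> `|h t| <= K) ->
      \int[mu]_(t in A) (ro l n t * h t) @[n --> F] --> \int[mu]_(t in A) (th t * h t)].
  apply: (@weak_compact_ge0 _ _ _ _ _ T) => //.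
  - by move=> n; apply: le_trans (le_ro l n _ mI (@subset_refl _ _)) _; rewrite lebesgue_measure_0T.
  - move=> e e0; exists e => // n A mA AI muA; apply: le_lt_trans (le_ro l n _ mA AI) _.
    have Afin : mu A \is a fin_num by rewrite ge0_fin_numE//; apply: lt_trans muA _; rewrite ltry.
    by rewrite -lte_fin fineK.
have [th hth] := choice h.
have glue n t (k : nat -> R) : \sum_(l < m.+1) ro l n t * k l = k (idx (u_ n t)).
  have im : (idx (u_ n t) < m.+1)%N by rewrite ltnS.
  rewrite (bigD1 (Ordinal im))//= /ro eqxx mul1r big1 ?addr0// => l.
  by rewrite -val_eqE/= eq_sym => /negbTE ->; rewrite mul0r.
have thi l : mu.-integrable setT (EFin \o th l) by have [] := hth l.
have conv (A : set (measurableTypeR R)) (h' : nat -> R -> R) (K : R) : measurable A -> A `<=` I ->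
      (forall l, measurable_fun A (h' l)) -> (forall l t, A t -> `|h' l t| <= K) ->
      \int[mu]_(t in A) h' (idx (u_ n t)) t @[n --> F] -->
      \int[mu]_(t in A) (\sum_(l < m.+1) th l t * h' l t).
  move=> mA AI mh hK.
  have Afin : (mu A < +oo)%E by apply: le_lt_trans Ifin; apply: le_measure; rewrite ?inE.
  have -> : (fun n => \int[mu]_(t in A) h' (idx (u_ n t)) t) =
      (fun n => \sum_(l < m.+1) \int[mu]_(t in A) (ro l n t * h' l t)).
    apply/funext => n; rewrite -(@Rintegral_finsum _ _ A (fun (l : 'I_m.+1) t => ro l n t * h' l t))//.
      by apply: eq_Rintegral => t _; rewrite (glue n t (fun l => h' l t)).
    move=> l; apply: (@integrable_mulr_bounded _ _ _ _ K) => //; last exact: hK.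
    by apply: integrableS (roi l n).
  rewrite (@Rintegral_finsum _ _ A (fun (l : 'I_m.+1) t => th l t * h' l t))//; last first.
    move=> l; apply: (@integrable_mulr_bounded _ _ _ _ K) => //; last exact: hK.
    by apply: integrableS (thi l).
  by apply: cvg_sumr => l; have [_ _] := hth l; apply => //; exact: hK.
have thiI : mu.-integrable I (EFin \o (fun t => \sum_(l < m.+1) th l t)).
  by apply: (@integrable_finsum _ _ I (fun (l : 'I_m.+1) t => th l t)) => // l; apply: integrableS (thi l).
(* For each [n] the indicators sum to one; the test functions equal to 1 carry this over to the
   limit on every set [A]. *)
have [|e1 e2] := ae_eq1_of_sets mI Ifin thiI.
  move=> A mA AI.
  have Afin : (mu A < +oo)%E by apply: le_lt_trans Ifin; apply: le_measure; rewrite ?inE.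
  have h1 : forall (l : nat) t, A t -> `|1 : R| <= 1 by move=> *; rewrite normr1.
  have m1 : forall l : nat, measurable_fun A ((fun _ _ => 1) l : R -> R) by move=> _; exact: measurable_cst.
  have := conv A (fun _ _ => 1) 1 mA AI m1 h1.
  rewrite Rintegral_cst// mul1r => c1.
  have -> : \int[mu]_(t in A) (\sum_(l < m.+1) th l t) =
      \int[mu]_(t in A) (\sum_(l < m.+1) th l t * 1).
    by apply: eq_Rintegral => t _; apply: eq_bigr => l _; rewrite mulr1.
  by apply: (cvg_unique _ c1 (cvg_cst _)); exact: Rhausdorff.
by exists th; split => // l; have [] := hth l.
Qed.

(** Uniform continuity of [phi] on a compact set of times, states and controls. The bound 1 on the
    distance of [v'] to [v] keeps [v'] in the ball of radius [K + 1]. *)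
Lemma running_cost_near (K e : R) : 0 < e -> exists2 del : R, 0 < del &
  \forall n \near F, forall t v v', I t -> U v -> U v' -> `|v| <= K -> `|v - v'| < del ->
    phi t (x t) v' <= phi t (x_ n t) v + e.
Proof.
move=> e0.
pose Kc : set (R * E * E) := (`[0, T]%classic `*` [set w : E | `|w| <= rho]) `*`
  ([set w : E | `|w| <= K + 1] `&` U).
have Kcompact : compact Kc.
  apply: compact_setX; first by apply: compact_setX; [exact: segment_compact|exact: closed_ball0_compact].
  by apply: compact_closedI => //; exact: closed_ball0_compact.
have KS : Kc `<=` [set z : R * E * E | z.1.1 \in `[0, T] /\ U z.2].
  by move=> -[[t y] v] [[/= It _] [_ Uv]].
have [del del0 hdel] := heine Kcompact KS hphi e0.
exists (Num.min del 1); first by rewrite lt_min del0 ltr01.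
apply: filterS (x_unif del0) => n xn t v v' It Uv Uv' vK; rewrite lt_min => /andP[vv' vv1].
have v'K : `|v'| <= K + 1.
  have -> : v' = v - (v - v') by rewrite opprB addrC subrK.
  by apply: le_trans (ler_normB _ _) _; apply: lerD => //; exact: ltW.
have K1 : Kc ((t, x t), v') by split; split => //=; exact: x_rho_lim.
have K2 : Kc ((t, x_ n t), v).
  by split; split => //=; [exact: x_rho|apply: le_trans vK _; rewrite lerDl].
have bl : ball ((t, x t), v') del ((t, x_ n t), v).
  split; [split|] => /=; first exact: ballxx.
  - by rewrite -ball_normE/= distrC; exact: xn.
  - by rewrite -ball_normE/= distrC.
have := hdel _ _ K1 K2 bl => /=; rewrite ltr_norml => /andP[_ h].
by rewrite ltW// addrC -ltrBlDr.
Qed.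

(* uk is the barycentre of the Young measure of the quantised controls, so Jensen's
   inequality bounds its running cost. *)
Lemma quantised_minimiser (e : R) : 0 < e -> exists uk : R -> E,
  [/\ measurable_control T uk, forall t, I t -> U (uk t),
      forall i, mu.-integrable I (EFin \o (fun t => ecoord i (uk t))),
      forall i, \int[mu]_(t in I) `|ecoord i (uk t) - om i t| <= e &
      forall c, (\forall n \near F, \int[mu]_(t in I) phi t (x_ n t) (u_ n t) <= c) ->
        mu.-integrable I (EFin \o (fun t => phi t (x t) (uk t))) /\
        \int[mu]_(t in I) phi t (x t) (uk t) <= c + e].
Proof.
move=> e0.
have Iz : I 0 by rewrite /I/= in_itv/= lexx ltW.
pose w0 := u_ 0 0; have U0 : U w0 by exact: Uu_.
have [C C1 hC] := ecoord_bounded E; have C0 : 0 < C by exact: lt_le_trans C1.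
have [C0' C0'0 hC0'] := running_cost_cst_bounded xc U0.
pose low := Cphi * rho `^ delta.
have low0 : 0 <= low by rewrite mulr_ge0 ?powR_ge0// ltW.
(* Collects the constants of the two errors made where the control exceeds [K] and is replaced by
   [w0]: [C0' + low] for the cost, [C (|w0| + 1)] for the coordinates. *)
pose D := C0' + low + C * (`|w0| + 1).
have D0 : 0 <= D by rewrite !addr_ge0// mulr_ge0 ?addr_ge0// ltW.
have e20 : 0 < e / 4 by rewrite divr_gt0.
(* Where [|u_n| > K], both [1] and [|u_n|] are at most [K^(1 - r) |u_n|^r], so these errors
   integrate to at most [K^(1 - r) D M]. *)
have [K K1 hK] := powR_small r1 (mulr_ge0 D0 M0) e20.
have K0 : 0 < K by exact: lt_le_trans K1.
have eT0 : 0 < e / 4 / T by rewrite divr_gt0.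
have [del del0 hdel] := running_cost_near K eT0.
have eq0 : 0 < Num.min del (e / 4 / T / C) by rewrite lt_min del0 divr_gt0.
have [m [w1 [idx [Uw1 idxm w1u w1K midx']]]] := quantiser K cU U0 eq0.
(* Indices above [m] never occur; truncating them leaves finitely many values and gives the bounds
   [Kb] and [Kw], uniform in [l]. *)
pose w l := w1 (minn l m).
have wE v : w (idx v) = w1 (idx v) by rewrite /w (minn_idPl _).
have Uw l : U (w l) by exact: Uw1.
have midx n l : measurable (I `&` [set t | idx (u_ n t) = l]) by exact: midx'.
have [th [th0 thi thN mS conv]] := value_frequencies idxm midx.
have big y : K <= y -> 1 <= K `^ (1 - r) * y `^ r.
  by move=> Ky; apply: le_trans (ge_powR_mul K0 r1 Ky); exact: le_trans Ky.
have bndP (c : R) n : 0 <= c -> c <= D ->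
    mu.-integrable I (EFin \o (fun t => e / 4 / T + c * K `^ (1 - r) * `|u_ n t| `^ r)) /\
    \int[mu]_(t in I) (e / 4 / T + c * K `^ (1 - r) * `|u_ n t| `^ r) <= e / 2.
  move=> c0 cD.
  have i1 : mu.-integrable I (EFin \o (fun=> e / 4 / T)) by exact: integrable_cst_fun.
  have i2 : mu.-integrable I (EFin \o (fun t => c * K `^ (1 - r) * `|u_ n t| `^ r)).
    exact: integrableZ_fun.
  split; first exact: integrableD_fun.
  rewrite RintegralD// Rintegral_cst// RintegralZl//.
  have -> : fine (mu I) = T by rewrite lebesgue_measure_0T.
  rewrite divfK ?gt_eqF//.
  have : c * K `^ (1 - r) * \int[mu]_(t in I) `|u_ n t| `^ r <= e / 4.
    apply: le_trans hK; rewrite -mulrA mulrCA ler_wpM2l ?powR_ge0//.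
    apply: ler_pM => //; apply: Rintegral_ge0 => t _; exact: powR_ge0.
  lra.
(* Controls of norm at most [K] are handled by uniform continuity. Beyond, the quantised value is
   [w0], whose cost is at most [C0'], while the cost of [u_ n] is at least [- low] by coercivity. *)
have pw1 : \forall n \near F, forall t, I t -> phi t (x t) (w (idx (u_ n t))) <=
    phi t (x_ n t) (u_ n t) + (e / 4 / T + (C0' + low) * K `^ (1 - r) * `|u_ n t| `^ r).
  apply: filterS hdel => n hn t It; rewrite wE addrA.
  have := Uu_ n It; set v := u_ n t => Uv.
  case: (leP `|v| K) => [vK|Kv].
    have := hn t v (w1 (idx v)) It Uv (Uw1 _) vK.
    have : `|v - w1 (idx v)| < del.
      by apply: lt_le_trans (w1u v Uv vK) _; rewrite ge_min lexx.
    move=> h /(_ h) h1; apply: le_trans h1 _; rewrite lerDl.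
    by rewrite !mulr_ge0 ?powR_ge0// addr_ge0.
  rewrite w1K//; have := hC0' t It; rewrite ler_norml => /andP[_ h1].
  have h2 : - low <= phi t (x_ n t) v.
    apply: le_trans (coercive (x_ n t) It Uv); rewrite /low -mulrN ler_wpM2l ?(ltW Cphi0)//.
    rewrite -[leLHS]add0r; apply: lerD; first exact: powR_ge0.
    by rewrite lerN2; apply: ge0_ler_powR; rewrite ?nnegrE ?(ltW delta0)//; exact: x_rho.
  have := big `|v| (ltW Kv); set L := _ * _ `^ r => L1.
  have : C0' + low <= (C0' + low) * L by rewrite ler_peMr// addr_ge0.
  rewrite -(mulrA (C0' + low)) -/L.
  move: (ltW eT0) h1 h2; move: (phi t (x t) w0) (phi t (x_ n t) v) (e / 4 / T) (_ * L) => a1 a2 a3 a4; lra.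
have pw2 i n t : I t -> `|ecoord i (w (idx (u_ n t))) - ecoord i (u_ n t)| <=
    e / 4 / T + C * (`|w0| + 1) * K `^ (1 - r) * `|u_ n t| `^ r.
  move=> It; rewrite wE -ecoordB; apply: le_trans (hC _ _) _.
  have := Uu_ n It; set v := u_ n t => Uv.
  case: (leP `|v| K) => [vK|Kv].
    have : `|v - w1 (idx v)| < e / 4 / T / C.
      by apply: lt_le_trans (w1u v Uv vK) _; rewrite ge_min lexx orbT.
    rewrite ltr_pdivlMr// mulrC distrC => /ltW h; apply: le_trans h _; rewrite lerDl.
    by rewrite !mulr_ge0 ?powR_ge0// ?addr_ge0// ltW.
  rewrite w1K//; apply: ler_wpDl; first exact: ltW.
  rewrite -!mulrA ler_wpM2l ?(ltW C0)//; apply: le_trans (ler_normB _ _) _.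
  rewrite mulrDl mul1r; apply: lerD; last exact: ge_powR_mul (ltW Kv).
  by rewrite ler_peMr// big// ltW.
have finb (b : nat -> R) l : (forall l, 0 <= b l) -> b (minn l m) <= \sum_(j < m.+1) b j.
  move=> b0; have lm : (minn l m < m.+1)%N by rewrite ltnS geq_minr.
  by rewrite (bigD1 (Ordinal lm))//= lerDl sumr_ge0.
have cb l : exists b : R, 0 <= b /\ forall t, I t -> `|phi t (x t) (w1 l)| <= b.
  by have [b b0 hb] := running_cost_cst_bounded xc (Uw1 l); exists b.
have [b hb] := choice cb.
pose Kb := \sum_(j < m.+1) b j.
have phib l t : I t -> `|phi t (x t) (w l)| <= Kb.
  move=> It; apply: le_trans ((hb _).2 _ It) _.
  by apply: finb => j; exact: (hb j).1.
pose Kw := \sum_(j < m.+1) C * `|w1 j|.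
have wb i l : `|ecoord i (w l)| <= Kw.
  apply: le_trans (hC _ _) _; apply: (finb (fun j => C * `|w1 j|)) => j.
  by rewrite mulr_ge0// ltW.
have mphi l : measurable_fun I (fun t => phi t (x t) (w l)).
  by apply: subspace_continuous_measurable_fun => //; exact: running_cost_cst_continuous.
pose H t := \sum_(l < m.+1) th l t * phi t (x t) (w l).
have thiI l : mu.-integrable I (EFin \o th l) by apply: integrableS (thi l).
have Hi : mu.-integrable I (EFin \o H).
  apply: (@integrable_finsum _ _ I (fun (l : 'I_m.+1) t => th l t * phi t (x t) (w l))) => // l.
  by apply: (@integrable_mulr_bounded _ _ _ _ Kb) => //; exact: phib.
pose v i t := \sum_(l < m.+1) th l t * ecoord i (w l).
have vi i : mu.-integrable I (EFin \o v i).
  apply: (@integrable_finsum _ _ I (fun (l : 'I_m.+1) t => th l t * ecoord i (w l))) => // l.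
  by apply: (@integrable_mulr_bounded _ _ _ _ Kw).
pose S : set (measurableTypeR R) := I `&` [set t | \sum_(l < m.+1) th l t = 1].
have SI : S `<=` I by exact: subIsetl.
(* Where the frequencies do not sum to one, which on [I] is a null set of times, the value [w0]
   keeps [uk] in [U]. *)
pose uk t := if \sum_(l < m.+1) th l t == 1 then \sum_(l < m.+1) th l t *: w l else w0.
have Uuk t : U (uk t).
  rewrite /uk; case: eqP => // th1.
  by apply: (convex_set_sum (convex_set_pair vU) (a := th^~ t)) => // l; exact: th0.
have ukv i t : S t -> ecoord i (uk t) = v i t.
  move=> [_ /= th1]; rewrite /uk th1 eqxx (big_morph _ (ecoordD i) (ecoord0 i)).
  by apply: eq_bigr => l _; rewrite ecoordZ.
have muk : measurable_control T uk.
  apply: coord_measurable_control => i.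
  have -> : (fun t => ecoord i (uk t)) =
     (fun t => if \sum_(l < m.+1) th l t == 1 then v i t else ecoord i w0).
    apply/funext => t; rewrite /uk; case: eqP => //= _.
    rewrite (big_morph _ (ecoordD i) (ecoord0 i)).
    by apply: eq_bigr => l _; rewrite ecoordZ.
  apply: (measurable_fun_ifset (S := S)) => //; last exact: integrable_measurable (vi i).
  by apply/seteqP; split => t [It /= /eqP h].
have uki i : mu.-integrable I (EFin \o (fun t => ecoord i (uk t))).
  apply: (@integrable_le _ _ _ (fun t => `|v i t| + `|ecoord i w0|)) => //.
  - by apply: integrableD_fun; [|exact: integrable_norm|exact: integrable_cst_fun].
  - by apply: control_comp_measurable => //; exact: ecoord_continuous.
  - move=> t It; rewrite {1}/uk; case: eqP => [th1|_]; last by rewrite lerDr.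
    have := @ukv i t (conj It th1); rewrite /uk; case: eqP => // _ ->.
    by rewrite lerDl.
exists uk; split => //.
- move=> i; have omI : mu.-integrable I (EFin \o om i) by apply: integrableS (om_i i).
  have -> : \int[mu]_(t in I) `|ecoord i (uk t) - om i t| =
      \int[mu]_(t in S) `|v i t - om i t|.
    rewrite (Rintegral_ae_subset _ mI mS SI thN).
    by apply: eq_Rintegral => t; rewrite inE => St; rewrite ukv.
  have dvi : mu.-integrable I (EFin \o (fun t => v i t - om i t)) by exact: integrableB_fun.
  apply: (@le_trans _ _ (\int[mu]_(t in I) `|v i t - om i t|)).
    by apply: Rintegral_nd_set => //; exact: integrable_norm.
  have -> : e = 2 * (e / 2) by rewrite mulrC divfK.
  apply: L1_norm_le_sets => // A mA AI.
  rewrite RintegralB//; [|exact: integrableS (vi i)|exact: integrableS omI].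
  have c1 := conv A (fun l _ => ecoord i (w l)) Kw mA AI (fun l => measurable_cst _) (fun l t _ => wb i l).
  have c2 := weak_limit_integral (om_c (i := i)) mA AI.
  apply: (cvgr_to_le (cvg_norm (cvgB c1 c2))); near=> n.
  have [b1 b2] : mu.-integrable I (EFin \o (fun t => e / 4 / T +
      C * (`|w0| + 1) * K `^ (1 - r) * `|u_ n t| `^ r)) /\
      \int[mu]_(t in I) (e / 4 / T + C * (`|w0| + 1) * K `^ (1 - r) * `|u_ n t| `^ r) <= e / 2.
    by apply: bndP; rewrite ?mulr_ge0 ?addr_ge0 ?(ltW C0)// /D lerDr addr_ge0.
  have mq : measurable_fun I (fun t => ecoord i (w (idx (u_ n t)))).
    by apply: (measurable_glue (idx := fun t => idx (u_ n t)) (h := fun l _ => ecoord i (w l))).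
  have qi : mu.-integrable I (EFin \o (fun t => ecoord i (w (idx (u_ n t))))).
    exact: (@integrable_bounded _ _ _ Kw).
  have cui := coord_control_integrable i n.
  suff : `|\int[mu]_(t in A) ecoord i (w (idx (u_ n t))) - \int[mu]_(t in A) ecoord i (u_ n t)| <= e / 2 by [].
  rewrite -RintegralB//; [|exact: integrableS qi|exact: integrableS cui].
  have di : mu.-integrable I (EFin \o (fun t => ecoord i (w (idx (u_ n t))) - ecoord i (u_ n t))).
    exact: integrableB_fun.
  apply: le_trans (Rintegral_norm_le mA (integrableS _ _ AI b1) _ _) _ => //.
  + by apply: measurable_funS AI _ => //; exact: integrable_measurable di.
  + by move=> t At; apply: pw2; exact: AI.
  + apply: le_trans b2; apply: Rintegral_nd_set => // t It.
    by rewrite addr_ge0 ?(ltW eT0)// !mulr_ge0 ?addr_ge0 ?powR_ge0// ltW.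
- move=> c hc.
  have mS' : measurable_fun I (fun t => phi t (x t) (uk t)) by exact: running_cost_measurable.
  have le_H t : S t -> phi t (x t) (uk t) <= H t.
    move=> [It /= th1]; rewrite /uk th1 eqxx.
    by apply: (convex_function_sum vU (hphi_convex (x t) It) (a := th^~ t)) => // l; exact: th0.
  have lowP t : I t -> - low <= phi t (x t) (uk t).
    move=> It; apply: le_trans (coercive (x t) It (Uuk t)); rewrite /low -mulrN ler_wpM2l ?(ltW Cphi0)//.
    rewrite -[leLHS]add0r; apply: lerD; first exact: powR_ge0.
    by rewrite lerN2; apply: ge0_ler_powR; rewrite ?nnegrE ?(ltW delta0)//; exact: x_rho_lim.
  (* Squeezed between [- low] and Jensen's bound [H] where the frequencies sum to one, bounded by
     [C0'] elsewhere. *)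
  have pi : mu.-integrable I (EFin \o (fun t => phi t (x t) (uk t))).
    apply: (@integrable_le _ _ _ (fun t => `|H t| + (C0' + low))) => //.
    + by apply: integrableD_fun; [|exact: integrable_norm|exact: integrable_cst_fun].
    + move=> t It; have [th1|th1] := eqVneq (\sum_(l < m.+1) th l t) 1.
        have h1 := le_H t (conj It th1); have h2 := lowP t It.
        rewrite ler_norml; have := ler_norm (H t); have := normr_ge0 (H t).
        by move: h1 h2 C0'0 low0; move: (phi _ _ _) (H t) `|H t| => a1 a2 a3 *; apply/andP; split; lra.
      rewrite /uk (negbTE th1); apply: le_trans (hC0' t It) _.
      by have := normr_ge0 (H t); move: C0'0 low0; lra.
  split => //.
  rewrite (Rintegral_ae_subset _ mI mS SI thN).
  apply: (@le_trans _ _ (\int[mu]_(t in S) H t)).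
    by apply: le_Rintegral => //; [exact: integrableS pi|exact: integrableS Hi].
  rewrite -(Rintegral_ae_subset _ mI mS SI thN).
  have c1 := conv I (fun l t => phi t (x t) (w l)) Kb mI (@subset_refl _ _) mphi phib.
  apply: (cvgr_to_le c1); near=> n.
  have n1 : \int[mu]_(t in I) phi t (x_ n t) (u_ n t) <= c by near: n.
  have n2 t : I t -> phi t (x t) (w (idx (u_ n t))) <=
    phi t (x_ n t) (u_ n t) + (e / 4 / T + (C0' + low) * K `^ (1 - r) * `|u_ n t| `^ r).
    by move: t; near: n.
  have [b1 b2] : mu.-integrable I (EFin \o (fun t => e / 4 / T +
      (C0' + low) * K `^ (1 - r) * `|u_ n t| `^ r)) /\
      \int[mu]_(t in I) (e / 4 / T + (C0' + low) * K `^ (1 - r) * `|u_ n t| `^ r) <= e / 2.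
    by apply: bndP; rewrite ?addr_ge0// /D lerDl mulr_ge0 ?addr_ge0 ?(ltW C0).
  have qi : mu.-integrable I (EFin \o (fun t => phi t (x t) (w (idx (u_ n t))))).
    apply: (@integrable_bounded _ _ _ Kb) => //; last by move=> t; exact: phib.
    by apply: (measurable_glue (idx := fun t => idx (u_ n t)) (h := fun l t => phi t (x t) (w l))).
  apply: (@le_trans _ _ (\int[mu]_(t in I) (phi t (x_ n t) (u_ n t) +
     (e / 4 / T + (C0' + low) * K `^ (1 - r) * `|u_ n t| `^ r)))).
    by apply: le_Rintegral => //; exact: integrableD_fun.
  by rewrite RintegralD//; apply: lerD => //; apply: le_trans b2 _; lra.
Unshelve. all: by end_near. Qed.

(** The bound [c] is quantified after [u] because it is used twice: with a crude value that yields
    integrability, then with a value involving the Young integral along the limit, known only once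
    [u] has been studied. *)
Lemma running_cost_lsc : exists u : R -> E,
  [/\ measurable_control T u, forall t, I t -> U (u t),
      forall i, mu.-integrable I (EFin \o (fun t => ecoord i (u t))),
      forall i, weak_limit i (fun t => ecoord i (u t)) &
      forall c, (\forall n \near F, \int[mu]_(t in I) phi t (x_ n t) (u_ n t) <= c) ->
        mu.-integrable I (EFin \o (fun t => phi t (x t) (u t))) /\
        \int[mu]_(t in I) phi t (x t) (u t) <= c].
Proof.
have Iz : I 0 by rewrite /I/= in_itv/= lexx ltW.
pose w0 := u_ 0 0; have U0 : U w0 by exact: Uu_.
have [C0' C0'0 hC0'] := running_cost_cst_bounded xc U0.
(* The accuracies are summable, so that L^1 closeness gives convergence almost everywhere. *)
pose ek (k : nat) : R := 1 / (2 ^ (k + 1))%:R.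
have ek0 k : 0 < ek k by rewrite divr_gt0// ltr0n expn_gt0.
have [uk huk] := choice (fun k => quantised_minimiser (ek0 k)).
have omI i : mu.-integrable I (EFin \o om i) by apply: integrableS (om_i i).
have dom i k : mu.-integrable I (EFin \o (fun t => `|ecoord i (uk k t) - om i t|)).
  by apply: integrable_norm; apply: integrableB_fun => //; have [] := huk k.
have aeS : {ae mu, forall t, forall i, I t -> `|ecoord i (uk k t) - om i t| @[k --> \oo] --> 0}.
  apply: filter_forall => i; apply: (L1_fast_cvg_ae mI) => [k|k t It|k]//.
  by have [_ _ _ /(_ i) h _] := huk k.
have [N [mN N0 hN]] := aeS.
pose S : set (measurableTypeR R) := I `\` N.
have mS : measurable S by exact: measurableD.
have SI : S `<=` I by move=> t [].
have S0 : mu (I `\` S) = 0%E.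
  by apply: (subset_measure0 _ mN _ N0); [exact: measurableD|move=> t [It /not_andP[//|/contrapT]]].
have Scvg i t : S t -> `|ecoord i (uk k t) - om i t| @[k --> \oo] --> 0.
  by move=> [It Nt]; have /contrapT := contra_not (hN t) Nt; apply.
pose us t := \sum_i om i t *: ebasis i.
(* Off [S], where convergence may fail, [w0] is used so that the control lies in [U] at every time;
   on [S] this holds because [U] is closed. *)
pose u t := if `[< S t >] then us t else w0.
have uS t : S t -> u t = us t by move=> St; rewrite /u; case: asboolP.
have [Cn Cn1 hCn] := norm_le_ecoord E.
have ukcvg t : S t -> uk k t @[k --> \oo] --> u t.
  move=> St; rewrite uS//; apply/cvgrPdist_lt => e e0.
  have : Cn * (\sum_i `|ecoord i (uk k t) - om i t|) @[k --> \oo] --> Cn * \sum_(i < edim E) 0.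
    by apply: cvgMr; apply: cvg_sumr => i; exact: Scvg.
  rewrite big1// mulr0 => /cvgrPdist_lt/(_ e e0); apply: filterS => k.
  rewrite sub0r normrN => h; apply: le_lt_trans (le_lt_trans (ler_norm _) h).
  apply: le_trans (hCn _) _; rewrite ler_wpM2l ?(le_trans ler01 Cn1)//.
  by apply: ler_sum => i _; rewrite distrC ecoordB ecoord_lincomb.
have Uu t : U (u t).
  have [St|nSt] := pselect (S t); last by rewrite /u; case: asboolP.
  have nU : \forall k \near \oo, U (uk k t).
    by near=> k; have [_ h _ _ _] := huk k; apply: h; exact: SI.
  exact: (closed_cvg _ cU nU _ (ukcvg t St)).
have uE i t : S t -> ecoord i (u t) = om i t by move=> St; rewrite uS// ecoord_lincomb.
have mu' : measurable_control T u.
  apply: coord_measurable_control => i.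
  have -> : (fun t => ecoord i (u t)) = (fun t => if `[<S t>] then om i t else ecoord i w0).
    apply/funext => t; rewrite /u; case: asboolP => //= St.
    by rewrite ecoord_lincomb.
  apply: (measurable_fun_ifset (S := S)) => //; last exact: integrable_measurable (omI i).
  apply/seteqP; split => t; first by move=> [It /=]; case: asboolP.
  by move=> St; split; [exact: SI|rewrite /=; case: asboolP].
exists u; split => //.
- move=> i; apply: (@integrable_le _ _ _ (fun t => `|om i t| + `|ecoord i w0|)) => //.
  + by apply: integrableD_fun; [|exact: integrable_norm|exact: integrable_cst_fun].
  + by apply: control_comp_measurable => //; exact: ecoord_continuous.
  + move=> t It; rewrite /u; case: asboolP => [St|_]; last by rewrite lerDr.
    by rewrite ecoord_lincomb lerDl.
- move=> i A h K mA AI mh hK.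
  have := om_c (i := i) mA AI mh hK.
  have mAS : measurable (A `&` S) by exact: measurableI.
  have AS0 : mu (A `\` (A `&` S)) = 0%E.
    apply: (subset_measure0 _ _ _ S0); [exact: measurableD|exact: measurableD|].
    by move=> t [At nS]; split; [exact: AI|move=> St; apply: nS].
  have sAS : A `&` S `<=` A by exact: subIsetl.
  suff -> : \int[mu]_(t in A) (om i t * h t) = \int[mu]_(t in A) (ecoord i (u t) * h t) by [].
  rewrite !(Rintegral_ae_subset _ mA mAS sAS AS0); apply: eq_Rintegral => t.
  by rewrite inE => -[_ St]; rewrite uE.
- move=> c hc.
  (* By coercivity [- low] bounds the running cost from below; adding [low] makes the integrands
     nonnegative, as Fatou's lemma requires. *)
  pose low := Cphi * rho `^ delta.
  have low0 : 0 <= low by rewrite mulr_ge0 ?powR_ge0// ltW.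
  have lowP v t : I t -> U v -> 0 <= phi t (x t) v + low.
    move=> It Uv; rewrite -lerBlDr sub0r; apply: le_trans (coercive (x t) It Uv).
    rewrite /low -mulrN ler_wpM2l ?(ltW Cphi0)//.
    rewrite -[leLHS]add0r; apply: lerD; first exact: powR_ge0.
    by rewrite lerN2; apply: ge0_ler_powR; rewrite ?nnegrE ?(ltW delta0)//; exact: x_rho_lim.
  have lowi : mu.-integrable I (EFin \o (fun=> low)) by exact: integrable_cst_fun.
  have mphi : measurable_fun I (fun t => phi t (x t) (u t)) by exact: running_cost_measurable.
  have mphiE : measurable_fun I (fun t => (phi t (x t) (u t) + low)%:E).
    by apply/measurable_EFinP; exact: measurable_funD.
  pose f_ k t := (phi t (x t) (uk k t) + low)%:E.
  have fi k : mu.-integrable I (f_ k).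
    by apply: (integrableD_fun mI _ lowi); have [_ _ _ _ /(_ c hc) []] := huk k.
  have f0 k t : S t -> (0 <= f_ k t)%E.
    move=> St; rewrite lee_fin; apply: lowP; first exact: SI.
    by have [_ h _ _ _] := huk k; apply: h; exact: SI.
  have mf k : measurable_fun S (f_ k).
    by apply: measurable_funS SI _ => //; have /integrableP[] := fi k.
  have fle k : (\int[mu]_(t in S) f_ k t <= (c + low * T + ek k)%:E)%E.
    rewrite -(integral_ae_subset _ mI mS SI S0) -(fineK (integrable_fin_num mI (fi k))) lee_fin.
    have [h1 _ _ _ /(_ c hc) [h2 h3]] := huk k.
    have -> : fine (\int[mu]_(t in I) f_ k t) = \int[mu]_(t in I) (phi t (x t) (uk k t) + low) by [].
    rewrite RintegralD// Rintegral_cst//.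
    have -> : fine (mu I) = T by rewrite lebesgue_measure_0T.
    lra.
  have fcvg t : S t -> limn_einf (f_^~ t) = (phi t (x t) (u t) + low)%:E.
    move=> St; apply: (cvg_limn_einf_sup _).1; apply/cvg_EFin; first by near=> k.
    rewrite /f_ /=; apply: cvgD; last exact: cvg_cst.
    move/subspace_continuousP: hphi => /(_ (t, x t, u t) (conj (SI _ St) (Uu t))) hcont.
    apply: cvg_trans hcont => A hA.
    have kc : (t, x t, uk k t) @[k --> \oo] --> (t, x t, u t).
      by apply: cvg_pairf; [exact: cvg_cst|exact: ukcvg].
    have := kc _ hA; rewrite /nbhs/=; apply: filterS => k; apply; split => //=; first exact: SI.
    by have [_ h _ _ _] := huk k; apply: h; exact: SI.
  have ek_cvg : (c + low * T + ek k)%:E @[k --> \oo] --> (c + low * T)%:E.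
    apply/cvg_EFin; first by near=> k.
    rewrite -[X in _ --> X]addr0; apply: cvgD; first exact: cvg_cst.
    apply: (@cvg_series_cvg_0 _ R^o); apply/cvg_ex; eexists.
    exact: (@cvg_geometric_series_half R 1 0).
  have key : (\int[mu]_(t in I) (phi t (x t) (u t) + low)%:E <= (c + low * T)%:E)%E.
    rewrite (integral_ae_subset _ mI mS SI S0).
    have := @fatou _ _ _ mu S mS f_ mf f0.
    have -> : (\int[mu]_(t in S) limn_einf (f_^~ t) =
       \int[mu]_(t in S) (phi t (x t) (u t) + low)%:E)%E.
      by apply: eq_integral => t; rewrite inE => St; exact: fcvg.
    move=> h; apply: le_trans h _.
    rewrite limn_einf_lim -(cvg_lim _ ek_cvg)//.
    apply: lee_lim; [exact: is_cvg_einfs|by apply/cvg_ex; eexists; exact: ek_cvg|].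
    near=> k; apply: le_trans (fle k); apply: ereal_inf_lbound => /=.
    by exists k => /=.
  have phii : mu.-integrable I (EFin \o (fun t => phi t (x t) (u t) + low)).
    apply/integrableP; split => //; apply: le_lt_trans (ltry (c + low * T)).
    apply: le_trans key; rewrite le_eqVlt; apply/orP; left; apply/eqP.
    by apply: eq_integral => t; rewrite inE => It; rewrite /= ger0_norm// lowP.
  have pi : mu.-integrable I (EFin \o (fun t => phi t (x t) (u t))).
    rewrite (_ : _ \o _ = EFin \o (fun t => phi t (x t) (u t) + low - low)); first exact: integrableB_fun.
    by apply/funext => t /=; rewrite addrK.
  split => //; move: key; rewrite -(fineK (integrable_fin_num mI phii)) lee_fin.
  move=> h; have : \int[mu]_(t in I) (phi t (x t) (u t) + low) <= c + low * T by exact: h.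
  rewrite RintegralD// Rintegral_cst//.
  have -> : fine (mu I) = T by rewrite lebesgue_measure_0T.
  by rewrite lerD2r.
Unshelve. all: by end_near. Qed.

End Level.

Lemma weak_limit_control : exists u : R -> E,
  [/\ measurable_control T u, forall t, I t -> U (u t),
      forall i, mu.-integrable I (EFin \o (fun t => ecoord i (u t))),
      forall i, weak_limit i (fun t => ecoord i (u t)) &
      forall c, (\forall n \near F, \int[mu]_(t in I) phi t (x_ n t) (u_ n t) <= c) ->
        mu.-integrable I (EFin \o (fun t => phi t (x t) (u t))) /\
        \int[mu]_(t in I) phi t (x t) (u t) <= c].
Proof.
have [om hom] := control_weak_limit.
exact: (running_cost_lsc (fun i => (hom i).1) (fun i => (hom i).2)).
Qed.
End LowerSemicontinuity.
End RunningCost.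

(** * The state equation *)

Lemma absolutely_continuous_unif (R : realType) (V : normedModType R) (T : R) (x : R -> V) :
  absolutely_continuous T x -> forall e : R, 0 < e -> exists2 del : R, 0 < del &
    forall s t, 0 <= s -> s <= t -> t <= T -> t - s < del -> `|x t - x s| < e.
Proof.
move=> xac e e0; have [del del0 hdel] := xac e e0; exists del => // s t s0 st tT ts.
have := hdel 1%N (fun=> s) (fun=> t); rewrite !big_ord1; apply => // i j _ _ _.
by rewrite !ord1.
Qed.

Lemma unif_within_continuous (R : realType) (V : normedModType R) (T : R) (x : R -> V) :
  (forall e : R, 0 < e -> exists2 del : R, 0 < del &
    forall s t, 0 <= s -> s <= t -> t <= T -> t - s < del -> `|x t - x s| < e) ->
  {within `[0, T], continuous x}.
Proof.
move=> xu; apply/subspace_continuousP => t; rewrite /= in_itv/= => /andP[t0 tT].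
apply/cvgrPdist_lt => e e0; have [del del0 hdel] := xu e e0.
rewrite near_withinE; exists del => //= s.
rewrite /ball/= => ts; rewrite in_itv/= => /andP[s0 sT].
case: (leP s t) => [st|/ltW st].
  by apply: hdel => //; apply: le_lt_trans (ler_norm _) ts.
by rewrite distrC; apply: hdel => //; rewrite distrC in ts; apply: le_lt_trans (ler_norm _) ts.
Qed.

Lemma absolutely_continuous_within (R : realType) (V : normedModType R) (T : R) (x : R -> V) :
  absolutely_continuous T x -> {within `[0, T], continuous x}.
Proof. by move=> xac; apply: unif_within_continuous; exact: absolutely_continuous_unif. Qed.

(** * Derivatives and absolute continuity in coordinates *)

Section VectorDerivative.
Context {R : realType} {E : normedVectType R}.

Lemma is_derive_cvgP (V : normedModType R) (x : R -> V) (t : R) (v : V) :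
  is_derive t 1 x v <-> h^-1 *: (x (h + t) - x t) @[h --> (0 : R)^'] --> v.
Proof.
have quotE : (fun h : R => h^-1 *: ((x \o shift t) (h *: (1 : R)) - x t)) =
    (fun h => h^-1 *: (x (h + t) - x t)).
  by apply/funext => h /=; rewrite /shift/= /GRing.scale/= mulr1.
split => [[]|cv].
- by rewrite /derivable /derive quotE => /cvg_ex[l cl] <-; move/cvg_lim : (cl) => ->.
- split; first by rewrite /derivable quotE; apply/cvg_ex; exists v.
  by rewrite /derive quotE; exact/cvg_lim.
Qed.

Lemma is_derive_ecoord (x : R -> E) (t : R) (v : E) i : is_derive t 1 x v ->
  is_derive t 1 (fun s => ecoord i (x s) : R^o) (ecoord i v).
Proof.
move/is_derive_cvgP => h; apply/is_derive_cvgP.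
have := cvg_comp _ _ h (@ecoord_continuous _ _ i v).
apply: cvg_trans; apply: near_eq_cvg; near=> k.
by rewrite /= ecoordZ ecoordB.
Unshelve. all: by end_near. Qed.

Lemma ecoord_is_derive (x : R -> E) (t : R) (v : E) :
  (forall i, is_derive t 1 (fun s => ecoord i (x s) : R^o) (ecoord i v)) -> is_derive t 1 x v.
Proof.
move=> h; apply/is_derive_cvgP; rewrite [X in _ --> X]ecoord_sum.
have : \sum_i (k^-1 * (ecoord i (x (k + t)) - ecoord i (x t))) *: ebasis i @[k --> (0 : R)^'] -->
    \sum_i ecoord i v *: ebasis i.
  by apply: cvg_sumr => i; apply: cvgZl; exact: (is_derive_cvgP _ _ _).1 (h i).
apply: cvg_trans; apply: near_eq_cvg; near=> k.
rewrite [RHS]ecoord_sum; apply: eq_bigr => i _.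
by rewrite ecoordZ ecoordB.
Unshelve. all: by end_near. Qed.

Lemma absolutely_continuous_ecoord (T : R) (x : R -> E) i : absolutely_continuous T x ->
  absolutely_continuous T (fun s => ecoord i (x s) : R^o).
Proof.
have [C C1 hC] := ecoord_bounded E; have C0 : 0 < C by exact: lt_le_trans C1.
move=> xac e e0; have [del del0 hdel] := xac _ (divr_gt0 e0 C0).
exists del => // n a b ab tri ltd.
apply: (@le_lt_trans _ _ (\sum_i C * `|x (b i) - x (a i)|)).
  by apply: ler_sum => j _; rewrite -ecoordB.
by rewrite -mulr_sumr -ltr_pdivlMl// mulrC; exact: hdel.
Qed.

Lemma ecoord_absolutely_continuous (T : R) (x : R -> E) :
  (forall i, absolutely_continuous T (fun s => ecoord i (x s) : R^o)) -> absolutely_continuous T x.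
Proof.
have [C C1 hC] := norm_le_ecoord E; have C0 : 0 < C by exact: lt_le_trans C1.
move=> xac e e0.
(* The successor keeps the divisor positive in dimension zero and makes the final estimate
   strict. *)
have N0 : 0 < C * (edim E).+1%:R by rewrite mulr_gt0.
have h i : exists del : R, 0 < del /\ forall (n : nat) (a b : 'I_n -> R),
      (forall i, [/\ 0 <= a i, a i <= b i & b i <= T]) ->
      trivIset [set: 'I_n] (fun i => `]a i, b i[%classic) ->
      \sum_i (b i - a i) < del ->
      \sum_j `|ecoord i (x (b j)) - ecoord i (x (a j))| < e / (C * (edim E).+1%:R).
  by have [del del0 hdel] := xac i _ (divr_gt0 e0 N0); exists del.
have [del hdel] := choice h.
have [d d0 hd] : exists2 d : R, 0 < d & forall i, d <= del i.
  exists (\big[Num.min/1]_i del i); last by move=> i; exact: bigmin_le_cond.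
  by elim/big_ind : _ => // [a b a0 b0|i _]; [rewrite lt_min a0|exact: (hdel i).1].
exists d => // n a b ab tri ltd.
apply: (@le_lt_trans _ _ (C * \sum_i \sum_j `|ecoord i (x (b j)) - ecoord i (x (a j))|)).
  rewrite exchange_big/= mulr_sumr; apply: ler_sum => j _; apply: le_trans (hC _) _.
  rewrite ler_wpM2l ?(ltW C0)//; apply: ler_sum => i _.
  by rewrite ecoordB.
rewrite -ltr_pdivlMl//.
apply: (@le_lt_trans _ _ (\sum_(i < edim E) e / (C * (edim E).+1%:R))).
  apply: ler_sum => i _; apply: ltW; apply: (hdel i).2 => //.
  exact: lt_le_trans ltd (hd i).
rewrite sumr_const card_ord -[X in X < _]mulr_natr invfM.
have -> : e * (C^-1 * (edim E).+1%:R^-1) * (edim E)%:R = C^-1 * e * ((edim E)%:R / (edim E).+1%:R).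
  by ring.
by rewrite gtr_pMr ?mulr_gt0 ?invr_gt0// ltr_pdivrMr// mul1r ltr_nat.
Qed.

End VectorDerivative.

(** * Vector integrals in coordinates, and Ascoli's theorem *)

Section VectorIntegral.
Context {R : realType} {E : normedVectType R}.
Notation mu := (@lebesgue_measure R).

(** The triangle inequality for an integral that is taken coordinate by coordinate: the equivalence
    of norms costs a constant, which depends on [E] alone. *)
Lemma norm_le_integral : exists2 C : R, 1 <= C &
  forall (A : set (measurableTypeR R)) (h : R -> E) (k : R -> R) (y : E),
    measurable A -> (forall i, measurable_fun A (fun t => ecoord i (h t))) ->
    mu.-integrable A (EFin \o k) -> (forall t, A t -> `|h t| <= k t) ->
    (forall i, ecoord i y = \int[mu]_(t in A) ecoord i (h t)) ->
    `|y| <= C * \int[mu]_(t in A) k t.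
Proof.
have [C C1 hC] := ecoord_bounded E; have [D D1 hD] := norm_le_ecoord E.
have [C0 D0] : 0 <= C /\ 0 <= D by split; exact: le_trans ler01 _.
exists (1 + D * (C * (edim E)%:R)) => [|A h k y mA mh ki hk hy].
  by rewrite lerDl !mulr_ge0.
have k0 : 0 <= \int[mu]_(t in A) k t.
  by apply: Rintegral_ge0 => t At; apply: le_trans (hk t At).
apply: le_trans (hD y) _; rewrite mulrDl mul1r; apply: ler_wpDl => //.
rewrite -mulrA ler_wpM2l//; apply: (@le_trans _ _ (\sum_(i < edim E) C * \int[mu]_(t in A) k t)).
  apply: ler_sum => i _; rewrite hy -RintegralZl//; apply: Rintegral_norm_le => //.
    exact: integrableZ_fun.
  by move=> t At; apply: le_trans (hC _ _) _; rewrite ler_wpM2l// hk.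
by rewrite sumr_const card_ord -[X in X <= _]mulr_natr mulrAC.
Qed.

(** Pointwise limits exist by compactness of balls and inherit the modulus of continuity. Uniformity
    comes from a dissection finer than both moduli: convergence at its finitely many points holds
    simultaneously along [F]. *)
Lemma ultra_ascoli (T : R) (F : set_system nat) (x_ : nat -> R -> E) (rho : R) : 0 < T ->
  UltraFilter F -> (forall n t, t \in `[0, T] -> `|x_ n t| <= rho) ->
  (forall e : R, 0 < e -> exists2 del : R, 0 < del &
     forall n s t, 0 <= s -> s <= t -> t <= T -> t - s < del -> `|x_ n t - x_ n s| <= e) ->
  exists2 x : R -> E, {within `[0, T], continuous x} &
    forall e : R, 0 < e -> \forall n \near F, forall t, t \in `[0, T] -> `|x_ n t - x t| < e.
Proof.
move=> T0 FU xr xe.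
have FF : ProperFilter F by exact: ultra_proper.
have hl t : exists l : E, t \in `[0, T] -> x_ n t @[n --> F] --> l.
  case: (boolP (t \in `[0, T])) => It; last by exists 0.
  have [|l _ hl] := ultra_compact_cvg (h := fun n => x_ n t) FU (@closed_ball0_compact _ E rho).
    by near=> n; exact: xr.
  by exists l.
have [x hx] := choice hl.
have xeq e : 0 < e -> exists2 del : R, 0 < del &
    forall s t, 0 <= s -> s <= t -> t <= T -> t - s < del -> `|x t - x s| <= e.
  move=> e0; have [del del0 hdel] := xe e e0; exists del => // s t s0 st tT ts.
  have cs := hx s; rewrite in_itv/= s0 (le_trans st tT)/= in cs.
  have ct := hx t; rewrite in_itv/= (le_trans s0 st) tT/= in ct.
  apply: (cvgr_to_le (cvg_norm (cvgB (ct isT) (cs isT)))); near=> n.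
  exact: hdel.
exists x.
  apply: unif_within_continuous => e e0.
  have [del del0 hdel] := xeq (e / 2) (divr_gt0 e0 (ltr0Sn _ 1)).
  exists del => // s t s0 st tT ts; apply: le_lt_trans (hdel s t s0 st tT ts) _.
  by rewrite ltr_pdivrMr// ltr_pMr// ltr1n.
move=> e e0; have e4 : 0 < e / 4 by rewrite divr_gt0.
have [d1 d10 h1] := xe _ e4; have [d2 d20 h2] := xeq _ e4.
have d0 : 0 < Num.min d1 d2 by rewrite lt_min d10.
have [s ps fs] := fine_dissection_exists T0 d0.
have [ps1 /eqP ps2] := ps.
have knotI i : knot T s i \in `[0, T].
  case: (ltnP i (size (0 :: s))) => is_; last first.
    by rewrite /knot nth_default// in_itv/= lexx ltW.
  have ki : knot T s i \in 0 :: s by exact: mem_nth.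
  by rewrite in_itv/= (path_lt_head ps1 ki) -{2}ps2 (path_lt_last ps1 ki).
have hn : \forall n \near F, forall i : 'I_(size s).+1, `|x_ n (knot T s i) - x (knot T s i)| < e / 4.
  apply: filter_forall => i; have /cvgrPdist_lt/(_ _ e4) := hx _ (knotI i).
  by apply: filterS => n; rewrite distrC.
apply: filterS hn => n hn t; rewrite in_itv/= => /andP[t0 tT].
have [i [it ti]] : exists i : 'I_(size s).+1, knot T s i <= t /\ t - knot T s i < Num.min d1 d2.
  have [tT'|Tt] := ltP t T.
    have [i [is_ it ti]] := dissection_block ps t0 tT'.
    exists (Ordinal (leqW is_)); split => //=; apply: lt_trans (fs i is_).
    by rewrite ltrD2r.
  exists ord_max => /=.
  have -> : knot T s (size s) = T by rewrite /knot (nth_last T (0 :: s)).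
  by split => //; apply: le_lt_trans d0; rewrite subr_le0.
have := knotI i; rewrite in_itv/= => /andP[k0 _].
move: ti; rewrite lt_min => /andP[ti1 ti2].
have b1 := h1 n _ _ k0 it tT ti1; have b2 := h2 _ _ k0 it tT ti2; have b3 := hn i.
have -> : x_ n t - x t = (x_ n t - x_ n (knot T s i)) - (x t - x (knot T s i)) +
  (x_ n (knot T s i) - x (knot T s i)).
  by rewrite opprB [RHS]addrAC !subrKA.
apply: le_lt_trans (ler_normD _ _) _; have := ler_normB (x_ n t - x_ n (knot T s i)) (x t - x (knot T s i)).
lra.
Unshelve. all: by end_near. Qed.

End VectorIntegral.

(** * The integral form of the state equation and its stability *)

Section StateEquation.
Context {R : realType} {E : normedVectType R}.
Notation mu := (@lebesgue_measure R).
Variables (T : R) (f : R -> E -> E) (g : R -> E -> 'End(E)).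
Hypothesis T0 : 0 < T.
Hypothesis hf : {within [set z : R * E | z.1 \in `[0, T]], continuous (fun z => f z.1 z.2)}.
Hypothesis hg : lfun_continuous_in [set z : R * E | z.1 \in `[0, T]] (fun z => g z.1 z.2).

Let I : set (measurableTypeR R) := `[0, T]%classic.
Let mI : measurable I. Proof. exact: measurable_itv. Qed.
Let Ifin : (mu I < +oo)%E. Proof. by rewrite (lebesgue_measure_0T T0) ltry. Qed.

Lemma lfun_eval_continuous v :
  {within [set z : R * E | z.1 \in `[0, T]], continuous (fun z => g z.1 z.2 v)}.
Proof.
apply/subspace_continuousP => z Iz; apply/cvgrPdist_lt => e e0.
have v0 : 0 < `|v| + 1 by rewrite ltr_pwDr.
have /cvgrPdist_lt/(_ _ (divr_gt0 e0 v0)) := hg Iz.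
apply: filterS => y; rewrite sub0r normrN ger0_norm ?opnorm_ge0// => h.
rewrite distrC /from_subspace /= -opp_lfunE -add_lfunE.
apply: le_lt_trans (le_opnorm _ _) _.
apply: (@le_lt_trans _ _ (opnorm (g y.1 y.2 - g z.1 z.2) * (`|v| + 1))).
  by rewrite ler_wpM2l ?opnorm_ge0// lerDl.
by rewrite -ltr_pdivlMr.
Qed.

Lemma within_strip_comp (V : normedModType R) (h : R -> E -> V) (x : R -> E) :
  {within [set z : R * E | z.1 \in `[0, T]], continuous (fun z => h z.1 z.2)} ->
  {within `[0, T], continuous x} -> {within `[0, T], continuous (fun t => h t (x t))}.
Proof.
move=> ch cx.
apply: (@within_comp _ _ _ `[0, T]%classic _ (fun t => (t, x t)) _ _ _ ch) => [t It//|].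
apply/subspace_continuousP => t It; move/subspace_continuousP: cx => /(_ t It) cx.
by apply: cvg_pairf; [exact: cvg_within|exact: cx].
Qed.

Lemma strip_bounded (V : normedModType R) (h : R -> E -> V) (rho : R) :
  {within [set z : R * E | z.1 \in `[0, T]], continuous (fun z => h z.1 z.2)} ->
  exists2 C : R, 0 <= C & forall t y, I t -> `|y| <= rho -> `|h t y| <= C.
Proof.
move=> ch; pose K : set (R * E) := `[0, T]%classic `*` [set w : E | `|w| <= rho].
have cK : compact K by apply: compact_setX; [exact: segment_compact|exact: closed_ball0_compact].
have KS : K `<=` [set z : R * E | z.1 \in `[0, T]] by move=> -[t y] [].
have [C C0 hC] := compact_norm_bounded cK (continuous_subspaceW KS ch).
by exists C => // t y It yr; exact: (hC (t, y)).
Qed.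

Lemma strip_unif (V : normedModType R) (h : R -> E -> V) (F : set_system nat)
    (x_ : nat -> R -> E) (x : R -> E) (rho : R) : Filter F ->
  {within [set z : R * E | z.1 \in `[0, T]], continuous (fun z => h z.1 z.2)} ->
  (forall n t, I t -> `|x_ n t| <= rho) -> (forall t, I t -> `|x t| <= rho) ->
  (forall e : R, 0 < e -> \forall n \near F, forall t, I t -> `|x_ n t - x t| < e) ->
  forall e : R, 0 < e -> \forall n \near F, forall t, I t -> `|h t (x_ n t) - h t (x t)| < e.
Proof.
move=> FF ch x_r xr xu e e0.
pose K : set (R * E) := `[0, T]%classic `*` [set w : E | `|w| <= rho].
have cK : compact K by apply: compact_setX; [exact: segment_compact|exact: closed_ball0_compact].
have KS : K `<=` [set z : R * E | z.1 \in `[0, T]] by move=> -[t y] [].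
have [del del0 hdel] := heine cK KS ch e0.
apply: filterS (xu del del0) => n hn t It.
have K1 : K (t, x_ n t) by split => //=; exact: x_r.
have K2 : K (t, x t) by split => //=; exact: xr.
apply: (hdel _ _ K1 K2); split => /=; first exact: ballxx.
by rewrite -ball_normE/=; exact: hn.
Qed.

Definition velocity (x u : R -> E) (t : R) : E := f t (x t) + g t (x t) (u t).

Lemma ecoord_velocity i x u t : ecoord i (velocity x u t) =
  ecoord i (f t (x t)) + \sum_j ecoord j (u t) * ecoord i (g t (x t) (ebasis j)).
Proof.
rewrite /velocity ecoordD; congr (_ + _).
rewrite {1}(ecoord_sum (u t)) linear_sum/= (big_morph _ (ecoordD i) (ecoord0 i)).
by apply: eq_bigr => j _; rewrite linearZ/= ecoordZ.
Qed.

Let cont_measurable (h : R -> E) i : {within `[0, T], continuous h} ->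
  measurable_fun I (fun t => ecoord i (h t)).
Proof.
move=> ch; apply: subspace_continuous_measurable_fun => //.
by apply/subspace_continuousP => t It; move/subspace_continuousP: ch => /(_ t It) h1;
  exact: cvg_comp h1 (@ecoord_continuous _ _ i (h t)).
Qed.

Lemma velocity_coefficients i x : {within `[0, T], continuous x} ->
  mu.-integrable I (EFin \o (fun t => ecoord i (f t (x t)))) /\
  forall j, measurable_fun I (fun t => ecoord i (g t (x t) (ebasis j))) /\
    exists K : R, forall t, I t -> `|ecoord i (g t (x t) (ebasis j))| <= K.
Proof.
move=> cx.
have [C C1 hC] := ecoord_bounded E; have C0 : 0 < C by exact: lt_le_trans C1.
have [rho rho0 hrho] := compact_norm_bounded (@segment_compact _ 0 T) cx.
split.
  have [Cf _ hCf] := strip_bounded rho hf.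
  apply: (@integrable_bounded _ _ _ (C * Cf)) => //.
    by apply: cont_measurable; exact: within_strip_comp.
  by move=> t It; apply: le_trans (hC _ _) _; rewrite ler_wpM2l ?(ltW C0)// hCf// hrho.
move=> j.
have [Cg _ hCg] := strip_bounded (h := fun t y => g t y (ebasis j)) rho (@lfun_eval_continuous (ebasis j)).
split; last first.
  exists (C * Cg) => t It; apply: le_trans (hC _ _) _.
  by rewrite ler_wpM2l ?(ltW C0)// hCg// hrho.
apply: cont_measurable; apply: (within_strip_comp (h := fun t y => g t y (ebasis j))) => //.
exact: lfun_eval_continuous.
Qed.

(** Being affine in [u], the velocity integrates to a finite sum of control coordinates tested
    against bounded coefficients: the form in which weak limits can be taken. *)
Lemma velocity_integral (A : set (measurableTypeR R)) i x u : measurable A -> A `<=` I ->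
  {within `[0, T], continuous x} ->
  (forall j, mu.-integrable I (EFin \o (fun t => ecoord j (u t)))) ->
  mu.-integrable A (EFin \o (fun t => ecoord i (velocity x u t))) /\
  \int[mu]_(t in A) ecoord i (velocity x u t) = \int[mu]_(t in A) ecoord i (f t (x t)) +
    \sum_j \int[mu]_(t in A) (ecoord j (u t) * ecoord i (g t (x t) (ebasis j))).
Proof.
move=> mA AI cx ui.
have Afin : (mu A < +oo)%E by apply: le_lt_trans Ifin; apply: le_measure; rewrite ?inE.
have [fi gi] := velocity_coefficients i cx.
have fiA := integrableS mI mA AI fi.
have giA j : mu.-integrable A (EFin \o (fun t => ecoord j (u t) * ecoord i (g t (x t) (ebasis j)))).
  have [mg [K hK]] := gi j; apply: (@integrableS _ _ _ _ I) => //.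
  exact: (@integrable_mulr_bounded _ _ _ _ K).
have velE : (fun t => ecoord i (velocity x u t)) = (fun t => ecoord i (f t (x t)) +
    \sum_j ecoord j (u t) * ecoord i (g t (x t) (ebasis j))).
  by apply/funext => t; exact: ecoord_velocity.
rewrite velE RintegralD// ?Rintegral_finsum//; last exact: integrable_finsum.
by split => //; apply: integrableD_fun => //; exact: integrable_finsum.
Qed.

Lemma velocity_integrable i x u : {within `[0, T], continuous x} ->
  (forall j, mu.-integrable I (EFin \o (fun t => ecoord j (u t)))) ->
  mu.-integrable I (EFin \o (fun t => ecoord i (velocity x u t))).
Proof. by move=> cx ui; have [] := velocity_integral i mI (@subset_refl _ _) cx ui. Qed.

Lemma solution_increment i xi x u s t : measurable_control T u ->
  (forall j, mu.-integrable I (EFin \o (fun t => ecoord j (u t)))) ->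
  solution_upto f g T xi x u -> 0 <= s -> s <= t -> t <= T ->
  ecoord i (x t) - ecoord i (x s) = \int[mu]_(z in `]s, t]) ecoord i (velocity x u z).
Proof.
move=> mu_ ui [xac _ dx] s0 st tT.
apply: (@ac_is_derive_integral _ T (fun t => ecoord i (velocity x u t)) (fun t => ecoord i (x t))) => //.
- by apply: velocity_integrable => //; exact: absolutely_continuous_within.
- exact: absolutely_continuous_ecoord.
- by move: dx; apply: ae_mono => z dz Iz; apply: is_derive_ecoord; exact: dz.
Qed.

(** The function [x] is known on [I] only. Its copy [y], defined on the whole line by the integral
    formula, can be differentiated directly. *)
Lemma solution_of_integral xi x u : {within `[0, T], continuous x} ->
  (forall j, mu.-integrable I (EFin \o (fun t => ecoord j (u t)))) ->
  (forall i t, I t -> ecoord i (x t) = ecoord i xi + \int[mu]_(z in `[0, t]) ecoord i (velocity x u z)) ->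
  exists2 y, solution_upto f g T xi y u & forall t, I t -> y t = x t.
Proof.
move=> cx ui hx.
pose y t := \sum_i (ecoord i xi + \int[mu]_(z in `[0, t]) ecoord i (velocity x u z)) *: ebasis i.
have yx t : I t -> y t = x t.
  by move=> It; apply: eq_ecoord => i; rewrite ecoord_lincomb hx.
have vi i := velocity_integrable i cx ui.
exists y => //; split.
- apply: ecoord_absolutely_continuous => i e e0.
  have [del del0 hdel] := primitive_absolutely_continuous (vi i) e0.
  exists del => // n a b ab tri ltd; apply: le_lt_trans (hdel n a b ab tri ltd).
  by apply: ler_sum => k _; rewrite !ecoord_lincomb opprD addrACA subrr add0r.
- apply: eq_ecoord => i; rewrite ecoord_lincomb set_itv1 Rintegral_set1 addr0//.
- have : {ae mu, forall t, forall i, t \in `[0, T] ->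
    is_derive t 1 (fun t => \int[mu]_(z in `[0, t]) ecoord i (velocity x u z) : R^o)
      (ecoord i (velocity x u t))}.
    by apply: filter_forall => i; exact: primitive_derive (vi i).
  apply: ae_mono => t dt It; apply: ecoord_is_derive => i.
  have vE : velocity y u t = velocity x u t by rewrite /velocity yx.
  have yE : (fun s => ecoord i (y s) : R^o) = cst (ecoord i xi : R^o) +
      (fun s => \int[mu]_(z in `[0, s]) ecoord i (velocity x u z) : R^o).
    by apply/funext => s; rewrite ecoord_lincomb.
  rewrite -[f t _ + _]/(velocity y u t) vE yE -[X in is_derive _ _ _ X]add0r.
  exact: is_deriveD (is_derive_cst _ _ _) (dt i It).
Qed.

Lemma lfun_ecoord_sum (A : 'End(E)) v : A v = \sum_j ecoord j v *: A (ebasis j).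
Proof.
by rewrite {1}(ecoord_sum v) linear_sum/=; apply: eq_bigr => j _; rewrite linearZ.
Qed.

(** The coefficients converge uniformly in time and the velocity is affine in [u], hence an error
    relative to [1 + |u|], uniform over all controls. *)
Lemma velocity_near (F : set_system nat) (x_ : nat -> R -> E) (x : R -> E) (rho : R) : Filter F ->
  (forall n t, I t -> `|x_ n t| <= rho) -> (forall t, I t -> `|x t| <= rho) ->
  (forall e : R, 0 < e -> \forall n \near F, forall t, I t -> `|x_ n t - x t| < e) ->
  forall e : R, 0 < e -> \forall n \near F, forall t u, I t ->
    `|velocity (x_ n) u t - velocity x u t| <= e * (1 + `|u t|).
Proof.
move=> FF x_r xr xu e e0.
have [C C1 hC] := ecoord_bounded E; have C0 : 0 < C by exact: lt_le_trans C1.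
pose N : R := C * (edim E).+1%:R.
have N0 : 0 < N by rewrite mulr_gt0.
have nf := strip_unif FF hf x_r xr xu e0.
have ng : \forall n \near F, forall j t, I t ->
    `|g t (x_ n t) (ebasis j) - g t (x t) (ebasis j)| < e / N.
  apply: filter_forall => j.
  exact: (strip_unif FF (h := fun t y => g t y (ebasis j)) (@lfun_eval_continuous _) x_r xr xu (divr_gt0 e0 N0)).
apply: filterS2 nf ng => n nf ng t u It.
rewrite /velocity opprD addrACA mulrDr mulr1; apply: le_trans (ler_normD _ _) _.
apply: lerD; first exact/ltW/nf.
rewrite (lfun_ecoord_sum (g t (x_ n t))) (lfun_ecoord_sum (g t (x t))) -sumrB.
apply: le_trans (ler_norm_sum _ _ _) _.
apply: (@le_trans _ _ (\sum_(j < edim E) (C * `|u t|) * (e / N))).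
  apply: ler_sum => j _; rewrite -scalerBr normrZ.
  by apply: ler_pM => //; exact/ltW/ng.
rewrite sumr_const card_ord -[X in X <= _]mulr_natr /N invfM.
have -> : C * `|u t| * (e * (C^-1 * (edim E).+1%:R^-1)) * (edim E)%:R =
   (C / C) * (e * `|u t| * ((edim E)%:R / (edim E).+1%:R)) by ring.
rewrite divff ?gt_eqF// mul1r ler_piMr ?mulr_ge0 ?(ltW e0)//.
by rewrite ler_pdivrMr// mul1r ler_nat.
Qed.

(** Two replacements in the integral equation: the coefficients at [x_ n] by those at [x], with an
    error controlled by the bounded integrals of [1 + |u_ n|]; then [u_ n] by [u], at frozen
    coefficients, by weak convergence. *)
Lemma solution_limit (F : set_system nat) (x_ u_ : nat -> R -> E) (x u : R -> E) (xi : E) (rho M : R) :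
  ProperFilter F -> {within `[0, T], continuous x} ->
  (forall n t, I t -> `|x_ n t| <= rho) -> (forall t, I t -> `|x t| <= rho) ->
  (forall e : R, 0 < e -> \forall n \near F, forall t, I t -> `|x_ n t - x t| < e) ->
  (forall n, measurable_control T (u_ n)) ->
  (forall n, mu.-integrable I (EFin \o (fun t => `|u_ n t|))) ->
  (forall n, \int[mu]_(t in I) `|u_ n t| <= M) ->
  (forall n, solution_upto f g T xi (x_ n) (u_ n)) ->
  (forall i, mu.-integrable I (EFin \o (fun t => ecoord i (u t)))) ->
  (forall i, weak_limit T F u_ i (fun t => ecoord i (u t))) ->
  exists2 y, solution_upto f g T xi y u & forall t, I t -> y t = x t.
Proof.
move=> FF xc x_r xr xu mu_ ui uM sol uci wl.
have [C C1 hC] := ecoord_bounded E; have C0 : 0 < C by exact: lt_le_trans C1.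
have cui n j : mu.-integrable I (EFin \o (fun t => ecoord j (u_ n t))).
  exact: ecoord_integrable.
apply: solution_of_integral => // i t It.
move: (It); rewrite /I/= in_itv/= => /andP[t0 tT].
pose A : set (measurableTypeR R) := `[0, t]%classic.
have mA : measurable A by exact: measurable_itv.
have AI : A `<=` I by move=> z; rewrite /A /I/= !in_itv/= => /andP[-> /le_trans]; apply.
have x_c n : {within `[0, T], continuous (x_ n)}.
  by have [xac _ _] := sol n; exact: absolutely_continuous_within.
have vni n m : mu.-integrable I (EFin \o (fun z => ecoord i (velocity (x_ n) (u_ m) z))).
  exact: velocity_integrable.
have vi m : mu.-integrable I (EFin \o (fun z => ecoord i (velocity x (u_ m) z))).
  exact: velocity_integrable.
have xn n : ecoord i (x_ n t) = ecoord i xi + \int[mu]_(z in A) ecoord i (velocity (x_ n) (u_ n) z).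
  have := solution_increment i (mu_ n) (cui n) (sol n) (lexx 0) t0 tT.
  rewrite -(RintegralcB (vni n n)) ?lexx// set_itv1 Rintegral_set1 subr0.
  by have [_ -> _] := sol n => <-; rewrite addrC subrK.
have c1 : ecoord i (x_ n t) @[n --> F] --> ecoord i (x t).
  have xt : x_ n t @[n --> F] --> x t.
    by apply/cvgrPdist_lt => e e0; apply: filterS (xu e e0) => n h; rewrite distrC; exact: h.
  exact: cvg_comp xt (@ecoord_continuous _ _ i (x t)).
have c2 : \int[mu]_(z in A) ecoord i (velocity x (u_ n) z) @[n --> F] -->
    \int[mu]_(z in A) ecoord i (velocity x u z).
  under eq_fun do rewrite (velocity_integral i mA AI xc (cui _)).2.
  rewrite (velocity_integral i mA AI xc uci).2.
  apply: cvgD; first exact: cvg_cst.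
  apply: cvg_sumr => j; have [_ /(_ j) [mg [K hK]]] := velocity_coefficients i xc.
  by apply: (wl j A _ K) => // [|t' At]; [apply: measurable_funS AI _|apply: hK; exact: AI].
have c3 : (\int[mu]_(z in A) ecoord i (velocity (x_ n) (u_ n) z) -
    \int[mu]_(z in A) ecoord i (velocity x (u_ n) z)) @[n --> F] --> (0 : R).
  apply/cvgrPdist_le => e e0.
  have N0 : 0 < C * (T + `|M|) + 1 by rewrite ltr_pwDr// mulr_ge0 ?(ltW C0)// addr_ge0 ?(ltW T0).
  apply: filterS (velocity_near FF x_r xr xu (divr_gt0 e0 N0)) => n hn.
  rewrite sub0r normrN -RintegralB//; [|exact: integrableS (vni n n)|exact: integrableS (vi n)].
  set q := e / _ in hn.
  have q0 : 0 < q by rewrite divr_gt0.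
  have qi : mu.-integrable I (EFin \o (fun z => C * (q * (1 + `|u_ n z|)))).
    do 2 apply: integrableZ_fun => //.
    by apply: integrableD_fun => //; exact: integrable_cst_fun.
  apply: (@le_trans _ _ (\int[mu]_(z in A) (C * (q * (1 + `|u_ n z|))))).
    apply: Rintegral_norm_le => //; first exact: integrableS qi.
    - apply: (integrable_measurable (A := A)); apply: integrableB_fun => //.
        exact: integrableS (vni n n).
      exact: integrableS (vi n).
    - move=> z Az; rewrite -ecoordB; apply: le_trans (hC _ _) _.
      by rewrite ler_wpM2l ?(ltW C0)//; apply: hn; exact: AI.
  apply: (@le_trans _ _ (\int[mu]_(z in I) (C * (q * (1 + `|u_ n z|))))).
    apply: Rintegral_nd_set => // z _.
    by rewrite mulr_ge0 ?(ltW C0)// mulr_ge0 ?(ltW q0)// addr_ge0.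
  have i1 : mu.-integrable I (EFin \o (fun z => 1 + `|u_ n z|)).
    by apply: integrableD_fun => //; exact: integrable_cst_fun.
  rewrite RintegralZl//; last exact: integrableZ_fun.
  rewrite RintegralZl// RintegralD//; last exact: integrable_cst_fun.
  rewrite Rintegral_cst// mul1r.
  have -> : fine (mu I) = T by rewrite lebesgue_measure_0T.
  rewrite mulrCA -[leRHS](divfK (lt0r_neq0 N0)) -/q ler_wpM2l ?(ltW q0)//.
  apply: ler_wpDr => //; rewrite ler_wpM2l ?(ltW C0)// lerD2l.
  exact: le_trans (uM n) (ler_norm _).
have c4 := cvg_sub0 c3 c2.
have c5 : ecoord i (x_ n t) @[n --> F] --> ecoord i xi + \int[mu]_(z in A) ecoord i (velocity x u z).
  by under eq_fun do rewrite xn; apply: cvgD; [exact: cvg_cst|exact: c4].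
by apply: (cvg_unique _ c1 c5); exact: Rhausdorff.
Qed.

End StateEquation.

(** * Growth of the Young integral and coercivity *)

(** A fixed choice of the constant in [norm_le_integral], for use in the definition of the clock. *)
Definition integral_norm_const (R : realType) (E : normedVectType R) : R :=
  s2val (cid2 (@norm_le_integral R E)).

Lemma powR_splitB (R : realType) (y k a : R) : 0 <= y -> 0 < k -> y `^ k = y `^ (k - a) * y `^ a.
Proof. by move=> y0 k0; rewrite -powRD ?subrK// (gt_eqF k0). Qed.

Lemma le_powR_mul (R : realType) (z C y b e : R) : 0 <= z -> 0 <= C -> 0 <= y -> 0 <= e ->
  z <= C * y `^ b -> z `^ e <= C `^ e * y `^ (b * e).
Proof.
move=> z0 C0 y0 e0 h; rewrite powRrM -powRM ?powR_ge0//.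
by apply: ge0_ler_powR; rewrite ?nnegrE ?mulr_ge0 ?powR_ge0.
Qed.

Lemma powR_ge1 (R : realType) (y b : R) : 1 <= y -> 0 <= b -> 1 <= y `^ b.
Proof. by move=> y1 b0; rewrite -[leLHS](powRr0 y); apply: ler_powR. Qed.

Lemma lsum_dist (R : realType) (d : nat) (G H : R -> 'Hom('rV[R]_d, R^o)) (eta : R -> 'rV[R]_d)
    (q y : R) (s : seq R) : (forall z, z \in y :: s -> opnorm (G z - H z) <= q) ->
  `|lsum (fun a b => G a (eta b - eta a)) y s - lsum (fun a b => H a (eta b - eta a)) y s|
    <= q * lsum (fun a b => `|eta b - eta a|) y s.
Proof.
elim: s y => [|z s ih] y hq /=; first by rewrite subrr normr0 mulr0.
rewrite opprD addrACA mulrDr; apply: le_trans (ler_normD _ _) _; apply: lerD.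
  rewrite -opp_lfunE -add_lfunE.
  have h : opnorm (G y - H y) * `|eta z - eta y| <= q * `|eta z - eta y|.
    by rewrite ler_wpM2r// hq// mem_head.
  exact: le_trans (@le_opnorm R _ _ (G y - H y) (eta z - eta y)) h.
by apply: ih => w ws; apply: hq; rewrite inE ws orbT.
Qed.

Lemma lsum_ge0 (R : realType) (H : R -> R -> R) (y : R) s : (forall a b, 0 <= H a b) -> 0 <= lsum H y s.
Proof. by move=> H0; elim: s y => //= z s ih y; rewrite addr_ge0. Qed.

Lemma powR_root (R : realType) (y b : R) : 0 <= y -> 0 < b -> (y `^ b^-1) `^ b = y.
Proof. by move=> y0 b0; rewrite -powRrM mulVf ?gt_eqF// powRr1. Qed.

Section ProcessBounds.
Context {R : realType} {E : normedVectType R}.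
Notation mu := (@lebesgue_measure R).
Variables (T : R) (U : set E) (f : R -> E -> E) (g : R -> E -> 'End(E)).
Hypothesis T0 : 0 < T.
Hypothesis hf : {within [set z : R * E | z.1 \in `[0, T]], continuous (fun z => f z.1 z.2)}.
Hypothesis hg : lfun_continuous_in [set z : R * E | z.1 \in `[0, T]] (fun z => g z.1 z.2).
Variables (r : R) (xi : E) (Cs Ce beta gamma : R).
Hypotheses (r1 : 1 < r) (Cs0 : 0 <= Cs) (Ce0 : 0 <= Ce) (beta0 : 0 <= beta) (gamma0 : 0 <= gamma).
Hypothesis hgrowth : forall u : R -> E, control_class T U r u ->
     forall (x : R -> E) (T1 : R), local_solution T f g xi x u T1 ->
       (Lnorm_itv T1 r (derive1 x)
          <= Cs%:E * (1 + Lnorm_itv T r u `^ beta))%E /\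
       (supnorm_itv T1 x <= Ce%:E * (1 + Lnorm_itv T r u `^ gamma))%E.

Let I : set (measurableTypeR R) := `[0, T]%classic.
Let mI : measurable I. Proof. exact: measurable_itv. Qed.
Let Ifin : (mu I < +oo)%E. Proof. by rewrite (lebesgue_measure_0T T0) ltry. Qed.
Let r0 : 0 < r. Proof. exact: lt_trans r1. Qed.

Definition Lr_norm (u : R -> E) : R := (\int[mu]_(t in I) `|u t| `^ r) `^ r^-1.

Lemma Lr_norm_ge0 (u : R -> E) : 0 <= Lr_norm u.
Proof. exact: powR_ge0. Qed.

Lemma Lr_norm_powR (u : R -> E) : Lr_norm u `^ r = \int[mu]_(t in I) `|u t| `^ r.
Proof.
rewrite /Lr_norm -powRrM mulVf ?gt_eqF// powRr1//.
by apply: Rintegral_ge0 => t _; exact: powR_ge0.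
Qed.

Lemma Lnorm_itvE (u : R -> E) : mu.-integrable I (EFin \o (fun t => `|u t| `^ r)) ->
  Lnorm_itv T r u = (Lr_norm u)%:E.
Proof.
by move=> ui; rewrite /Lnorm_itv /Lr_norm -poweR_EFin /Rintegral fineK//; exact: integrable_fin_num.
Qed.

Lemma Lnorm_itv_le (u : R -> E) (c : R) : measurable_fun I (fun t => `|u t| : R) -> 0 <= c ->
  (Lnorm_itv T r u <= c%:E)%E ->
  mu.-integrable I (EFin \o (fun t => `|u t| `^ r)) /\ \int[mu]_(t in I) `|u t| `^ r <= c `^ r.
Proof.
move=> mun c0 hu.
have i0 : (0 <= \int[mu]_(t in I) (`|u t| `^ r)%:E)%E.
  by apply: integral_ge0 => t _; rewrite lee_fin powR_ge0.
have le1 : (\int[mu]_(t in I) (`|u t| `^ r)%:E <= (c `^ r)%:E)%E.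
  have := hu; rewrite /Lnorm_itv.
  case: (\int[mu]_(t in I) _)%E i0 => [a a0|_|//]; last by rewrite poweRyr ?invr_neq0 ?gt_eqF// leye_eq.
  rewrite poweR_EFin !lee_fin in a0 * => h.
  have : (a `^ r^-1) `^ r <= c `^ r by apply: ge0_ler_powR; rewrite ?nnegrE ?powR_ge0// ltW.
  by rewrite -powRrM mulVf ?gt_eqF// powRr1.
have mur : measurable_fun I (fun t => `|u t| `^ r).
  exact: (measurableT_comp (measurable_powR r) mun).
have ui : mu.-integrable I (EFin \o (fun t => `|u t| `^ r)).
  apply/integrableP; split; first exact/measurable_EFinP.
  apply: le_lt_trans (ltry (c `^ r)); apply: le_trans le1.
  rewrite le_eqVlt; apply/orP; left; apply/eqP; apply: eq_integral => t _ /=.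
  by rewrite ger0_norm ?powR_ge0.
by split => //; move: le1; rewrite -(fineK (integrable_fin_num mI ui)) lee_fin.
Qed.

Lemma control_class_integrable u : measurable_control T u -> (forall t, I t -> U (u t)) ->
  mu.-integrable I (EFin \o (fun t => `|u t| `^ r)) -> control_class T U r u.
Proof.
move=> mu_ Uu ui; split => //; last by rewrite Lnorm_itvE// ltry.
by apply: aeW => t; exact: Uu.
Qed.

Let itv_sub s t : 0 <= s -> t <= T -> `]s, t] `<=` I.
Proof.
by move=> s0 tT z; rewrite /I/= !in_itv/= => /andP[/ltW/(le_trans s0) -> /le_trans]; apply.
Qed.

Let Rintegral_itv_oc1 (s t : R) : s <= t -> \int[mu]_(z in `]s, t]) 1 = t - s.
Proof.
move=> st; rewrite Rintegral_cst//= lebesgue_measure_itv/= lte_fin.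
by case: ltgtP st => // [_ _|-> _]; rewrite ?subrr ?mul1r// mulr0.
Qed.

Let c := integral_norm_const E.
Let c1 : 1 <= c. Proof. exact: s2valP (cid2 (@norm_le_integral R E)). Qed.

(** The summand 1 makes the clock run at least as fast as time; the factor [c], the constant of the
    triangle inequality for integrals, makes it dominate the increments of [x]. *)
Definition clock_rate (x u : R -> E) (t : R) : R := 1 + c * `|velocity f g x u t|.

(* A clock in which t and x(t) are 1-Lipschitz, so that psi(t, x(t)) is Hoelder with
   any exponent at most kappa. *)
Definition clock (x u : R -> E) (t : R) : R :=
  \int[mu]_(s in `[0, Num.min (Num.max t 0) T]) clock_rate x u s.

(** The factor [K = (Cs + 1) (1 + m^beta)] is a positive bound on the L^r norm of the velocity;
    truncation at the level [K] itself bounds the L^1 norm by [(T + 1) K]. *)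
Definition clock_bound (m : R) : R := T + c * ((T + 1) * ((Cs + 1) * (1 + m `^ beta))).

Section Process.
Variables (x u : R -> E).
Hypothesis mu_ : measurable_control T u.
Hypothesis Uu : forall t, I t -> U (u t).
Hypothesis ui : mu.-integrable I (EFin \o (fun t => `|u t| `^ r)).
Hypothesis sol : solution_upto f g T xi x u.

Lemma solution_bounds :
  (Lnorm_itv T r (derive1 x) <= (Cs * (1 + Lr_norm u `^ beta))%:E)%E /\
  forall t, I t -> `|x t| <= Ce * (1 + Lr_norm u `^ gamma).
Proof.
have ls : local_solution T f g xi x u T by split => //; rewrite T0 lexx.
have := hgrowth (control_class_integrable mu_ Uu ui) ls.
rewrite (Lnorm_itvE ui) !poweR_EFin => -[h1 h2]; split => // t It.
rewrite -lee_fin; apply: le_trans h2; apply: ereal_sup_ubound.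
by exists t.
Qed.

Let xc : {within `[0, T], continuous x}.
Proof. by have [xac _ _] := sol; exact: absolutely_continuous_within. Qed.

Lemma control_integrable : mu.-integrable I (EFin \o (fun t => `|u t|)).
Proof. by apply: (Lr_integrable mI Ifin r1) => //; exact: norm_control_measurable. Qed.

Let cui j : mu.-integrable I (EFin \o (fun t => ecoord j (u t))).
Proof.
by apply: ecoord_integrable => //; exact: control_integrable.
Qed.

Lemma velocity_measurable : measurable_fun I (fun t => `|velocity f g x u t|).
Proof.
apply: norm_control_measurable; apply: coord_measurable_control => i.
by apply: integrable_measurable; exact: velocity_integrable.
Qed.
Let mvel := velocity_measurable.

(** The growth hypothesis concerns [derive1 x], which coincides with the velocity off a null set;
    the velocity has the advantage of being visibly measurable. *)
Lemma velocity_Lr : mu.-integrable I (EFin \o (fun t => `|velocity f g x u t| `^ r)) /\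
  \int[mu]_(t in I) `|velocity f g x u t| `^ r <= (Cs * (1 + Lr_norm u `^ beta)) `^ r.
Proof.
apply: Lnorm_itv_le => //; first by rewrite mulr_ge0// addr_ge0// powR_ge0.
have [h1 _] := solution_bounds; apply: le_trans h1.
have [_ _ [N [mN N0 hN]]] := sol.
have NI0 : mu (I `\` (I `\` N)) = 0%E.
  apply: (subset_measure0 _ mN _ N0); last by move=> t [It /not_andP[//|/contrapT]].
  by apply: measurableD => //; exact: measurableD.
have mD : measurable (I `\` N) by exact: measurableD.
rewrite /Lnorm_itv !(integral_ae_subset _ mI mD (@subDsetl _ _ _) NI0).
have eqi : (\int[mu]_(t in I `\` N) (`|velocity f g x u t| `^ r)%:E =
    \int[mu]_(t in I `\` N) (`|derive1 x t| `^ r)%:E)%E.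
  apply: eq_integral => t; rewrite inE => -[It Nt].
  have /contrapT := contra_not (hN t) Nt => /(_ It) [_ dt].
  by rewrite derive1E dt.
by rewrite eqi.
Qed.

Lemma clock_rate_integrable : mu.-integrable I (EFin \o clock_rate x u).
Proof.
apply: integrableD_fun => //; first exact: integrable_cst_fun.
apply: integrableZ_fun => //; apply: (Lr_integrable mI Ifin r1) => //.
by have [] := velocity_Lr.
Qed.

Let rate0 t : 0 <= clock_rate x u t.
Proof. by rewrite addr_ge0// mulr_ge0// (le_trans ler01 c1). Qed.

Lemma clockB s t : 0 <= s -> s <= t -> t <= T ->
  clock x u t - clock x u s = \int[mu]_(z in `]s, t]) clock_rate x u z.
Proof.
move=> s0 st tT; have t0 := le_trans s0 st; have sT := le_trans st tT.
rewrite /clock (max_idPl t0) (max_idPl s0) (min_idPl tT) (min_idPl sT).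
by apply: (@RintegralcB _ T) => //; exact: clock_rate_integrable.
Qed.

(** Clamping the time to [[0, T]] in [clock] gives monotonicity on the whole line, as
    [young_sums_cvg] demands. *)
Lemma clock_nd s t : s <= t -> clock x u s <= clock x u t.
Proof.
move=> st; apply: Rintegral_nd_set => //.
- move=> z /=; rewrite !in_itv/= => /andP[->/= /le_trans]; apply.
  by rewrite le_min !ge_min lexx !orbT andbT; apply/orP; left; rewrite ge_max !le_max st lexx !orbT.
- apply: integrableS clock_rate_integrable => // z; rewrite /I/= !in_itv/= => /andP[->/= /le_trans]; apply.
  by rewrite ge_min lexx orbT.
Qed.

Lemma clock_time s t : 0 <= s -> s <= t -> t <= T -> t - s <= clock x u t - clock x u s.
Proof.
move=> s0 st tT; rewrite clockB//.
have sub : `]s, t] `<=` I by exact: itv_sub.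
have -> : t - s = \int[mu]_(z in `]s, t]) 1.
  by rewrite Rintegral_itv_oc1.
apply: le_Rintegral => //.
- by apply: integrableS (integrable_cst_fun 1 mI Ifin).
- by apply: integrableS clock_rate_integrable.
- by move=> z _; rewrite lerDl mulr_ge0// (le_trans ler01 c1).
Qed.

Lemma clock_dist s t : 0 <= s -> s <= t -> t <= T -> `|x t - x s| <= clock x u t - clock x u s.
Proof.
move=> s0 st tT; rewrite clockB//.
have sub : `]s, t] `<=` I by exact: itv_sub.
have veli : mu.-integrable `]s, t] (EFin \o (fun z => `|velocity f g x u z|)).
  apply: (@integrableS _ _ _ _ I) => //; apply: (Lr_integrable mI Ifin r1) => //.
  by have [] := velocity_Lr.
apply: (@le_trans _ _ (c * \int[mu]_(z in `]s, t]) `|velocity f g x u z|)).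
  apply: (s2valP' (cid2 (@norm_le_integral R E)) _ (velocity f g x u)) => //.
    move=> i; apply: (measurable_funS mI sub); apply: integrable_measurable.
    exact: velocity_integrable.
  by move=> i; rewrite ecoordB; exact: (solution_increment T0 hf hg i mu_ cui sol s0 st tT).
rewrite -RintegralZl//; apply: le_Rintegral => //.
- exact: integrableZ_fun.
- by apply: integrableS clock_rate_integrable.
- by move=> z _; rewrite /clock_rate lerDr.
Qed.

Lemma clock_total : clock x u T - clock x u 0 <= clock_bound (Lr_norm u).
Proof.
rewrite clockB ?lexx ?(ltW T0)//.
have c0 := le_trans ler01 c1.
have [vi vle] := velocity_Lr.
have vI := Lr_integrable mI Ifin r1 mvel (fun _ _ => normr_ge0 _) vi.
apply: (@le_trans _ _ (\int[mu]_(z in I) clock_rate x u z)).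
  apply: Rintegral_nd_set => //; last exact: clock_rate_integrable.
  exact: itv_sub.
rewrite RintegralD//; [|exact: integrable_cst_fun|exact: integrableZ_fun].
rewrite Rintegral_cst// mul1r RintegralZl//.
have muI : fine (mu I) = T by rewrite lebesgue_measure_0T.
rewrite muI lerD2l ler_wpM2l//.
set K := (Cs + 1) * (1 + Lr_norm u `^ beta).
have K0 : 0 < K by apply: mulr_gt0; [rewrite ltr_wpDl|rewrite ltr_pwDl// powR_ge0].
apply: le_trans (Lr_integral_le mI Ifin r1 mvel _ vi mI (@subset_refl _ _) K0) _ => //.
rewrite muI mulrDl mul1r mulrC lerD2l.
apply: (@le_trans _ _ (K `^ (1 - r) * K `^ r)).
  rewrite ler_wpM2l ?powR_ge0//; apply: le_trans vle _.
  apply: ge0_ler_powR; rewrite ?nnegrE ?(ltW r0) ?(ltW K0)//.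
    by rewrite mulr_ge0// addr_ge0// powR_ge0.
  by rewrite /K ler_wpM2r ?lerDl// addr_ge0// powR_ge0.
by rewrite -powRD ?subrK ?powRr1 ?(ltW K0)// (gt_eqF K0) implybT.
Qed.

End Process.

(** The velocities are bounded in L^r, hence equi-integrable. This yields the equicontinuity of the
    states and one dissection that is fine for all clocks; a constant sequence gives the continuity
    of a single clock. *)
Lemma clock_equicontinuous (x_ u_ : nat -> R -> E) (M : R) :
  (forall n, measurable_control T (u_ n)) -> (forall n t, I t -> U (u_ n t)) ->
  (forall n, mu.-integrable I (EFin \o (fun t => `|u_ n t| `^ r))) ->
  (forall n, solution_upto f g T xi (x_ n) (u_ n)) -> (forall n, Lr_norm (u_ n) <= M) ->
  forall e : R, 0 < e -> exists2 del : R, 0 < del &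
    forall n s t, 0 <= s -> s <= t -> t <= T -> t - s < del ->
      clock (x_ n) (u_ n) t - clock (x_ n) (u_ n) s <= e.
Proof.
move=> mu_ Uu ui sol uM e e0.
have c0 : 0 < c := lt_le_trans ltr01 c1.
have vL n := velocity_Lr (mu_ n) (Uu n) (ui n) (sol n).
have mv n : measurable_fun I (fun t => `|velocity f g (x_ n) (u_ n) t|).
  exact: velocity_measurable (sol n).
pose M' := (Cs * (1 + M `^ beta)) `^ r.
have vM n : \int[mu]_(t in I) `|velocity f g (x_ n) (u_ n) t| `^ r <= M'.
  apply: le_trans (vL n).2 _; apply: ge0_ler_powR; rewrite ?nnegrE ?(ltW r0)//.
  - by rewrite mulr_ge0// addr_ge0// powR_ge0.
  - by rewrite mulr_ge0// addr_ge0// powR_ge0.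
  - rewrite ler_wpM2l// lerD2l; apply: ge0_ler_powR => //; rewrite nnegrE.
      exact: Lr_norm_ge0.
    exact: le_trans (Lr_norm_ge0 _) (uM n).
have e2 : 0 < e / 2 / c by rewrite !divr_gt0.
have [del del0 hdel] := @Lr_equi_integrable _ _ _ _ M' (fun n t => `|velocity f g (x_ n) (u_ n) t|) mI Ifin r1
  mv (fun _ _ _ => normr_ge0 _) (fun n => (vL n).1) vM _ e2.
exists (Num.min del (e / 2)) => [|n s t s0 st tT]; first by rewrite lt_min del0 divr_gt0.
rewrite lt_min => /andP[ts1 ts2].
have sub : `]s, t] `<=` I by exact: itv_sub.
have must : mu (`]s, t]%classic : set (measurableTypeR R)) = (t - s)%:E.
  rewrite lebesgue_measure_itv/= lte_fin EFinB.
  by case: ltgtP st => // -> _; rewrite subee.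
have vI : mu.-integrable `]s, t] (EFin \o (fun z => `|velocity f g (x_ n) (u_ n) z|)).
  apply: (@integrableS _ _ _ _ I) => //; apply: (Lr_integrable mI Ifin r1) => //.
  by have [] := vL n.
rewrite (clockB (mu_ n) (Uu n) (ui n) (sol n))// RintegralD//; last 2 first.
- by apply: integrable_cst_fun => //; rewrite must ltry.
- exact: integrableZ_fun.
rewrite Rintegral_itv_oc1// RintegralZl//.
have := hdel n `]s, t]%classic (measurable_itv _) sub.
rewrite must lte_fin => /(_ ts1).
rewrite ltr_pdivlMr// mulrC => h.
have -> : e = e / 2 + e / 2 by rewrite -splitr.
by apply: lerD; exact: ltW.
Qed.

Lemma clock_bound_gt0 m : 0 < clock_bound m.
Proof.
rewrite /clock_bound ltr_pwDl// mulr_ge0 ?(le_trans ler01 c1)//.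
by rewrite !mulr_ge0 ?addr_ge0 ?(ltW T0)// powR_ge0.
Qed.

(** * The Young integral of a process: growth, limits and coercivity *)

Section YoungCost.
Variables (d : nat) (psi : R -> E -> 'Hom('rV[R]_d, R^o)) (kappa Cpsi alpha : R).
Hypotheses (kappa2 : 2^-1 < kappa) (Cpsi0 : 0 <= Cpsi) (alpha0 : 0 <= alpha).
Hypothesis hpsi : forall rho : R, 0 <= rho ->
     exists2 K : R, K <= Cpsi * (1 + rho `^ alpha) &
       forall (s t : R) (x y : E), s \in `[0, T] -> t \in `[0, T] ->
         `|x| <= rho -> `|y| <= rho ->
         opnorm (psi t x - psi s y)
           <= K * (`|t - s| `^ kappa + `|x - y| `^ kappa).
Hypothesis hexp1 : gamma * (alpha + kappa - 2^-1) + beta / 2 < r.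
Variable eta : R -> 'rV[R]_d.
Hypothesis heta : observation_path T eta.

Lemma pvariation_lsum p : 2 < p -> exists2 B : R, 0 < B & forall s, itv_partition 0 T s ->
  lsum (fun y z => `|eta z - eta y| `^ p) 0 s <= B.
Proof.
move=> p2; have p0 : 0 < p by apply: lt_trans p2.
have := heta.2 p p2; rewrite /pvariation.
set S := [set _ | _ in _] => hS.
have Slt : (ereal_sup S < +oo)%E.
  rewrite ltey; apply/eqP => Sy; move: hS; rewrite Sy poweRyr ?ltxx//.
  by rewrite invr_neq0// gt_eqF.
exists (`|fine (ereal_sup S)| + 1) => [|s ps]; first by rewrite ltr_pwDr.
have Ss : S (lsum (fun y z => `|eta z - eta y| `^ p) 0 s)%:E.
  by exists s => //; rewrite -(lsum_knot _ T).
have le1 := ereal_sup_ubound Ss.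
have Sfin : ereal_sup S \is a fin_num.
  rewrite fin_numElt Slt andbT; apply: lt_le_trans le1; exact: ltNyr.
rewrite -(fineK Sfin) lee_fin in le1; apply: le_trans le1 _.
by apply: le_trans (ler_norm _) _; rewrite lerDl.
Qed.

Definition sup_bound (m : R) : R := Ce * (1 + m `^ gamma).

(** Lowering the exponent from [kappa] to [a] costs the power [kappa - a] of the largest possible
    increment: [T] for the time, twice the bound on the state for [x]. *)
Definition holder_bound (a m : R) : R := Cpsi * (1 + sup_bound m `^ alpha) *
  (T `^ (kappa - a) + (2 * sup_bound m) `^ (kappa - a)).

Let kappa0 : 0 < kappa. Proof. by apply: lt_trans kappa2; rewrite invr_gt0. Qed.

Lemma sup_bound_ge0 m : 0 <= sup_bound m.
Proof. by rewrite mulr_ge0// addr_ge0// powR_ge0. Qed.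

Lemma holder_bound_ge0 a m : 0 <= holder_bound a m.
Proof. by rewrite !mulr_ge0// ?addr_ge0// powR_ge0. Qed.

Lemma psi_lipschitz_bound rho s t y z : 0 <= rho -> s \in `[0, T] -> t \in `[0, T] ->
  `|y| <= rho -> `|z| <= rho ->
  opnorm (psi t y - psi s z) <= Cpsi * (1 + rho `^ alpha) * (`|t - s| `^ kappa + `|y - z| `^ kappa).
Proof.
move=> rho0 Is It yr zr; have [K KC hK] := hpsi rho0.
by apply: le_trans (hK _ _ _ _ Is It yr zr) _; rewrite ler_wpM2r// addr_ge0// powR_ge0.
Qed.

Lemma integrand_holder (x : R -> E) (V : R -> R) (a m : R) : 0 < a -> a <= kappa ->
  (forall t, I t -> `|x t| <= sup_bound m) ->
  (forall s t, 0 <= s -> s <= t -> t <= T -> t - s <= V t - V s) ->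
  (forall s t, 0 <= s -> s <= t -> t <= T -> `|x t - x s| <= V t - V s) ->
  forall s t, 0 <= s -> s <= t -> t <= T ->
    opnorm (psi t (x t) - psi s (x s)) <= holder_bound a m * (V t - V s) `^ a.
Proof.
move=> a0 ak xr Vt Vx s t s0 st tT.
have Is : s \in `[0, T] by rewrite in_itv/= s0 (le_trans st).
have It : t \in `[0, T] by rewrite in_itv/= tT (le_trans s0).
apply: le_trans (psi_lipschitz_bound (sup_bound_ge0 m) Is It (xr t It) (xr s Is)) _.
rewrite /holder_bound -[leRHS]mulrA ler_wpM2l//.
  by rewrite mulr_ge0// addr_ge0// powR_ge0.
have ka : 0 <= kappa - a by rewrite subr_ge0.
have ts0 : 0 <= t - s by rewrite subr_ge0.
have V0 : 0 <= V t - V s by apply: le_trans ts0 _; exact: Vt.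
rewrite mulrDl; apply: lerD.
  rewrite ger0_norm// (powR_splitB a ts0 kappa0).
  apply: ler_pM; rewrite ?powR_ge0//; apply: ge0_ler_powR; rewrite ?nnegrE ?(ltW a0) ?(ltW T0)//.
    by rewrite lerBlDr ler_wpDr.
  exact: Vt.
rewrite (powR_splitB a (normr_ge0 _) kappa0).
apply: ler_pM; rewrite ?powR_ge0//; apply: ge0_ler_powR; rewrite ?nnegrE ?(ltW a0)//.
- by rewrite mulr_ge0// sup_bound_ge0.
- apply: le_trans (ler_normB _ _) _; rewrite mulrDl mul1r; apply: lerD; exact: xr.
- exact: Vx.
Qed.

Lemma sup_bound_le m m' : 0 <= m -> m <= m' -> sup_bound m <= sup_bound m'.
Proof.
move=> m0 mm; rewrite ler_wpM2l// lerD2l; apply: ge0_ler_powR; rewrite ?nnegrE//.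
exact: le_trans mm.
Qed.

Lemma clock_bound_le m m' : 0 <= m -> m <= m' -> clock_bound m <= clock_bound m'.
Proof.
move=> m0 mm; rewrite lerD2l ler_wpM2l ?(le_trans ler01 c1)// ler_wpM2l ?addr_ge0 ?(ltW T0)//.
rewrite ler_wpM2l ?addr_ge0// lerD2l; apply: ge0_ler_powR; rewrite ?nnegrE//.
exact: le_trans mm.
Qed.

(** An arbitrary upper bound [m] of the control norm is allowed, so that the same estimate holds
    along a bounded sequence. *)
Lemma young_estimate : exists a, [/\ 2^-1 < a, a <= kappa, gamma * (alpha + kappa - a) + beta * a < r &
  exists2 K : R, 0 <= K & exists sg : R, [/\ 0 < sg, sg <= a &
    forall (x u : R -> E) (m : R), measurable_control T u -> (forall t, I t -> U (u t)) ->
      mu.-integrable I (EFin \o (fun t => `|u t| `^ r)) -> solution_upto f g T xi x u ->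
      Lr_norm u <= m ->
      exists2 l, is_young_integral T (fun t => psi t (x t)) eta l &
        forall e s, 0 <= e -> itv_partition 0 T s -> fine_dissection T (clock x u) e s ->
          `|ysum (fun t => psi t (x t)) eta s - l| <=
             holder_bound a m * K * (e `^ sg * clock_bound m `^ (a - sg))]].
Proof.
have := hexp1; set rho0 := gamma * _ + _ => rho0r.
(* The three terms keep [a = 1/2 + ep] at most [kappa], at most 1, and the growth exponent below
   [r]: beyond [a = 1/2] that exponent increases at a rate of at most [beta]. *)
pose ep := Num.min (kappa - 2^-1) (Num.min 2^-1 ((r - rho0) / (beta + 1))).
have b1 : 0 < beta + 1 by rewrite ltr_wpDl.
have ep0 : 0 < ep by rewrite !lt_min subr_gt0 kappa2 invr_gt0 ltr0n/= divr_gt0// subr_gt0.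
have epk : ep <= kappa - 2^-1 by rewrite ge_min lexx.
have ep2 : ep <= 2^-1 by rewrite !ge_min lexx !orbT.
have epr : ep <= (r - rho0) / (beta + 1) by rewrite !ge_min lexx !orbT.
pose a := 2^-1 + ep.
have a2 : 2^-1 < a by rewrite ltrDl.
have a0 : 0 < a by apply: lt_trans a2; rewrite invr_gt0.
have ak : a <= kappa by rewrite /a addrC -lerBrDr.
have ar : gamma * (alpha + kappa - a) + beta * a < r.
  have h1 : (beta + 1) * ep <= r - rho0 by rewrite mulrC -ler_pdivlMr.
  have h2 : 0 <= gamma * ep by rewrite mulr_ge0// ltW.
  have -> : gamma * (alpha + kappa - a) + beta * a = rho0 - gamma * ep + beta * ep.
    by rewrite /a /rho0; ring.
  by move: h1; rewrite mulrDl mul1r; lra.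
exists a; split => //.
(* This is [1/p], the midpoint of [1 - a] and [1/2]; hence [p > 2] and [a + 1/p > 1]. *)
pose pi := (3 / 2 - a) / 2.
have pi0 : 0 < pi by rewrite /pi /a; move: ep2; lra.
have pi2 : pi < 2^-1 by rewrite /pi; move: a2; lra.
have p2 : 2 < pi^-1 by rewrite -[ltLHS]invrK ltf_pV2 ?posrE ?invr_gt0.
have p1 : 1 < pi^-1 by apply: lt_trans p2; rewrite ltr1n.
have ap : 1 < a + pi^-1^-1 by rewrite invrK /pi; move: a2; lra.
have [B B0 hB] := pvariation_lsum p2.
have [K K0 [sg [sg0 sga hK]]] := young_sums_cvg T0 p1 B0 ap hB.
exists K => //; exists sg; split => // x u m mu_ Uu ui sol um.
have Ln0 := Lr_norm_ge0 u.
apply: hK => //.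
- exact: holder_bound_ge0.
- exact: clock_bound_gt0.
- exact: clock_nd mu_ Uu ui sol.
- exact: le_trans (clock_total mu_ Uu ui sol) (clock_bound_le Ln0 um).
- apply: integrand_holder => //.
  + move=> t It; apply: le_trans (sup_bound_le Ln0 um).
    by have [_] := solution_bounds mu_ Uu ui sol; apply.
  + exact: clock_time mu_ Uu ui sol.
  + exact: clock_dist mu_ Uu ui sol.
- move=> e e0.
  have [del del0 hdel] := @clock_equicontinuous (fun=> x) (fun=> u) _
    (fun=> mu_) (fun=> Uu) (fun=> ui) (fun=> sol) (fun=> lexx _) _ e0.
  by exists del => // s t; exact: hdel 0%N s t.
Qed.

(** The integral is compared with the sum over the one-interval dissection, which involves only [xi]
    and [eta]. With [e] the full clock bound, the error is [K] times [holder_bound] times the power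
    [a] of the clock bound, and the exponents of [1 + |u|_r] add up to [rho]. *)
Lemma young_growth : exists2 C : R, 0 <= C & exists2 rho : R, 0 <= rho < r &
  forall x u : R -> E, measurable_control T u -> (forall t, I t -> U (u t)) ->
    mu.-integrable I (EFin \o (fun t => `|u t| `^ r)) -> solution_upto f g T xi x u ->
    young_integrable T (fun t => psi t (x t)) eta /\
    `|young_integral T (fun t => psi t (x t)) eta| <= C * (1 + Lr_norm u) `^ rho.
Proof.
have [a [a2 ak ar [K K0 [sg [sg0 sga hK]]]]] := young_estimate.
have a0 : 0 < a by apply: lt_trans a2; rewrite invr_gt0.
have ka : 0 <= kappa - a by rewrite subr_ge0.
have c0 := le_trans ler01 c1.
pose X1 := Ce * 2; pose A1 := T + c * ((T + 1) * ((Cs + 1) * 2)).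
have X10 : 0 <= X1 by rewrite mulr_ge0.
have A10 : 0 <= A1 by rewrite addr_ge0 ?(ltW T0)// !mulr_ge0// addr_ge0 ?(ltW T0).
pose H1 := Cpsi * (1 + X1 `^ alpha) * (T `^ (kappa - a) + (2 * X1) `^ (kappa - a)).
have H10 : 0 <= H1 by rewrite !mulr_ge0// ?addr_ge0// powR_ge0.
pose D0 := opnorm (psi 0 xi) * `|eta T - eta 0|.
have D00 : 0 <= D0 by rewrite mulr_ge0// opnorm_ge0.
pose rho := gamma * (alpha + kappa - a) + beta * a.
have rho0 : 0 <= rho.
  by rewrite /rho addr_ge0// mulr_ge0// ?(ltW a0)// -addrA addr_ge0.
exists (D0 + H1 * K * A1 `^ a); first by apply: addr_ge0 => //; apply: mulr_ge0; [exact: mulr_ge0|exact: powR_ge0].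
exists rho; first by rewrite rho0.
move=> x u mu_ Uu ui sol.
have [l hl hsum] := hK x u _ mu_ Uu ui sol (lexx _).
split; first by exists l.
rewrite (young_integralE T0 hl).
set m := Lr_norm u in hsum *.
have m0 : 0 <= m by exact: Lr_norm_ge0.
pose y := 1 + m.
have y1 : 1 <= y by rewrite lerDl.
have y0 : 0 < y := lt_le_trans ltr01 y1.
have my : m <= y by rewrite lerDr.
have one_m b : 0 <= b -> 1 + m `^ b <= 2 * y `^ b.
  move=> b0; rewrite mulrDl mul1r; apply: lerD; first exact: powR_ge1.
  by apply: ge0_ler_powR; rewrite ?nnegrE// ltW.
have hX : sup_bound m <= X1 * y `^ gamma.
  by rewrite /sup_bound /X1 -mulrA ler_wpM2l// one_m.
have hA : clock_bound m <= A1 * y `^ beta.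
  rewrite /clock_bound /A1 [leRHS]mulrDl; apply: lerD.
    by rewrite ler_peMr ?(ltW T0)// powR_ge1.
  rewrite -!mulrA ler_wpM2l// ler_wpM2l ?addr_ge0 ?(ltW T0)// ler_wpM2l ?addr_ge0//.
  exact: one_m.
have hH : holder_bound a m <= H1 * (y `^ (gamma * alpha) * y `^ (gamma * (kappa - a))).
  rewrite /holder_bound /H1 [leRHS]mulrACA; apply: ler_pM.
  - by rewrite mulr_ge0// addr_ge0// powR_ge0.
  - by rewrite addr_ge0// powR_ge0.
  - rewrite -mulrA ler_wpM2l// mulrDl mul1r; apply: lerD.
      by rewrite powR_ge1// mulr_ge0.
    by apply: le_powR_mul => //; [exact: sup_bound_ge0|exact: ltW].
  - rewrite [leRHS]mulrDl; apply: lerD.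
      by rewrite ler_peMr ?powR_ge0// powR_ge1// mulr_ge0.
    apply: le_powR_mul => //; [|by rewrite mulr_ge0|exact: ltW|].
      by rewrite mulr_ge0// sup_bound_ge0.
    by rewrite -mulrA ler_wpM2l.
have hAa : clock_bound m `^ a <= A1 `^ a * y `^ (beta * a).
  by apply: le_powR_mul => //; rewrite ?(ltW (clock_bound_gt0 m)) ?(ltW y0)// ltW.
have pT : itv_partition 0 T [:: T] by split; rewrite /= ?T0 ?eqxx.
have fT : fine_dissection T (clock x u) (clock_bound m) [:: T].
  by move=> [|i]//= _; exact: clock_total mu_ Uu ui sol.
have := hsum _ _ (ltW (clock_bound_gt0 m)) pT fT.
rewrite -powRD ?subrKC ?(gt_eqF (clock_bound_gt0 m)) ?implybT//.
set S := ysum _ _ _ => hS.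
have S0 : `|S| <= D0.
  rewrite /S /ysum /= addr0; have [_ -> _] := sol; exact: le_opnorm.
have hl1 : `|l| <= D0 + holder_bound a m * K * clock_bound m `^ a.
  have -> : l = S - (S - l) by rewrite opprB addrC subrK.
  by apply: le_trans (ler_normB _ _) _; exact: lerD.
apply: le_trans hl1 _; rewrite mulrDl; apply: lerD.
  by rewrite ler_peMr// powR_ge1.
have -> : y `^ rho = y `^ (gamma * alpha) * y `^ (gamma * (kappa - a)) * y `^ (beta * a).
  rewrite -!powRD ?(gt_eqF y0) ?implybT//; congr (_ `^ _); rewrite /rho; ring.
move: hH hAa; set P := y `^ (gamma * alpha) * _; set Q := y `^ _; set A1a := A1 `^ a => hH hAa.
have -> : H1 * K * A1a * (P * Q) = H1 * P * K * (A1a * Q) by ring.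
apply: ler_pM => //; [exact: mulr_ge0 (holder_bound_ge0 _ _) K0|exact: powR_ge0|by rewrite ler_wpM2r].
Qed.

(** Equicontinuity of the clocks provides one dissection on which all sums are [e / 4]-close to
    their integrals; there the sums converge, because [psi] is Hoelder on a ball containing all
    states. *)
Lemma young_limit (F : set_system nat) (x_ u_ : nat -> R -> E) (x u : R -> E) (M : R) : Filter F ->
  (forall n, measurable_control T (u_ n)) -> (forall n t, I t -> U (u_ n t)) ->
  (forall n, mu.-integrable I (EFin \o (fun t => `|u_ n t| `^ r))) ->
  (forall n, solution_upto f g T xi (x_ n) (u_ n)) -> (forall n, Lr_norm (u_ n) <= M) ->
  measurable_control T u -> (forall t, I t -> U (u t)) ->
  mu.-integrable I (EFin \o (fun t => `|u t| `^ r)) ->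
  solution_upto f g T xi x u -> Lr_norm u <= M ->
  (forall e : R, 0 < e -> \forall n \near F, forall t, I t -> `|x_ n t - x t| < e) ->
  young_integral T (fun t => psi t (x_ n t)) eta @[n --> F] -->
    young_integral T (fun t => psi t (x t)) eta.
Proof.
move=> FF mun Uun uin soln unM mu_ Uu ui sol uM xu.
have [a [a2 ak ar [K K0 [sg [sg0 sga hK]]]]] := young_estimate.
have [l hl lsums] := hK x u M mu_ Uu ui sol uM.
have [l_ hl_] := choice (fun n =>
  let: ex_intro2 l h1 h2 := hK (x_ n) (u_ n) M (mun n) (Uun n) (uin n) (soln n) (unM n) in
  ex_intro _ l (conj h1 h2)).
rewrite (young_integralE T0 hl).
have -> : (fun n => young_integral T (fun t => psi t (x_ n t)) eta) = l_.
  by apply/funext => n; rewrite (young_integralE T0 (hl_ n).1).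
apply/cvgrPdist_lt => e e0.
have M0 : 0 <= M := le_trans (Lr_norm_ge0 _) uM.
pose h := holder_bound a M * K * clock_bound M `^ (a - sg).
have h0 : 0 <= h by rewrite /h; apply: mulr_ge0; [apply: mulr_ge0 => //; exact: holder_bound_ge0|exact: powR_ge0].
have e40 : 0 < e / 4 by rewrite divr_gt0.
have h10 : 0 < h + 1 by rewrite ltr_wpDl.
pose e' := (e / 4 / (h + 1)) `^ sg^-1.
have q0 : 0 < e / 4 / (h + 1) by rewrite divr_gt0.
have e'0 : 0 < e' by rewrite powR_gt0.
have he' : holder_bound a M * K * (e' `^ sg * clock_bound M `^ (a - sg)) <= e / 4.
  rewrite /e' powR_root ?(ltW q0)// mulrCA -/h mulrAC ler_pdivrMr// ler_wpM2l ?(ltW e40)//.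
  by rewrite lerDl.
have [d1 d10 hd1] := clock_equicontinuous mun Uun uin soln unM e'0.
have [d2 d20 hd2] := @clock_equicontinuous (fun=> x) (fun=> u) _
    (fun=> mu_) (fun=> Uu) (fun=> ui) (fun=> sol) (fun=> lexx _) _ e'0.
have d0 : 0 < Num.min d1 d2 by rewrite lt_min d10.
have [s ps fs] := fine_dissection_exists T0 d0.
have [ps1 /eqP ps2] := ps.
have sI z : z \in 0 :: s -> z \in `[0, T].
  by move=> zs; rewrite in_itv/= (path_lt_head ps1 zs) -ps2 (path_lt_last ps1 zs).
have knotS i : (i < size s)%N -> [/\ 0 <= knot T s i, knot T s i <= knot T s i.+1 & knot T s i.+1 <= T].
  move=> is_; have := sI _ (@mem_nth _ T (0 :: s) i (leqW is_)).
  have := sI _ (@mem_nth _ T (0 :: s) i.+1 is_).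
  rewrite !in_itv/= => /andP[_ ?] /andP[? _]; split => //.
  by have /(pathP T)/(_ i is_)/ltW := ps1.
have fine1 n : fine_dissection T (clock (x_ n) (u_ n)) e' s.
  move=> i is_; have [k0 kk kT] := knotS i is_; apply: hd1 => //.
  by apply: lt_le_trans (fs i is_) _; rewrite ge_min lexx.
have fine2 : fine_dissection T (clock x u) e' s.
  move=> i is_; have [k0 kk kT] := knotS i is_; apply: (hd2 0%N) => //.
  by apply: lt_le_trans (fs i is_) _; rewrite ge_min lexx orbT.
pose L := lsum (fun y z => `|eta z - eta y|) 0 s.
have L0 : 0 <= L by exact: lsum_ge0.
pose Cp := Cpsi * (1 + sup_bound M `^ alpha).
have Cp0 : 0 <= Cp by rewrite /Cp; apply: mulr_ge0 => //; rewrite addr_ge0// powR_ge0.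
have CL0 : 0 < Cp * L + 1 by rewrite ltr_wpDl// mulr_ge0.
have q1 : 0 < e / 4 / (Cp * L + 1) by rewrite divr_gt0.
have e''0 : 0 < (e / 4 / (Cp * L + 1)) `^ kappa^-1 by rewrite powR_gt0.
have xb n t : I t -> `|x_ n t| <= sup_bound M.
  move=> It; apply: le_trans (sup_bound_le (Lr_norm_ge0 _) (unM n)).
  by have [_] := solution_bounds (mun n) (Uun n) (uin n) (soln n); apply.
have xb' t : I t -> `|x t| <= sup_bound M.
  move=> It; apply: le_trans (sup_bound_le (Lr_norm_ge0 _) uM).
  by have [_] := solution_bounds mu_ Uu ui sol; apply.
apply: filterS (xu _ e''0) => n hn.
have s1 := (hl_ n).2 _ _ (ltW e'0) ps (fine1 n).
have s2 := lsums _ _ (ltW e'0) ps fine2.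
have s3 : `|ysum (fun t => psi t (x_ n t)) eta s - ysum (fun t => psi t (x t)) eta s| <= e / 4.
  apply: le_trans (@lsum_dist _ _ _ _ eta (Cp * (e / 4 / (Cp * L + 1))) 0 s _) _.
    move=> z /sI Iz; apply: le_trans (psi_lipschitz_bound (sup_bound_ge0 M) Iz Iz (xb n z Iz) (xb' z Iz)) _.
    rewrite -/Cp ler_wpM2l// subrr normr0 powR0 ?gt_eqF// add0r.
    rewrite -[leRHS](powR_root (ltW q1) kappa0).
    by apply: ge0_ler_powR; rewrite ?nnegrE ?powR_ge0 ?(ltW kappa0)//; exact/ltW/hn.
  rewrite -/L mulrAC mulrA ler_pdivrMr// mulrC ler_wpM2l ?(ltW e40)//.
  by rewrite lerDl.
have -> : l - l_ n = (ysum (fun t => psi t (x_ n t)) eta s - l_ n)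
    - (ysum (fun t => psi t (x t)) eta s - l)
    - (ysum (fun t => psi t (x_ n t)) eta s - ysum (fun t => psi t (x t)) eta s) by ring.
apply: le_lt_trans (ler_normB _ _) _.
have := ler_normB (ysum (fun t => psi t (x_ n t)) eta s - l_ n) (ysum (fun t => psi t (x t)) eta s - l).
move: (le_trans s1 he') (le_trans s2 he') s3 e0.
move: (`|ysum (fun t => psi t (x_ n t)) eta s - l_ n|) `|_ - l| `|ysum _ _ _ - ysum _ _ _| `|_ - (_ - l)|.
move=> b1 b2 b3 b4; lra.
Qed.

Lemma cost_coercive (phi : R -> E -> E -> R) (Cphi delta : R) : 0 < Cphi -> 0 < delta ->
  (forall (t : R) (x u : E), t \in `[0, T] -> U u ->
     Cphi * (`|u| `^ r - `|x| `^ delta) <= phi t x u) ->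
  gamma * delta < r ->
  exists2 k : R, 0 < k & exists D : R, forall x u : R -> E,
    measurable_control T u -> (forall t, I t -> U (u t)) ->
    mu.-integrable I (EFin \o (fun t => `|u t| `^ r)) -> solution_upto f g T xi x u ->
    mu.-integrable I (EFin \o (fun t => phi t (x t) (u t))) ->
    k * \int[mu]_(t in I) `|u t| `^ r - D <=
      \int[mu]_(t in I) phi t (x t) (u t) + young_integral T (fun t => psi t (x t)) eta.
Proof.
move=> Cphi0 delta0 coercive hexp2.
have [C C0 [rho /andP[rho0 rhor] hY]] := young_growth.
(* Dominates the growth exponents of the Young integral and of [|x|^delta], both below [r]; the term
   [r / 2] makes it positive. *)
pose s := Num.max rho (Num.max (gamma * delta) (r / 2)).
have s0 : 0 < s by rewrite !lt_max [X in _ || (_ || X)]divr_gt0// !orbT.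
have sr : s < r.
  by rewrite !gt_max rhor hexp2/= ltr_pdivrMr// ltr_pMr// ltr1n.
have q1 : 1 < r / s by rewrite ltr_pdivlMr// mul1r.
pose X1 := Ce * 2.
have X10 : 0 <= X1 by rewrite mulr_ge0.
pose B := C + Cphi * T * X1 `^ delta.
have B0 : 0 <= B.
  by rewrite /B addr_ge0// !mulr_ge0 ?powR_ge0 ?(ltW T0)// ltW.
have B20 : 0 <= B * 2 `^ r by rewrite mulr_ge0// powR_ge0.
have Cp2 : 0 < Cphi / 2 by rewrite divr_gt0.
(* With this [K], the lower-order terms [B y^s] use up half of the coercive term, plus a
   constant. *)
have [K K1 hK] := powR_small q1 B20 Cp2.
have K0 : 0 < K := lt_le_trans ltr01 K1.
exists (Cphi / 2) => //; exists (B * K + Cphi / 2) => x u mu_ Uu ui sol phii.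
have [_ hy] := hY x u mu_ Uu ui sol.
rewrite -Lr_norm_powR; set m := Lr_norm u in hy *.
have m0 : 0 <= m by exact: Lr_norm_ge0.
set y := 1 + m in hy.
have y1 : 1 <= y by rewrite lerDl.
have y0 : 0 < y := lt_le_trans ltr01 y1.
have hyr : y `^ r <= 2 `^ r * (1 + m `^ r).
  apply: (@le_trans _ _ ((2 * Num.max 1 m) `^ r)).
    apply: ge0_ler_powR; rewrite ?nnegrE ?(ltW r0) ?(ltW y0)//.
      by rewrite mulr_ge0// le_max ler01.
    by rewrite mulrDl mul1r; apply: lerD; rewrite le_max lexx ?orbT.
  rewrite powRM ?le_max ?ler01// ler_wpM2l ?powR_ge0//.
  by case: (leP 1 m) => _; rewrite ?powR1 ?lerDl ?lerDr// powR_ge0.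
have hys : y `^ s <= K + K `^ (1 - r / s) * y `^ r.
  have := le_powR_add K0 q1 (powR_ge0 y s).
  have sE : s * (r / s) = r by rewrite mulrC divfK// gt_eqF.
  by rewrite -powRrM sE.
have hB : B * y `^ s <= B * K + Cphi / 2 * (1 + m `^ r).
  apply: (@le_trans _ _ (B * (K + K `^ (1 - r / s) * (2 `^ r * (1 + m `^ r))))).
    rewrite ler_wpM2l//; apply: le_trans hys _.
    by rewrite lerD2l ler_wpM2l// powR_ge0.
  rewrite mulrDr lerD2l.
  have -> : B * (K `^ (1 - r / s) * (2 `^ r * (1 + m `^ r))) =
    K `^ (1 - r / s) * (B * 2 `^ r) * (1 + m `^ r) by ring.
  by rewrite ler_wpM2r// addr_ge0// powR_ge0.
have hphi : Cphi * (m `^ r - T * (X1 `^ delta * y `^ s)) <= \int[mu]_(t in I) phi t (x t) (u t).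
  have ci : mu.-integrable I (EFin \o (fun=> X1 `^ delta * y `^ s)) by exact: integrable_cst_fun.
  have -> : Cphi * (m `^ r - T * (X1 `^ delta * y `^ s)) =
     \int[mu]_(t in I) (Cphi * (`|u t| `^ r - X1 `^ delta * y `^ s)).
    rewrite RintegralZl//; last exact: integrableB_fun.
    rewrite RintegralB// Rintegral_cst// /m Lr_norm_powR [X in _ = _ * (_ - X)]mulrC.
    by have -> : fine (mu I) = T by rewrite lebesgue_measure_0T.
  apply: le_Rintegral => //; first by apply: integrableZ_fun => //; exact: integrableB_fun.
  move=> t It; apply: le_trans (coercive t (x t) (u t) It (Uu t It)).
  rewrite ler_wpM2l ?(ltW Cphi0)// lerD2l lerN2.
  have [_ /(_ t It) xb] := solution_bounds mu_ Uu ui sol.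
  apply: (@le_trans _ _ (X1 `^ delta * y `^ (gamma * delta))).
    apply: le_powR_mul => //; rewrite ?(ltW y0) ?(ltW delta0)//.
    apply: le_trans xb _; rewrite /X1 -mulrA ler_wpM2l//.
    rewrite mulrDl mul1r; apply: lerD; first exact: powR_ge1.
    by apply: ge0_ler_powR; rewrite ?nnegrE ?(ltW y0)// lerDr.
  by rewrite ler_wpM2l ?powR_ge0//; apply: ler_powR => //; rewrite !le_max lexx !orbT.
have hys2 : y `^ rho <= y `^ s by apply: ler_powR => //; rewrite le_max lexx.
have := ler_normlW hy; move: hy; rewrite ler_norml => /andP[hy1 _] _.
have hC : C * y `^ rho <= C * y `^ s by rewrite ler_wpM2l.
move: hB hphi; rewrite /B.
have -> : (C + Cphi * T * X1 `^ delta) * y `^ s = C * y `^ s + Cphi * (T * (X1 `^ delta * y `^ s)).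
  by ring.
move: hy1 hC; rewrite mulrBr mulrDr mulr1.
move: (young_integral _ _ _) (C * y `^ rho) (C * y `^ s) (Cphi * (T * _)) (_ * K) (\int[mu]_(t in I) _).
have -> : Cphi / 2 * m `^ r = Cphi * m `^ r / 2 by rewrite mulrAC.
move: (Cphi * m `^ r) => b0 b1 b2 b3 b4 b5 b6; lra.
Qed.

End YoungCost.
End ProcessBounds.

(** * Existence of a minimiser *)

Section Reduction.
Context {R : realType} {E : normedVectType R}.
Notation mu := (@lebesgue_measure R).

(** The lower bound makes the integral of the negative part finite; finiteness of the difference
    then rules out an infinite positive part. *)
Lemma bounded_below_integrable (D : set (measurableTypeR R)) (h : R -> R) (c : R) :
  measurable D -> (mu D < +oo)%E -> measurable_fun D h -> (forall t, D t -> - c <= h t) ->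
  (\int[mu]_(t in D) (h t)%:E)%E \is a fin_num -> mu.-integrable D (EFin \o h).
Proof.
move=> mD Dfin mh hc hfin.
have mhE : measurable_fun D (EFin \o h) by exact/measurable_EFinP.
have ci : mu.-integrable D (EFin \o (fun=> `|c|)) by exact: integrable_cst_fun.
have nfin : (\int[mu]_(t in D) (EFin \o h)^\- t < +oo)%E.
  apply: (@le_lt_trans _ _ (\int[mu]_(t in D) (`|c|)%:E)%E); last first.
    by rewrite -ge0_fin_numE ?integral_ge0//; exact: integrable_fin_num ci.
  apply: ge0_le_lower_integral => t Dt; first exact: funeneg_ge0.
  rewrite funenegE ge_max /= !lee_fin normr_ge0 andbT.
  by have := hc t Dt; have := ler_norm c; lra.
have pfin : (\int[mu]_(t in D) (EFin \o h)^\+ t < +oo)%E.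
  rewrite ltNge leye_eq; apply/negP => /eqP pE.
  move: hfin; rewrite integralE pE.
  by move: nfin; case: (\int[mu]_(t in D) _)%E.
apply/integrableP; split => //.
have -> : (\int[mu]_(t in D) `|(EFin \o h) t| =
    \int[mu]_(t in D) ((EFin \o h)^\+ t + (EFin \o h)^\- t))%E.
  by apply: eq_integral => t _; have /(congr1 (fun k => k t)) := fune_abse (EFin \o h).
rewrite ge0_integralD//; [|exact: measurable_funepos|exact: measurable_funeneg].
exact: lte_add_pinfty.
Qed.

Variables (T : R) (U : set E) (f : R -> E -> E) (g : R -> E -> 'End(E)).
Hypotheses (T0 : 0 < T) (cU : closed U).

Let I : set (measurableTypeR R) := `[0, T]%classic.
Let mI : measurable I. Proof. exact: measurable_itv. Qed.
Let Ifin : (mu I < +oo)%E. Proof. by rewrite (lebesgue_measure_0T T0) ltry. Qed.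

(** Continuity and coercivity of [phi] hold only on [U], so the control is altered on the null set
    where it leaves [U]. The new value is [u t0] for a time [t0] satisfying the constraint, which
    exists because [I] has positive measure. *)
Lemma constraint_everywhere (x u : R -> E) (xi : E) : measurable_control T u -> control_constraint T U u ->
  solution_upto f g T xi x u ->
  exists v : R -> E, [/\ measurable_control T v, forall t, I t -> U (v t), solution_upto f g T xi x v &
    exists2 S : set (measurableTypeR R), [/\ measurable S, S `<=` I & mu (I `\` S) = 0%E] &
      forall t, S t -> v t = u t].
Proof.
move=> mu_ cu [xac x0 dx].
pose S : set (measurableTypeR R) := I `&` u @^-1` U.
have mS : measurable S by exact: closed_preimage_measurable.
have SI : S `<=` I by exact: subIsetl.
have S0 : mu (I `\` S) = 0%E.
  have [N [mN N0 hN]] := cu; apply: (subset_measure0 _ mN _ N0); first exact: measurableD.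
  by move=> t [It nS]; apply: hN => h; apply: nS; split => //; exact: h.
have [t0 St0] : exists t0, S t0.
  apply/not_existsP => nS; have : mu I = 0%E.
    by rewrite -S0; congr (mu _); apply/seteqP; split => [t It|t []//]; split => // St; exact: (nS t).
  by rewrite (lebesgue_measure_0T T0) => -[] /eqP; rewrite gt_eqF.
pose w0 := u t0; have Uw : U w0 by have [] := St0.
pose v t := if `[< U (u t) >] then u t else w0.
have vS t : U (u t) -> v t = u t by move=> Ut; rewrite /v; case: asboolP.
exists v; split.
- apply: coord_measurable_control => i.
  have -> : (fun t => ecoord i (v t)) = (fun t => if `[<U (u t)>] then ecoord i (u t) else ecoord i w0).
    by apply/funext => t; rewrite /v; case: asboolP.
  apply: (measurable_fun_ifset (S := S)) => //.
    by apply/seteqP; split => t [It /=] => [/asboolP|/asboolP].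
  by apply: control_comp_measurable => //; exact: ecoord_continuous.
- by move=> t _; rewrite /v; case: asboolP.
- split => //; have := ae_and dx cu; apply: ae_mono => t [h1 h2] It.
  by rewrite vS; [exact: h1|exact: h2].
- by exists S => // t [_ /=]; exact: vS.
Qed.

End Reduction.

(** * Minimising sequences and their limit *)

Section Existence.
Context {R : realType} {E : normedVectType R} {d : nat}.
Notation mu := (@lebesgue_measure R).
Variables (T : R) (U : set E) (f : R -> E -> E) (g : R -> E -> 'End(E)).
Variables (phi : R -> E -> E -> R) (psi : R -> E -> 'Hom('rV[R]_d, R^o)).
Hypothesis T0 : 0 < T.
Hypothesis hf : {within [set z : R * E | z.1 \in `[0, T]], continuous (fun z => f z.1 z.2)}.
Hypothesis hg : lfun_continuous_in [set z : R * E | z.1 \in `[0, T]] (fun z => g z.1 z.2).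
Variables (kappa Cpsi alpha : R).
Hypotheses (kappa2 : 2^-1 < kappa) (Cpsi0 : 0 <= Cpsi) (alpha0 : 0 <= alpha).
Hypothesis hpsi : forall rho : R, 0 <= rho ->
     exists2 K : R, K <= Cpsi * (1 + rho `^ alpha) &
       forall (s t : R) (x y : E), s \in `[0, T] -> t \in `[0, T] ->
         `|x| <= rho -> `|y| <= rho ->
         opnorm (psi t x - psi s y)
           <= K * (`|t - s| `^ kappa + `|x - y| `^ kappa).
Hypotheses (cU : closed U) (vU : convex_set U).
Hypothesis hphi : {within [set z : R * E * E | z.1.1 \in `[0, T] /\ U z.2],
            continuous (fun z => phi z.1.1 z.1.2 z.2)}.
Hypothesis hphi_convex : forall (t : R) (x : E), t \in `[0, T] -> convex_function U (phi t x).
Variables (Cphi delta r : R).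
Hypotheses (Cphi0 : 0 < Cphi) (delta0 : 0 < delta) (r1 : 1 < r).
Hypothesis coercive : forall (t : R) (x u : E), t \in `[0, T] -> U u ->
     Cphi * (`|u| `^ r - `|x| `^ delta) <= phi t x u.
Variables (xi : E) (Cs Ce beta gamma : R).
Hypotheses (Cs0 : 0 <= Cs) (Ce0 : 0 <= Ce) (beta0 : 0 <= beta) (gamma0 : 0 <= gamma).
Hypothesis hgrowth : forall u : R -> E, control_class T U r u ->
     forall (x : R -> E) (T1 : R), local_solution T f g xi x u T1 ->
       (Lnorm_itv T1 r (derive1 x)
          <= Cs%:E * (1 + Lnorm_itv T r u `^ beta))%E /\
       (supnorm_itv T1 x <= Ce%:E * (1 + Lnorm_itv T r u `^ gamma))%E.
Hypothesis hexp1 : gamma * (alpha + kappa - 2^-1) + beta / 2 < r.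
Hypothesis hexp2 : gamma * delta < r.

Let I : set (measurableTypeR R) := `[0, T]%classic.
Let mI : measurable I. Proof. exact: measurable_itv. Qed.
Let Ifin : (mu I < +oo)%E. Proof. by rewrite (lebesgue_measure_0T T0) ltry. Qed.

(** Admissible processes after correction on a null set. No observation path occurs: the Young
    integral exists along every such process, so a process admissible for one path is a competitor
    for all paths. *)
Definition regular_process (x u : R -> E) : Prop :=
  [/\ measurable_control T u, forall t, I t -> U (u t), solution_upto f g T xi x u,
      mu.-integrable I (EFin \o (fun t => `|u t| `^ r)) &
      mu.-integrable I (EFin \o (fun t => phi t (x t) (u t)))].

Definition regular_cost (eta : R -> 'rV[R]_d) (x u : R -> E) : R :=
  \int[mu]_(t in I) phi t (x t) (u t) + young_integral T (fun t => psi t (x t)) eta.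

(** Coercivity solved for [|u|^r], the state being bounded. *)
Lemma control_powR_integrable (x u : R -> E) (rho : R) : measurable_control T u ->
  (forall t, I t -> U (u t)) -> (forall t, I t -> `|x t| <= rho) -> 
  mu.-integrable I (EFin \o (fun t => phi t (x t) (u t))) ->
  mu.-integrable I (EFin \o (fun t => `|u t| `^ r)).
Proof.
move=> mu_ Uu xr pi.
have mun := norm_control_measurable mu_.
apply: (@integrable_le _ _ _ (fun t => Cphi^-1 * phi t (x t) (u t) + rho `^ delta)) => //.
- by apply: integrableD_fun; [|exact: integrableZ_fun|exact: integrable_cst_fun].
- exact: (measurableT_comp (measurable_powR r) mun).
- move=> t It; rewrite ger0_norm ?powR_ge0// -lerBlDr mulrC ler_pdivlMr// mulrC.
  apply: le_trans (coercive (x t) It (Uu t It)); rewrite ler_wpM2l ?(ltW Cphi0)// lerB//.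
  have rho0 : 0 <= rho := le_trans (normr_ge0 _) (xr t It).
  by apply: ge0_ler_powR; rewrite ?nnegrE ?(ltW delta0)// xr.
Qed.

Lemma solution_continuous (x u : R -> E) : solution_upto f g T xi x u -> {within `[0, T], continuous x}.
Proof. by case=> xac _ _; exact: absolutely_continuous_within. Qed.

Lemma regular_of_admissible eta x u : admissible T U f g phi psi xi eta x u ->
  exists2 v, regular_process x v & cost T phi psi eta x u = (regular_cost eta x v)%:E.
Proof.
move=> [[[mu_ sol] cu] [yi cfin]].
have [v [mv Uv solv [S [mS SI S0] vS]]] := constraint_everywhere T0 cU mu_ cu sol.
have cx := solution_continuous solv.
have [rho rho0 xr] := compact_norm_bounded (@segment_compact _ 0 T) cx.
have eqI : (\int[mu]_(t in I) (phi t (x t) (u t))%:E = \int[mu]_(t in I) (phi t (x t) (v t))%:E)%E.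
  rewrite !(integral_ae_subset _ mI mS SI S0); apply: eq_integral => t.
  by rewrite inE => St; rewrite vS.
have pi : mu.-integrable I (EFin \o (fun t => phi t (x t) (v t))).
  apply: (bounded_below_integrable (c := Cphi * rho `^ delta)) => //.
  - exact: (running_cost_measurable T0 cU hphi).
  - move=> t It; apply: le_trans (coercive (x t) It (Uv t It)).
    rewrite -mulrN ler_wpM2l ?(ltW Cphi0)// -[leLHS]add0r; apply: lerD; first exact: powR_ge0.
    by rewrite lerN2; apply: ge0_ler_powR; rewrite ?nnegrE ?(ltW delta0)// xr.
  - rewrite -eqI; move: cfin; rewrite /cost fin_numD => /andP[]//.
exists v; first by split => //; exact: control_powR_integrable xr pi.
rewrite /cost /regular_cost EFinD; congr (_ + _)%E.
by rewrite -[LHS]/(\int[mu]_(t in I) (phi t (x t) (u t))%:E)%E eqI -(fineK (integrable_fin_num mI pi)).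
Qed.

Lemma admissible_of_regular eta x u : observation_path T eta -> regular_process x u ->
  admissible T U f g phi psi xi eta x u /\ cost T phi psi eta x u = (regular_cost eta x u)%:E.
Proof.
move=> heta [mu_ Uu sol ui pi].
have [C _ [rho _ hY]] := young_growth T0 hf hg r1 Cs0 Ce0 beta0 gamma0 hgrowth kappa2 Cpsi0 alpha0 hpsi hexp1 heta.
have [yi _] := hY x u mu_ Uu ui sol.
have cE : cost T phi psi eta x u = (regular_cost eta x u)%:E.
  rewrite /cost /regular_cost EFinD; congr (_ + _)%E.
  by rewrite -(fineK (integrable_fin_num mI pi)).
split => //; split; first by split => //; apply: aeW => t; exact: Uu.
by split => //; rewrite cE.
Qed.

Lemma minimiser_exists (eta : R -> 'rV[R]_d) (x0 u0 : R -> E) : observation_path T eta ->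
  regular_process x0 u0 -> exists x u, regular_process x u /\
    forall y v, regular_process y v -> regular_cost eta x u <= regular_cost eta y v.
Proof.
move=> heta reg0.
have [k k0 [D hD]] := cost_coercive T0 hf hg r1 Cs0 Ce0 beta0 gamma0 hgrowth kappa2 Cpsi0 alpha0
  hpsi hexp1 heta Cphi0 delta0 coercive hexp2.
have [C C0 [rho /andP[rho0 _] hY]] := young_growth T0 hf hg r1 Cs0 Ce0 beta0 gamma0 hgrowth kappa2 Cpsi0 alpha0
  hpsi hexp1 heta.
pose Sv := [set a | exists p : (R -> E) * (R -> E), regular_process p.1 p.2 /\ a = regular_cost eta p.1 p.2].
have Sinf : has_inf Sv.
  split; first by exists (regular_cost eta x0 u0); exists (x0, u0).
  exists (- D) => _ [[x u] /= [[mu_ Uu sol ui pi] ->]].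
  apply: le_trans (hD x u mu_ Uu ui sol pi); rewrite -[leLHS]add0r lerD2r mulr_ge0 ?(ltW k0)//.
  by apply: Rintegral_ge0 => t _; exact: powR_ge0.
have infle y v : regular_process y v -> inf Sv <= regular_cost eta y v.
  by move=> reg; apply: (ge_inf Sinf.2); exists (y, v).
have hseq (n : nat) : exists p : (R -> E) * (R -> E),
    regular_process p.1 p.2 /\ regular_cost eta p.1 p.2 < inf Sv + n.+1%:R^-1.
  have n0 : 0 < n.+1%:R^-1 :> R by rewrite invr_gt0.
  have [_ [p [reg ->]] lt] := inf_adherent n0 Sinf.
  by exists p.
have [p hp] := choice hseq.
pose x_ n := (p n).1; pose u_ n := (p n).2.
have mu_ n : measurable_control T (u_ n) by have [[]] := hp n.
have Uu_ n t : I t -> U (u_ n t) by have [[]] := hp n => _ h _ _ _ _; exact: h.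
have sol n : solution_upto f g T xi (x_ n) (u_ n) by have [[]] := hp n.
have ui n : mu.-integrable I (EFin \o (fun t => `|u_ n t| `^ r)) by have [[]] := hp n.
have pi n : mu.-integrable I (EFin \o (fun t => phi t (x_ n t) (u_ n t))) by have [[]] := hp n.
have costn n : regular_cost eta (x_ n) (u_ n) < inf Sv + n.+1%:R^-1 by have [] := hp n.
pose Mr := (inf Sv + 1 + D) / k.
have uM n : \int[mu]_(t in I) `|u_ n t| `^ r <= Mr.
  rewrite /Mr ler_pdivlMr// mulrC -lerBlDr.
  apply: le_trans (hD _ _ (mu_ n) (Uu_ n) (ui n) (sol n) (pi n)) _.
  apply: le_trans (ltW (costn n)) _; rewrite lerD2l invf_le1//.
  by rewrite ler1n.
pose M := Mr `^ r^-1.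
have r0 : 0 < r := lt_trans ltr01 r1.
have unM n : Lr_norm T r (u_ n) <= M.
  have i0 : 0 <= \int[mu]_(t in I) `|u_ n t| `^ r by apply: Rintegral_ge0 => t _; exact: powR_ge0.
  apply: ge0_ler_powR; rewrite ?nnegrE ?invr_ge0 ?(ltW r0)//; exact: le_trans i0 (uM n).
pose rb := sup_bound Ce gamma M.
have x_rb n t : I t -> `|x_ n t| <= rb.
  move=> It; apply: le_trans (sup_bound_le Ce0 gamma0 (Lr_norm_ge0 _ _ _) (unM n)).
  by have [_] := solution_bounds T0 hgrowth (mu_ n) (Uu_ n) (ui n) (sol n); apply.
have [F [FU Foo]] := ultraFilterLemma eventually_filter.
have FF : ProperFilter F by exact: ultra_proper.
have x_eq (e : R) : 0 < e -> exists2 del : R, 0 < del &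
     forall n s t, 0 <= s -> s <= t -> t <= T -> t - s < del -> `|x_ n t - x_ n s| <= e.
  move=> e0.
  have [del del0 hdel] := clock_equicontinuous T0 hf hg r1 Cs0 beta0 hgrowth mu_ Uu_ ui sol unM e0.
  exists del => // n s t s0 st tT ts; apply: le_trans (hdel n s t s0 st tT ts).
  exact: (clock_dist T0 hf hg r1 Cs0 hgrowth (mu_ n) (Uu_ n) (ui n) (sol n)).
have [x xc xu] := ultra_ascoli T0 FU x_rb x_eq.
have xb t : I t -> `|x t| <= rb by exact: x_rho_lim x_rb xu t.
have [u [mu' Uu uci wl lsc]] := weak_limit_control T0 cU vU hphi hphi_convex Cphi0 delta0 r1 coercive
  FU xc x_rb xu mu_ Uu_ ui uM pi.
have uL n := control_integrable T0 r1 (mu_ n) (ui n).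
have uL1 n : \int[mu]_(t in I) `|u_ n t| <= T + Mr.
  have i1 := Lr_integral_le mI Ifin r1 (norm_control_measurable (mu_ n)) (fun _ _ => normr_ge0 _)
    (ui n) mI (@subset_refl _ _) ltr01.
  apply: le_trans i1 _; rewrite powR1 !mul1r.
  have -> : fine (mu I) = T by rewrite (lebesgue_measure_0T T0).
  by rewrite lerD2l.
have [y soly yx] := solution_limit T0 hf hg FF xc x_rb xb xu mu_ uL uL1 sol uci wl.
have M0 : 0 <= M by exact: powR_ge0.
have Yn n : `|young_integral T (fun t => psi t (x_ n t)) eta| <= C * (1 + M) `^ rho.
  have [_ h] := hY _ _ (mu_ n) (Uu_ n) (ui n) (sol n); apply: le_trans h _.
  apply: ler_wpM2l; first exact: C0.
  apply: ge0_ler_powR; first exact: rho0.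
  - by rewrite nnegrE; apply: addr_ge0 => //; exact: Lr_norm_ge0.
  - by rewrite nnegrE; exact: addr_ge0.
  - by rewrite lerD2l; exact: unM.
(* The crude bound on the running costs, from that on the Young integrals, gives the integrability
   of the limit cost and thereby of [|u|^r], which is needed before the Young integral along the
   limit can be handled. *)
have [pxi _] : mu.-integrable I (EFin \o (fun t => phi t (x t) (u t))) /\
    \int[mu]_(t in I) phi t (x t) (u t) <= inf Sv + 1 + C * (1 + M) `^ rho.
  apply: lsc; apply: nearW => n; have := ltW (costn n); rewrite /regular_cost.
  have : n.+1%:R^-1 <= 1 :> R by rewrite invf_le1// ler1n.
  have := Yn n; rewrite ler_norml => /andP[].
  move: (n.+1%:R^-1) (\int[mu]_(t in I) _) (young_integral _ _ _) (C * _) => b1 b2 b3 b4; lra.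
have pyE t : I t -> phi t (y t) (u t) = phi t (x t) (u t) by move=> It; rewrite yx.
have pyi : mu.-integrable I (EFin \o (fun t => phi t (y t) (u t))).
  by apply: eq_integrable pxi => // t; rewrite inE => It /=; rewrite pyE.
have u_i : mu.-integrable I (EFin \o (fun t => `|u t| `^ r)) by exact: control_powR_integrable xb pxi.
have regy : regular_process y u by [].
exists y, u; split => // z v regz; apply: le_trans (infle _ _ regz).
(* [young_limit] asks for one bound on the norms of the sequence and of the limit. *)
pose M2 := Num.max M (Lr_norm T r u).
have yu (e : R) : 0 < e -> \forall n \near F, forall t, I t -> `|x_ n t - y t| < e.
  by move=> e0; apply: filterS (xu e e0) => n h t It; rewrite yx// h.
have unM2 n : Lr_norm T r (u_ n) <= M2 by apply: le_trans (unM n) _; rewrite le_max lexx.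
have uM2 : Lr_norm T r u <= M2 by rewrite le_max lexx orbT.
have Ycvg := young_limit T0 hf hg r1 Cs0 Ce0 beta0 gamma0 hgrowth kappa2 Cpsi0 hpsi hexp1 heta
  FF mu_ Uu_ ui sol unM2 mu' Uu u_i soly uM2 yu.
apply/ler_addgt0Pl => e e0; have e2 : 0 < e / 2 by rewrite divr_gt0.
set Y := young_integral T (fun t => psi t (y t)) eta in Ycvg.
have near_le : \forall n \near F, \int[mu]_(t in I) phi t (x_ n t) (u_ n t) <= inf Sv - Y + e.
  have n1 : \forall n \near F, n.+1%:R^-1 < e / 2.
    by apply: Foo; exact: (near_infty_natSinv_lt (PosNum e2)).
  move/cvgrPdist_lt/(_ _ e2) : Ycvg => n2; apply: filterS2 n1 n2 => n h1.
  rewrite ltr_norml => /andP[h2 h3]; have := costn n; rewrite /regular_cost.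
  move: h1 h2 h3; move: (n.+1%:R^-1) (\int[mu]_(t in I) _) (young_integral _ _ _) => b1 b2 b3; lra.
have [_ fin] := lsc _ near_le.
rewrite /regular_cost -/Y.
have -> : \int[mu]_(t in I) phi t (y t) (u t) = \int[mu]_(t in I) phi t (x t) (u t).
  by apply: eq_Rintegral => t; rewrite inE => It; exact: pyE.
by rewrite -lerBrDr (addrC e) addrAC.
Qed.

End Existence.

Theorem theorem1 (R : realType) (T : R) (hT : 0 < T)
  (E : normedVectType R) (d : nat) (U : set E)
  (f : R -> E -> E) (g : R -> E -> 'End(E))
  (phi : R -> E -> E -> R) (psi : R -> E -> 'Hom('rV[R]_d, R^o))
  (* (i) *)
  (hf : {within [set z : R * E | z.1 \in `[0, T]], continuous (fun z => f z.1 z.2)})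
  (hg : lfun_continuous_in [set z : R * E | z.1 \in `[0, T]]
          (fun z => g z.1 z.2))
  (* (ii) *)
  (kappa Cpsi alpha : R) (hkappa : 2^-1 < kappa)
  (hCpsi : 0 <= Cpsi) (halpha : 0 <= alpha)
  (hpsi : forall rho : R, 0 <= rho ->
     exists2 K : R, K <= Cpsi * (1 + rho `^ alpha) &
       forall (s t : R) (x y : E), s \in `[0, T] -> t \in `[0, T] ->
         `|x| <= rho -> `|y| <= rho ->
         opnorm (psi t x - psi s y)
           <= K * (`|t - s| `^ kappa + `|x - y| `^ kappa))
  (* (iii) *)
  (hUclosed : closed U) (hUconvex : convex_set U)
  (* (iv) *)
  (hphi : {within [set z : R * E * E | z.1.1 \in `[0, T] /\ U z.2],
            continuous (fun z => phi z.1.1 z.1.2 z.2)})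
  (hphi_convex : forall (t : R) (x : E), t \in `[0, T] ->
     convex_function U (phi t x))
  (Cphi delta r : R) (hCphi : 0 < Cphi) (hdelta : 0 < delta) (hr : 1 < r)
  (hphi_coercive : forall (t : R) (x u : E), t \in `[0, T] -> U u ->
     Cphi * (`|u| `^ r - `|x| `^ delta) <= phi t x u)
  (* (v) *)
  (xi : E) (Cs Ce beta gamma : R)
  (hCs : 0 <= Cs) (hCe : 0 <= Ce) (hbeta : 0 <= beta) (hgamma : 0 <= gamma)
  (hgrowth : forall u : R -> E, control_class T U r u ->
     forall (x : R -> E) (T1 : R), local_solution T f g xi x u T1 ->
       (Lnorm_itv T1 r (derive1 x)
          <= Cs%:E * (1 + Lnorm_itv T r u `^ beta))%E /\
       (supnorm_itv T1 x <= Ce%:E * (1 + Lnorm_itv T r u `^ gamma))%E)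
  (hexp1 : gamma * (alpha + kappa - 2^-1) + beta / 2 < r)
  (hexp2 : gamma * delta < r)
  (* an admissible process, for some observation path *)
  (eta0 : R -> 'rV[R]_d) (heta0 : observation_path T eta0)
  (x0 u0 : R -> E)
  (hadm : admissible T U f g phi psi xi eta0 x0 u0) :
  forall eta : R -> 'rV[R]_d, observation_path T eta ->
    exists x u : R -> E,
      minimiser T U f g phi psi xi eta x u /\ (Lnorm_itv T r u < +oo)%E.
Proof.
move=> eta heta.
(* The given process is admissible for [eta0]; regularity forgets the path, so there is a competitor
   for [eta] as well. *)
have [u1 reg0 _] := regular_of_admissible hT hUclosed hphi hCphi hdelta hphi_coercive hadm.
have [x [u [reg hmin]]] := minimiser_exists hT hf hg hkappa hCpsi halpha hpsi hUclosed hUconvex hphi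
  hphi_convex hCphi hdelta hr hphi_coercive hCs hCe hbeta hgamma hgrowth hexp1 hexp2 heta reg0.
exists x, u.
have adm := admissible_of_regular hT hf hg hkappa hCpsi halpha hpsi hr hCs hCe hbeta hgamma hgrowth
  hexp1 heta.
have [axu cxu] := adm _ _ _ reg.
split; last by have [_ _ _ ui _] := reg; rewrite Lnorm_itvE// ltry.
split=> // y v /(regular_of_admissible hT hUclosed hphi hCphi hdelta hphi_coercive)[v' regv ->].
by rewrite cxu lee_fin hmin.
Qed.
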